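(* There exist universal constants $C, C_1, C_2 > 0$ such that the following holds. Let $\|\cdot\|_g$ and $\|\cdot\|_e$ be semi-norms on $\mathbb{R}^p$, let $(x,y) \in \mathbb{R}^p \times \mathbb{R}$ be a joint random pair such that $x$ exhibits generic Bernstein concentration with respect to $(\|\cdot\|_g, \|\cdot\|_e)$ and $y$ is sub-exponential. Let $K \subset \mathbb{R}^p$ be convex, set $K^\Delta := \operatorname{span}(K-K) \cap \mathbb{S}^{p-1}$, and assume that $Q_{2\tau}(K^\Delta, x) > 0$ for some $\tau > 0$. Let $(x_1,y_1), \dots, (x_n,y_n)$ be independent copies of $(x,y)$. Fix a vector $\beta^\natural \in K$. Then for every $u \ge 8$ and $t \ge 0$, the following holds true with probability at least $1 - 5\exp(-C u^2) - 2\exp(-C\sqrt{n})$: If $$n \ge C_1 \cdot \bigg(\frac{q_{t,n}^{(g,e)}(K - \beta^\natural) + \tau \cdot u}{\tau \cdot Q_{2\tau}(K^\Delta, x)}\bigg)^2$$ and $$t \ge C_2 \cdot \frac{1}{(\tau \cdot Q_{2\tau}(K^\Delta, x))^2} \cdot \bigg[\rho_t(\beta^\natural) + u^2 \cdot \sigma(\beta^\natural) \cdot \frac{m_t^{(g,e)}(K - \beta^\natural)}{\sqrt{n}}\bigg]_+,$$ then every minimizer $\hat\beta$ of $$\min_{\beta \in K} \ \tfrac{1}{n}\sum_{i=1}^n (y_i - \langle x_i, \beta\rangle)^2$$ satisfies $\|\hat\beta - \beta^\natural\|_2 \le t$.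
   Context: Notation: $\mathbb{S}^{p-1}$ is the Euclidean unit sphere in $\mathbb{R}^p$; $\operatorname{span}$, $\operatorname{cone}$, $\operatorname{conv}$ denote linear, conic and convex hull; $[s]_+ := \max\{s,0\}$. A constant is universal if its value does not depend on any other involved parameter. Measure-theoretic issues are disregarded. Sub-exponential: $\|Z\|_{\psi_1} := \inf\{s > 0 : \mathbb{E}[\exp(|Z|/s)] \le 2\}$; a random variable $Z$ is sub-exponential if $\|Z\|_{\psi_1} < \infty$. Generic Bernstein concentration: a random vector $x \in \mathbb{R}^p$ exhibits generic Bernstein concentration with respect to semi-norms $(\|\cdot\|_g, \|\cdot\|_e)$ if for all $v \in \mathbb{R}^p$ and $s \ge 0$, $$\mathbb{P}(|\langle x, v\rangle| \ge s) \le 2\exp\Big(-\min\Big\{\tfrac{s^2}{\|v\|_g^2}, \tfrac{s}{\|v\|_e}\Big\}\Big),$$ where $\exp(-\infty) := 0$, and $s/0 := \infty$ for $s > 0$, $0/0 := 0$. $\gamma$-functional: for a set $L$ with pseudo-metric $d$ and $\alpha \in \{1,2\}$, $\gamma_\alpha(L,d) := \inf \sup_{v \in L} \sum_{s=0}^\infty 2^{s/\alpha} \Delta(A_s(v))$, where the infimum is over all increasing sequences $(\mathcal{A}_s)_{s \ge 0}$ of partitions of $L$ (every $A \in \mathcal{A}_{s+1}$ is contained in some $B \in \mathcal{A}_s$) with $|\mathcal{A}_0| = 1$ and $|\mathcal{A}_s| \le 2^{2^s}$ for $s \ge 1$, $A_s(v)$ is the element of $\mathcal{A}_s$ containing $v$,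 and $\Delta$ is the diameter with respect to $d$. For a semi-norm $\|\cdot\|$, $\gamma_\alpha(L, \|\cdot\|)$ uses the induced pseudo-metric. Local complexities for $L \subset \mathbb{R}^p$ and $t > 0$: $$q_{t,n}^{(g,e)}(L) := \tfrac{1}{t}\inf\Big\{\tfrac{\gamma_1(S,\|\cdot\|_e)}{\sqrt{n}} + \gamma_2(S, \|\cdot\|_g + \|\cdot\|_e) : S \subset \mathbb{R}^p, \operatorname{conv}(S) \supset L \cap t\mathbb{S}^{p-1}\Big\},$$ $$m_t^{(g,e)}(L) := \tfrac{1}{t}\inf\Big\{\gamma_1(S,\|\cdot\|_e) + \gamma_2(S, \|\cdot\|_g) : S \subset \mathbb{R}^p, \operatorname{conv}(S) \supset (L \cap t\mathbb{S}^{p-1}) \cup \{0\}\Big\}.$$ Conic complexities (case $t = 0$): $$q_{0,n}^{(g,e)}(L) := \inf\Big\{\tfrac{\gamma_1(S,\|\cdot\|_e)}{\sqrt{n}} + \gamma_2(S, \|\cdot\|_g + \|\cdot\|_e) : S \subset \mathbb{R}^p, \operatorname{conv}(S) \supset \operatorname{cone}(L) \cap \mathbb{S}^{p-1}\Big\},$$ $$m_0^{(g,e)}(L) := \inf\Big\{\gamma_1(S,\|\cdot\|_e) + \gamma_2(S, \|\cdot\|_g) : S \subset \mathbb{R}^p, \operatorname{conv}(S) \supset (\operatorname{cone}(L) \cap \mathbb{S}^{p-1}) \cup \{0\}\Big\}.$$ Small-ball function: $Q_\theta(L, x) := \inf_{v \in L} \mathbb{P}(|\langle x, v\rangle| \ge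 \theta)$ for $\theta \ge 0$. Mismatch parameters: $\sigma(\beta^\natural) := \|y - \langle x, \beta^\natural\rangle\|_{\psi_1}$ and, for $t \ge 0$, $\rho_t(\beta^\natural) := \sup_{v \in K^t} \big\langle \mathbb{E}[(y - \langle x, \beta^\natural\rangle) x], v\big\rangle$, where $K^t := \tfrac{1}{t}(K - \beta^\natural) \cap \mathbb{S}^{p-1}$ for $t > 0$ and $K^0 := \operatorname{cone}(K - \beta^\natural) \cap \mathbb{S}^{p-1}$. *)

(* Defs.v *)
From HB Require Import structures.
From mathcomp Require Import all_boot all_order all_algebra.
From mathcomp Require Import all_classical all_reals all_analysis.

Set Implicit Arguments.
Unset Strict Implicit.
Unset Printing Implicit Defensive.

Import Order.TTheory GRing.Theory Num.Theory.
Import numFieldNormedType.Exports.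

Local Open Scope classical_set_scope.
Local Open Scope ring_scope.

(** * Euclidean space *)

Definition dot (R : realType) (p : nat) (u v : 'rV[R]_p) : R :=
  \sum_(i < p) u ord0 i * v ord0 i.

(** The library norm [`|v|] on row vectors is the sup norm, hence [norm2]. *)
Definition norm2 (R : realType) (p : nat) (v : 'rV[R]_p) : R :=
  Num.sqrt (dot v v).

Definition sphere (R : realType) (p : nat) : set 'rV[R]_p :=
  [set v | norm2 v = 1].
Arguments sphere R p : clear implicits.

Definition scale_set (R : realType) (p : nat) (a : R) (L : set 'rV[R]_p) :
  set 'rV[R]_p := [set a *: v | v in L].

Definition translate (R : realType) (p : nat) (L : set 'rV[R]_p)
    (b : 'rV[R]_p) : set 'rV[R]_p := [set v - b | v in L].

Definition set_diff (R : realType) (p : nat) (L : set 'rV[R]_p) :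
  set 'rV[R]_p := [set v - w | v in L & w in L].

Definition linear_subspace (R : realType) (p : nat) (V : set 'rV[R]_p) : Prop :=
  V 0 /\ forall (a : R) (u v : 'rV[R]_p), V u -> V v -> V (a *: u + v).

Definition convex_cone (R : realType) (p : nat) (V : set 'rV[R]_p) : Prop :=
  V 0 /\ forall (a b : R) (u v : 'rV[R]_p),
    0 <= a -> 0 <= b -> V u -> V v -> V (a *: u + b *: v).

Definition span_hull (R : realType) (p : nat) (L : set 'rV[R]_p) :
  set 'rV[R]_p := smallest (@linear_subspace R p) L.

Definition cone_hull (R : realType) (p : nat) (L : set 'rV[R]_p) :
  set 'rV[R]_p := smallest (@convex_cone R p) L.

Definition conv_hull (R : realType) (p : nat) (L : set 'rV[R]_p) :
  set 'rV[R]_p := smallest (@convex_set R 'rV[R]_p) L.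

(** The library class [semiNormedZmodType] does not ask for homogeneity with
    respect to real scalars. *)
Definition seminorm (R : realType) (p : nat) (N : 'rV[R]_p -> R) : Prop :=
  (forall u v, N (u + v) <= N u + N v) /\
  (forall (a : R) v, N (a *: v) = `|a| * N v).

(** * The gamma-functional *)

Definition diameter (R : realType) (V : Type) (d : V -> V -> R) (A : set V) :
  \bar R := ereal_sup [set (d v w)%:E | v in A & w in A].

(** A partition is a set of subsets of [L]; its blocks are nonempty. *)
Definition admissible_sequence (V : Type) (L : set V)
    (A : nat -> set (set V)) : Prop :=
  [/\ forall s, partition (A s) id L,
      forall s B, A s.+1 B -> exists2 B', A s B' & B `<=` B',
      (A 0%N #= `I_1)%card
    & forall s, (0 < s)%N -> (A s #<= `I_(2 ^ (2 ^ s))%N)%card].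

Definition gamma_dist (R : realType) (V : Type) (alpha : nat) (L : set V)
    (d : V -> V -> R) : \bar R :=
  ereal_inf
    [set ereal_sup
        [set (\sum_(0 <= s <oo)
                (2 `^ (s%:R / alpha%:R))%:E * diameter d (pblock (A s) id v))%E
        | v in L]
    | A in admissible_sequence L].

Definition gamma (R : realType) (p : nat) (alpha : nat) (L : set 'rV[R]_p)
    (N : 'rV[R]_p -> R) : \bar R :=
  gamma_dist alpha L (fun v w => N (v - w)).

(** * Complexity parameters *)

Definition q_bound (R : realType) (p n : nat) (Ng Ne : 'rV[R]_p -> R)
    (M : set 'rV[R]_p) : \bar R :=
  ereal_inf
    [set (gamma 1 S Ne / (Num.sqrt n%:R)%:E + gamma 2 S (Ng \+ Ne)%R)%E
    | S in [set S | M `<=` conv_hull S]].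

Definition m_bound (R : realType) (p : nat) (Ng Ne : 'rV[R]_p -> R)
    (M : set 'rV[R]_p) : \bar R :=
  ereal_inf
    [set (gamma 1 S Ne + gamma 2 S Ng)%E
    | S in [set S | M `|` [set 0] `<=` conv_hull S]].

Definition q_complexity (R : realType) (p n : nat) (Ng Ne : 'rV[R]_p -> R)
    (t : R) (L : set 'rV[R]_p) : \bar R :=
  if t == 0 then q_bound n Ng Ne (cone_hull L `&` sphere R p)
  else ((t^-1)%:E * q_bound n Ng Ne (L `&` scale_set t (sphere R p)))%E.

Definition m_complexity (R : realType) (p : nat) (Ng Ne : 'rV[R]_p -> R)
    (t : R) (L : set 'rV[R]_p) : \bar R :=
  if t == 0 then m_bound Ng Ne (cone_hull L `&` sphere R p)
  else ((t^-1)%:E * m_bound Ng Ne (L `&` scale_set t (sphere R p)))%E.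

(** * Probability *)

(** [R^p] with its Borel sigma-algebra. *)
Definition borel_rV (R : realType) (p : nat) :=
  g_sigma_algebraType (@open 'rV[R]_p).

(** Independent copies of [Z0]: every [Z i] has the law of [Z0], and the family
    is mutually independent. Subfamilies are covered by taking [B i = setT]. *)
Definition independent_copies (d d' : measure_display) (T : measurableType d)
    (T' : measurableType d') (R : realType) (P : probability T R) (n : nat)
    (Z0 : T -> T') (Z : 'I_n -> T -> T') : Prop :=
  (forall i B, measurable B -> P (Z i @^-1` B) = P (Z0 @^-1` B)) /\
  (forall B : 'I_n -> set T', (forall i, measurable (B i)) ->
    P (\bigcap_i (Z i @^-1` B i)) = (\prod_(i < n) P (Z i @^-1` B i))%E).

Definition psi1_norm (d : measure_display) (T : measurableType d)
    (R : realType) (P : probability T R) (Z : T -> R) : \bar R :=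
  ereal_inf [set s%:E | s in
    [set s : R | 0 < s /\ ('E_P[fun w => expR (`|Z w| / s)] <= 2%:E)%E]].

Definition sub_exponential (d : measure_display) (T : measurableType d)
    (R : realType) (P : probability T R) (Z : T -> R) : Prop :=
  (psi1_norm P Z < +oo)%E.

(** In [\bar R], [0^-1 = +oo] and [0 * +oo = 0], so that [s / 0 = +oo] for
    [0 < s] and [0 / 0 = 0]; moreover [expeR -oo = 0]. *)
Definition generic_bernstein (d : measure_display) (T : measurableType d)
    (R : realType) (P : probability T R) (p : nat) (x : T -> 'rV[R]_p)
    (Ng Ne : 'rV[R]_p -> R) : Prop :=
  forall (v : 'rV[R]_p) (s : R), 0 <= s ->
    (P [set w | (s <= `|dot (x w) v|)%R] <=
     2%:E * expeR (- mine ((s ^+ 2)%:E / (Ng v ^+ 2)%:E)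
                          (s%:E / (Ne v)%:E)))%E.

(** The infimum over the empty set is [+oo]. *)
Definition small_ball (d : measure_display) (T : measurableType d)
    (R : realType) (P : probability T R) (p : nat) (theta : R)
    (L : set 'rV[R]_p) (x : T -> 'rV[R]_p) : \bar R :=
  ereal_inf [set P [set w | theta <= `|dot (x w) v|] | v in L].

(** * Mismatch parameters and least squares *)

Definition residual (R : realType) (T : Type) (p : nat) (x : T -> 'rV[R]_p)
    (y : T -> R) (b : 'rV[R]_p) : T -> R := fun w => y w - dot (x w) b.

Definition sigma_mismatch (d : measure_display) (T : measurableType d)
    (R : realType) (P : probability T R) (p : nat) (x : T -> 'rV[R]_p)
    (y : T -> R) (b : 'rV[R]_p) : \bar R := psi1_norm P (residual x y b).

Definition normalized_set (R : realType) (p : nat) (K : set 'rV[R]_p)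
    (b : 'rV[R]_p) (t : R) : set 'rV[R]_p :=
  (if t == 0 then cone_hull (translate K b)
   else scale_set t^-1 (translate K b)) `&` sphere R p.

Definition mismatch_mean (d : measure_display) (T : measurableType d)
    (R : realType) (P : probability T R) (p : nat) (x : T -> 'rV[R]_p)
    (y : T -> R) (b : 'rV[R]_p) : 'rV[R]_p :=
  \row_(j < p) fine 'E_P[fun w => residual x y b w * x w ord0 j].

Definition rho_mismatch (d : measure_display) (T : measurableType d)
    (R : realType) (P : probability T R) (p : nat) (x : T -> 'rV[R]_p)
    (y : T -> R) (K : set 'rV[R]_p) (b : 'rV[R]_p) (t : R) : \bar R :=
  ereal_sup [set (dot (mismatch_mean P x y b) v)%:E
            | v in normalized_set K b t].

Definition empirical_risk (R : realType) (p n : nat) (X : 'I_n -> 'rV[R]_p)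
    (Y : 'I_n -> R) (b : 'rV[R]_p) : R :=
  n%:R^-1 * \sum_(i < n) (Y i - dot (X i) b) ^+ 2.

Definition minimizer (R : realType) (V : Type) (K : set V) (f : V -> R)
    (b : V) : Prop := K b /\ forall b', K b' -> f b <= f b'.

(* Main.v *)
(* If a minimizer is at distance [r > t] from [beta], let [v] be the unit vector from
   [beta] towards it. By convexity [v] lies in [normalized_set K beta t], and comparing
   the risks at the minimizer and at [beta] gives [r * Quad v <= 2 * Mult v], where
   [Quad v] is the empirical mean of [<x_i, v>^2] and [Mult v] that of
   [(y_i - <x_i, beta>) <x_i, v>]. So it suffices that, uniformly in [v],
   [Quad v >= tau^2 Q / 8] and [Mult v <= rho_t + u^2 sigma m_t / sqrt n].

   Quadratic part: [<x, v>^2] dominates a multiple of a Lipschitz truncation of [|<x, v>|]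
   whose mean is at least [Q]. The exponential moments of the supremum of the centered
   truncations are bounded by replacing one observation at a time, which performs
   concentration, symmetrization and contraction in a single step; here the law of [x] is
   first discretized, so that all expectations are finite sums. The resulting Rademacher
   walk is bounded by chaining.

   Multiplier part: chaining again, a link at level [s] being split at the height where its
   Bernstein exponent reaches [min (n / q) (sqrt n)], [q = u^2 2^s]. The low part has
   sub-exponential products and obeys Bernstein's inequality; the high part is bounded by
   the Cauchy-Schwarz inequality, using an exponential moment of its Bernstein exponent.

   Both bounds are proved for finite sets of directions and extended to all directions
   along a countable dense set. *)

Require Import Defs.
From HB Require Import structures.
From mathcomp Require Import all_boot all_order all_algebra.
From mathcomp Require Import finmap.
From mathcomp Require Import all_classical all_reals all_analysis.
From mathcomp Require Import measurable_realfun.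
From mathcomp Require Import ring lra.

Set Implicit Arguments.
Unset Strict Implicit.
Unset Printing Implicit Defensive.

Import Order.TTheory GRing.Theory Num.Theory.
Import numFieldNormedType.Exports.

Local Open Scope classical_set_scope.
Local Open Scope ring_scope.

(** * Exponential inequalities *)

(** In the multiplier process [xi * <x, v>] is a product of two sub-exponential variables; such a
    product has in general no exponential moment, so Bernstein's inequality does not apply to it
    directly. With [b = sqrt n] and [r = u * 2^(s/2)] at level [s], the cut bounds the low part of a
    link by [b * (g / r + e)], where [g] and [e] are its two norms. Bernstein's inequality then
    gives a deviation [sg * b * (r * g + r^2 * e)], and summing over a chain produces
    [gamma_2 + gamma_1]. The high part needs a bound on the sum of the [xi^2], which fails with
    probability of order [exp (- sqrt n / 2)]: this is the source of the term in [sqrt n]. In the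
    quadratic process, a finite alphabet makes the law of a sample an iterated finite sum, so
    symmetrization reduces to convexity properties of a functional that can be carried through an
    induction. A chain only controls increments from its base point. In a Rademacher walk the base
    point has mean zero; in the multiplier process it is removed by means of the vector 0, which is
    why [m_bound] adjoins 0 to the set and [q_bound] does not. *)

Ltac nonneg := lazymatch goal with
  | |- is_true (0 <= _ * _) => apply: mulr_ge0; nonneg
  | |- is_true (0 <= _ + _) => apply: addr_ge0; nonneg
  | |- is_true (0 <= _^-1) => rewrite invr_ge0; nonneg
  | |- is_true (0 <= expR _) => exact: expR_ge0
  | |- is_true (0 <= `|_|) => exact: normr_ge0
  | |- is_true (0 <= Num.sqrt _) => exact: sqrtr_ge0
  | |- is_true (0 <= _%:R) => exact: ler0n
  | |- is_true (0 <= 1) => exact: ler01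
  | |- is_true (0 <= _ ^+ 2) => exact: sqr_ge0
  | |- is_true (0 <= _ ^+ _) => apply: exprn_ge0; nonneg
  | |- _ => first [assumption | by apply: ltW]
  end.

Section ExpBounds.
Variable R : realType.
Implicit Types x y z : R.

Lemma id_le_expR x : x <= expR x.
Proof. by have := expR_ge1Dx x; lra. Qed.

(** Second-order Taylor bound, derived from [1 + x <= expR x] alone: [expR z - 1 <= z * expR z]
    follows on multiplying [1 - z <= expR (- z)] by [expR z], and a further multiplication by [z]
    yields the quadratic remainder. *)
Lemma expR_le_quad z : expR z <= 1 + z + z ^+ 2 * expR `|z|.
Proof.
have hN x : 1 - x <= expR (- x) by have := expR_ge1Dx (- x); lra.
have hM x : expR x * expR (- x) = 1 by rewrite -expRD subrr expR0.
case: (lerP 0 z) => z0.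
  rewrite ger0_norm //.
  have h1 : expR z - 1 <= z * expR z.
    have := ler_wpM2l (expR_ge0 z) (hN z); rewrite hM; lra.
  have := ler_wpM2l z0 h1; rewrite mulrA -expr2; lra.
rewrite ltr0_norm //.
have [y yE] : exists y, z = - y by exists (- z); rewrite opprK.
rewrite yE opprK sqrrN; rewrite yE oppr_lt0 in z0.
have y0 : 0 <= y by exact: ltW.
have h1 : 1 - expR (- y) <= y by have := hN y; lra.
have h3 : y * expR (- y) <= 1 - expR (- y).
  have := ler_wpM2l (expR_ge0 (- y)) (expR_ge1Dx y).
  by rewrite [expR (- y) * expR y]mulrC hM; lra.
have h2 := ler_wpM2l y0 h1.
have h4 : 1 <= expR y by have := expR_ge1Dx y; lra.
have := ler_wpM2l (sqr_ge0 y) h4; rewrite expr2 in h2 *; lra.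
Qed.

Lemma add_expRN_le z : expR z + expR (- z) <= 2 * (1 + z ^+ 2 * expR `|z|).
Proof.
have := expR_le_quad z; have := expR_le_quad (- z).
by rewrite normrN sqrrN; lra.
Qed.

Lemma affine_le_expR (c w : R) : 0 <= c -> 0 <= w -> 1 + c * expR w <= expR (w + c).
Proof.
move=> c0 w0; have h : 1 <= expR w by have := expR_ge1Dx w; lra.
by rewrite expRD; have := expR_ge1Dx c => /(ler_wpM2l (expR_ge0 w)); lra.
Qed.

Lemma add_expR_le (x y : R) : expR (x + y) <= (expR (2 * x) + expR (2 * y)) / 2.
Proof.
rewrite expRD !expRM_natl.
by have := sqr_ge0 (expR x - expR y); lra.
Qed.

End ExpBounds.

(** * Suprema over a finite alphabet *)

Section IteratedExpectation.
Variables (R : realType) (I : finType) (p : I -> R).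
Hypothesis p_ge0 : forall i, 0 <= p i.
Hypothesis p_sum1 : \sum_i p i = 1.

(** Expectation over [n] independent draws from the law [p]. The recursion makes conditioning on the
    first draw definitional and requires no product measure. *)
Fixpoint iexp (n : nat) (h : seq I -> R) : R :=
  if n is m.+1 then \sum_i p i * iexp m (fun z => h (i :: z)) else h [::].

Lemma eq_iexp n h1 h2 : h1 =1 h2 -> iexp n h1 = iexp n h2.
Proof.
elim: n h1 h2 => [|n IH] h1 h2 h12 /=; first exact: h12.
by apply: eq_bigr => i _; rewrite (IH _ (fun z => h2 (i :: z))).
Qed.

Lemma le_iexp n h1 h2 : (forall z, size z = n -> h1 z <= h2 z) ->
  iexp n h1 <= iexp n h2.
Proof.
elim: n h1 h2 => [|n IH] h1 h2 h12 /=; first exact: h12.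
apply: ler_sum => i _; apply: ler_wpM2l => //.
by apply: IH => z zn; apply: h12; rewrite /= zn.
Qed.

Lemma iexpD n h1 h2 : iexp n (fun z => h1 z + h2 z) = iexp n h1 + iexp n h2.
Proof.
elim: n h1 h2 => [|n IH] h1 h2 //=.
by rewrite -big_split /=; apply: eq_bigr => i _; rewrite IH mulrDr.
Qed.

Lemma iexpZ n c h : iexp n (fun z => c * h z) = c * iexp n h.
Proof.
elim: n h => [|n IH] h //=.
by rewrite mulr_sumr; apply: eq_bigr => i _; rewrite IH mulrCA.
Qed.

Lemma iexp_cst n c : iexp n (fun=> c) = c.
Proof. by elim: n => [|n IH] //=; rewrite -mulr_suml p_sum1 IH mul1r. Qed.

Lemma iexp_sum n (K : Type) (s : seq K) (P : pred K) (h : K -> seq I -> R) :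
  iexp n (fun z => \sum_(k <- s | P k) h k z) = \sum_(k <- s | P k) iexp n (h k).
Proof.
elim: s => [|k s IH].
  by rewrite big_nil (eq_iexp _ (h2 := fun=> 0)) ?iexp_cst // => z; rewrite big_nil.
rewrite big_cons; case: ifP => Pk.
  rewrite -IH -iexpD; apply: eq_iexp => z; by rewrite big_cons Pk.
by rewrite -IH; apply: eq_iexp => z; rewrite big_cons Pk.
Qed.

Lemma iexp_prod n (f : I -> R) :
  iexp n (fun z => \prod_(i <- z) f i) = (\sum_i p i * f i) ^+ n.
Proof.
elim: n => [|n IH] /=; first by rewrite big_nil expr0.
rewrite exprS -IH mulr_suml; apply: eq_bigr => i _; rewrite -mulrA; congr (_ * _).
by rewrite -iexpZ; apply: eq_iexp => z; rewrite big_cons.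
Qed.

Lemma iexp_tuple n (h : seq I -> R) :
  iexp n h = \sum_(z : n.-tuple I) (\prod_(i <- z) p i) * h z.
Proof.
elim: n h => [|n IH] h /=.
  rewrite (big_pred1 [tuple]) => [|z]; first by rewrite big_nil mul1r.
  by rewrite (tuple0 z) /= eqxx.
under eq_bigr do rewrite IH mulr_sumr.
rewrite pair_bigA /=.
rewrite (reindex (fun z : n.+1.-tuple I => (thead z, [tuple of behead z]))) /=.
  apply: eq_bigr => z _; case/tupleP: z => i z.
  by rewrite theadE /= big_cons mulrA.
exists (fun q : I * n.-tuple I => [tuple of q.1 :: q.2]) => z _.
  by case/tupleP: z => i z; apply: val_inj.
by case: z => i z /=; congr (_, _); apply: val_inj.
Qed.

Lemma iexp_markov n (A : pred (seq I)) h s :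
  (forall z, size z = n -> 0 <= h z) ->
  (forall z, size z = n -> A z -> s <= h z) ->
  s * \sum_(z : n.-tuple I | A z) \prod_(i <- z) p i <= iexp n h.
Proof.
move=> h0 hA; rewrite iexp_tuple mulr_sumr [leLHS]big_mkcond /=.
have p0 (z : seq I) : 0 <= \prod_(i <- z) p i by apply: prodr_ge0.
apply: ler_sum => z _; case: ifPn => Az.
  by rewrite mulrC ler_wpM2l// hA// size_tuple.
by rewrite mulr_ge0// h0// size_tuple.
Qed.

End IteratedExpectation.

(* The properties of a random supremum [b |-> E (sup (b + Z))] that survive
   averaging over one more coordinate. *)
Record suplike (R : realType) (I : finType) (p : I -> R) (J : Type)
    (L : (J -> R) -> R) : Prop := Suplike {
  suplike_mono : forall a b, (forall j, a j <= b j) -> L a <= L b ;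
  suplike_shift : forall a c, L (fun j => a j + c) = L a + c ;
  suplike_mid : forall a b,
    L (fun j => (a j + b j) / 2) <= (L a + L b) / 2 ;
  suplike_jensen : forall b : I -> J -> R,
    L (fun j => \sum_i p i * b i j) <= \sum_i p i * L (b i) ;
  suplike_contract : forall a h l : J -> R,
    (forall j k, `|h j - h k| <= `|l j - l k|) ->
    L (fun j => a j + h j) + L (fun j => a j - h j) <=
    L (fun j => a j + l j) + L (fun j => a j - l j) }.

(** * Symmetrization and contraction of one coordinate at a time *)

Section Symmetrization.
Variables (R : realType) (I : finType) (p : I -> R).
Hypothesis p_ge0 : forall i, 0 <= p i.
Hypothesis p_sum1 : \sum_i p i = 1.
Variable J : Type.
Implicit Types (a b : J -> R) (L : (J -> R) -> R).

Section Step.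
Variable l : I -> J -> R.

(** Effect on [L] of averaging over one symmetrized coordinate, a random sign times [l i]; it is
    what a centered observation gets replaced by. *)
Definition rademacher_step L : (J -> R) -> R := fun b =>
  \sum_i p i * ((L (fun j => b j + l i j) + L (fun j => b j - l i j)) / 2).

(** A step is an average of translates of [L], and every property is stable under translation and
    averaging. Contraction is inherited by applying it at both base points [a + l i] and
    [a - l i]. *)
Lemma suplike_step L : suplike p L -> suplike p (rademacher_step L).
Proof.
move=> sL; split.
- move=> a b ab; apply: ler_sum => i _; apply: ler_wpM2l => //.
  have h1 : L (fun j => a j + l i j) <= L (fun j => b j + l i j).
    by apply: (suplike_mono sL) => j; rewrite lerD2r.
  have h2 : L (fun j => a j - l i j) <= L (fun j => b j - l i j).
    by apply: (suplike_mono sL) => j; rewrite lerD2r.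
  by lra.
- move=> a c; rewrite -[c in RHS]mul1r -p_sum1 mulr_suml -big_split /=.
  apply: eq_bigr => i _; rewrite -mulrDr; congr (_ * _).
  have -> : (fun j => a j + c + l i j) = (fun j => a j + l i j + c).
    by apply/funext => j; rewrite addrAC.
  have -> : (fun j => a j + c - l i j) = (fun j => a j - l i j + c).
    by apply/funext => j; rewrite addrAC.
  by rewrite !(suplike_shift sL); lra.
- move=> a b; rewrite mulrDl !mulr_suml -big_split /=.
  apply: ler_sum => i _; rewrite -!mulrA -mulrDr; apply: ler_wpM2l => //.
  have h1 := suplike_mid sL (fun j => a j + l i j) (fun j => b j + l i j).
  have h2 := suplike_mid sL (fun j => a j - l i j) (fun j => b j - l i j).
  have e1 : (fun j => (a j + b j) / 2 + l i j) =
      (fun j => (a j + l i j + (b j + l i j)) / 2) by apply/funext => j; lra.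
  have e2 : (fun j => (a j + b j) / 2 - l i j) =
      (fun j => (a j - l i j + (b j - l i j)) / 2) by apply/funext => j; lra.
  by rewrite e1 e2; lra.
- move=> b; rewrite /rademacher_step.
  under [leRHS]eq_bigr do rewrite mulr_sumr.
  rewrite exchange_big /=; apply: ler_sum => i _.
  rewrite (eq_bigr (fun k => p i * (p k *
    ((L (fun j => b k j + l i j) + L (fun j => b k j - l i j)) / 2)))); last first.
    by move=> k _; rewrite mulrCA.
  rewrite -mulr_sumr; apply: ler_wpM2l => //.
  have h1 := suplike_jensen sL (fun k j => b k j + l i j).
  have h2 := suplike_jensen sL (fun k j => b k j - l i j).
  have e1 : (fun j => \sum_k p k * b k j + l i j) =
      (fun j => \sum_k p k * (b k j + l i j)).
    apply/funext => j; under [RHS]eq_bigr do rewrite mulrDr.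
    by rewrite big_split /= -mulr_suml p_sum1 mul1r.
  have e2 : (fun j => \sum_k p k * b k j - l i j) =
      (fun j => \sum_k p k * (b k j - l i j)).
    apply/funext => j; under [RHS]eq_bigr do rewrite mulrBr.
    by rewrite sumrB -mulr_suml p_sum1 mul1r.
  rewrite e1 e2.
  under eq_bigr do rewrite mulrA mulrDr.
  by rewrite -mulr_suml big_split /=; lra.
- move=> a h m hm; rewrite -!big_split /=; apply: ler_sum => i _.
  rewrite -!mulrDr; apply: ler_wpM2l => //.
  have h1 := suplike_contract sL (fun j => a j + l i j) hm.
  have h2 := suplike_contract sL (fun j => a j - l i j) hm.
  have e (x y : J -> R) : (fun j => a j + x j + y j) = (fun j => a j + y j + x j).
    by apply/funext => j; rewrite addrAC.
  rewrite (e (l i) h) (e (l i) (fun j => - h j)) in h1.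
  rewrite (e (l i) m) (e (l i) (fun j => - m j)) in h1.
  rewrite (e (fun j => - l i j) h) (e (fun j => - l i j) (fun j => - h j)) in h2.
  rewrite (e (fun j => - l i j) m) (e (fun j => - l i j) (fun j => - m j)) in h2.
  by lra.
Qed.

Definition signed (y : I * bool) : J -> R :=
  fun j => if y.2 then l y.1 j else - l y.1 j.

(** Unfolds [n] steps into a Rademacher sum; a letter is now a pair of an index and a sign, of
    weight [p i / 2]. *)
Lemma iter_stepE L n b : iter n rademacher_step L b =
  iexp (fun y : I * bool => p y.1 / 2) n
    (fun z => L (fun j => b j + \sum_(y <- z) signed y j)).
Proof.
elim: n b => [|n IH] b /=.
  by congr (L _); apply/funext => j; rewrite big_nil addr0.
pose G i s := p i / 2 * iexp (fun y : I * bool => p y.1 / 2) n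
  (fun z => L (fun j => b j + \sum_(y <- ((i, s) :: z)) signed y j)).
rewrite [RHS](eq_bigr (fun y => G y.1 y.2)) => [|[i s] _ //].
rewrite -(pair_bigA _ G) /= /G.
apply: eq_bigr => i _; rewrite big_bool /= !IH.
have e (s : bool) (y : J -> R) : y = signed (i, s) ->
    iexp (fun y => p y.1 / 2) n (fun z => L (fun j => b j + y j + \sum_(y <- z) signed y j)) =
    iexp (fun y => p y.1 / 2) n (fun z => L (fun j => b j + \sum_(y <- ((i, s) :: z)) signed y j)).
  move=> ->; apply: eq_iexp => z; congr (L _); apply/funext => j.
  by rewrite big_cons addrA.
by rewrite (e true)// (e false (fun j => - l i j))//; lra.
Qed.

End Step.

Section OneStep.
Variables (f l : I -> J -> R).
Hypothesis f01 : forall i j, 0 <= f i j <= 1.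
Hypothesis fl : forall i j k, 2 * `|f i j - f i k| <= `|l i j - l i k|.

(** The sign is that of a deficit: an upper bound on the supremum of sums of these is a uniform
    lower bound on sums of [f]. *)
Definition centered i j : R := \sum_k p k * f k j - f i j.

(** Jensen's inequality replaces the mean of [f] by an independent draw [f k]. The midpoint property
    then separates [b + f k - f i] into [b + 2 * f k] and [b - 2 * f i], so that the two draws can
    be averaged separately and recombined as one draw with both signs. Contraction turns [2 * f]
    into [l], hence the factor 2 in the Lipschitz hypothesis. *)
Lemma mean_centered_le L b : suplike p L ->
  \sum_i p i * L (fun j => b j + centered i j) <= rademacher_step l L b.
Proof.
move=> sL.
pose U := \sum_k p k * L (fun j => b j + 2 * f k j).
pose V := \sum_i p i * L (fun j => b j - 2 * f i j).
have h1 : \sum_i p i * L (fun j => b j + centered i j) <= (U + V) / 2.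
  apply: (@le_trans _ _ (\sum_i p i *
     (\sum_k p k * ((L (fun j => b j + 2 * f k j) + L (fun j => b j - 2 * f i j)) / 2)))).
    apply: ler_sum => i _; apply: ler_wpM2l => //.
    have h := suplike_jensen sL (fun k j => b j + f k j - f i j).
    have e : (fun j => \sum_k p k * (b j + f k j - f i j)) =
        (fun j => b j + centered i j).
      apply/funext => j; under eq_bigr do rewrite mulrBr mulrDr.
      by rewrite sumrB big_split /= -!mulr_suml p_sum1 !mul1r addrA.
    rewrite e in h.
    apply: (le_trans h); apply: ler_sum => k _; apply: ler_wpM2l => //.
    have := suplike_mid sL (fun j => b j + 2 * f k j) (fun j => b j - 2 * f i j).
    have -> // : (fun j => (b j + 2 * f k j + (b j - 2 * f i j)) / 2) =
      (fun j => b j + f k j - f i j) by apply/funext => j; lra.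
  rewrite le_eqVlt; apply/orP; left; apply/eqP.
  under eq_bigr => i _.
    under eq_bigr do rewrite mulrA mulrDr.
    rewrite -mulr_suml big_split /= -mulr_suml p_sum1 mul1r mulrA mulrDr.
    over.
  by rewrite -mulr_suml big_split /= -mulr_suml p_sum1 mul1r.
apply: (le_trans h1).
rewrite /U /V -big_split /= mulr_suml; apply: ler_sum => i _.
rewrite -mulrDr -mulrA; apply: ler_wpM2l => //.
have := @suplike_contract _ _ _ _ _ sL b (fun j => 2 * f i j) (l i) _.
rewrite ler_pdivlMr// divfK//; apply => j k.
by rewrite -mulrBr normrM (@ger0_norm _ 2).
Qed.

(** A bounded-difference step: since [f] takes values in [[0, 1]], changing the draw moves [L] by at
    most 1, so the centered variable has exponential moment at most [expR (expR 1 * lam ^+ 2)]; its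
    mean is controlled by [mean_centered_le]. *)
Lemma mgf_step L b (lam : R) : suplike p L -> 0 <= lam <= 1 ->
  \sum_i p i * expR (lam * L (fun j => b j + centered i j)) <=
  expR (expR 1 * lam ^+ 2) * expR (lam * rademacher_step l L b).
Proof.
move=> sL /andP[lam0 lam1].
pose g i := L (fun j => b j + centered i j).
pose m := \sum_i p i * g i.
have g1 i k : g i <= g k + 1.
  rewrite /g -(suplike_shift sL); apply: (suplike_mono sL) => j.
  rewrite /centered; have := f01 i j; have := f01 k j; lra.
have gm i : `|g i - m| <= 1.
  have e c : \sum_k p k * (c + g k) = c + m.
    under eq_bigr do rewrite mulrDr.
    by rewrite big_split /= -mulr_suml p_sum1 mul1r.
  have e1 c : \sum_k p k * c = c by rewrite -mulr_suml p_sum1 mul1r.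
  rewrite ler_norml; apply/andP; split.
    have : m <= g i + 1.
      rewrite -[leRHS]e1; apply: ler_sum => k _; exact: ler_wpM2l.
    lra.
  have : g i <= 1 + m.
    rewrite -e -[leLHS]e1; apply: ler_sum => k _; apply: ler_wpM2l => //.
    by rewrite addrC.
  lra.
have h : \sum_i p i * expR (lam * (g i - m)) <= expR (expR 1 * lam ^+ 2).
  apply: (@le_trans _ _ (\sum_i p i * (1 + lam * (g i - m) + expR 1 * lam ^+ 2))).
    apply: ler_sum => i _; apply: ler_wpM2l => //.
    apply: (le_trans (expR_le_quad _)); rewrite lerD2l.
    have h1 : `|lam * (g i - m)| <= 1.
      rewrite normrM (ger0_norm lam0) -[leRHS]mulr1; exact: ler_pM.
    rewrite mulrC; apply: ler_pM; rewrite ?expR_ge0 ?sqr_ge0//.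
      by rewrite ler_expR.
    rewrite exprMn -[leRHS]mulr1; apply: ler_wpM2l; first exact: sqr_ge0.
    by rewrite -real_normK ?num_real// expr_le1.
  have -> : \sum_i p i * (1 + lam * (g i - m) + expR 1 * lam ^+ 2) = 1 + expR 1 * lam ^+ 2.
    under eq_bigr do rewrite mulrDr mulrDr mulr1 mulrBr mulrBr.
    rewrite !big_split /= -!mulr_suml p_sum1 sumrN -mulr_suml p_sum1.
    have -> : \sum_i p i * (lam * g i) = lam * m.
      by rewrite mulr_sumr; apply: eq_bigr => i _; rewrite mulrCA.
    by lra.
  exact: expR_ge1Dx.
have hm : lam * m <= lam * rademacher_step l L b.
  by apply: ler_wpM2l => //; exact: mean_centered_le.
apply: (@le_trans _ _ (expR (expR 1 * lam ^+ 2) * expR (lam * m))); last first.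
  by rewrite ler_pM2l ?expR_gt0// ler_expR.
apply: le_trans (ler_wpM2r (expR_ge0 (lam * m)) h).
rewrite mulr_suml le_eqVlt; apply/orP; left; apply/eqP; apply: eq_bigr => i _.
by rewrite -mulrA -expRD; congr (_ * expR _); rewrite /g; lra.
Qed.

(** By induction, with the first draw held fixed while the others are replaced. The functional left
    after that is an iterate of [rademacher_step], still [suplike], so [mgf_step] applies to the
    first draw. Each draw costs one factor [expR (expR 1 * lam ^+ 2)]. *)
Lemma iexp_mgf_sup L (lam : R) n b : suplike p L -> 0 <= lam <= 1 ->
  iexp p n (fun z => expR (lam * L (fun j => b j + \sum_(i <- z) centered i j))) <=
  expR (n%:R * (expR 1 * lam ^+ 2)) * expR (lam * iter n (rademacher_step l) L b).
Proof.
move=> sL lam01; elim: n b => [|n IH] b /=.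
  rewrite mul0r expR0 mul1r.
  have -> // : (fun j => b j + \sum_(i <- [::]) centered i j) = b.
  by apply/funext => j; rewrite big_nil addr0.
have sLn : suplike p (iter n (rademacher_step l) L).
  by elim: {IH}n => //= n; exact: suplike_step.
apply: (@le_trans _ _ (\sum_i p i * (expR (n%:R * (expR 1 * lam ^+ 2)) *
   expR (lam * iter n (rademacher_step l) L (fun j => b j + centered i j))))).
  apply: ler_sum => i _; apply: ler_wpM2l => //.
  apply: le_trans (IH _); rewrite le_eqVlt; apply/orP; left; apply/eqP.
  apply: eq_iexp => z; congr (expR (lam * L _)); apply/funext => j.
  by rewrite big_cons addrA.
under eq_bigr do rewrite mulrCA.
rewrite -mulr_sumr -natr1 mulrDl mul1r expRD -mulrA ler_pM2l ?expR_gt0//.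
exact: mgf_step.
Qed.

End OneStep.
End Symmetrization.

Section FiniteSup.
Variables (R : realType) (J : finType) (j0 : J).

Definition fsup (a : J -> R) : R := \big[Num.max/a j0]_j a j.

Lemma fsup_ub a j : a j <= fsup a.
Proof. exact: le_bigmax. Qed.

Lemma fsup_le a c : (forall j, a j <= c) -> fsup a <= c.
Proof. by move=> ac; apply/bigmax_leP; split. Qed.

Lemma fsup_suplike (I : finType) (p : I -> R) : (forall i, 0 <= p i) ->
  suplike p fsup.
Proof.
move=> p0; split.
- move=> a b ab; apply: fsup_le => j; exact: le_trans (ab j) (fsup_ub _ _).
- move=> a c; apply/eqP; rewrite eq_le; apply/andP; split.
    by apply: fsup_le => j; rewrite lerD2r fsup_ub.
  rewrite -lerBrDr; apply: fsup_le => j; rewrite lerBrDr.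
  exact: (fsup_ub (fun j => a j + c)).
- move=> a b; apply: fsup_le => j; have := fsup_ub a j; have := fsup_ub b j; lra.
- move=> b; apply: fsup_le => j; apply: ler_sum => i _.
  by apply: ler_wpM2l => //; exact: fsup_ub.
(* Two-point contraction: for fixed [j] and [k], [h j - h k] is at most [l j - l k] or [l k - l j],
   and in either case the pair is admissible for the right-hand side, possibly after exchanging the
   two suprema. The suprema over [j] and [k] are then taken separately. *)
- move=> a h l hl; set S := leRHS.
  have hS j k : (a j + h j) + (a k - h k) <= S.
    have u1 := fsup_ub (fun j => a j + l j) j.
    have u2 := fsup_ub (fun j => a j + l j) k.
    have v1 := fsup_ub (fun j => a j - l j) j.
    have v2 := fsup_ub (fun j => a j - l j) k.
    have := le_trans (ler_norm _) (hl j k); rewrite /S.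
    by case: (ger0P (l j - l k)) => _; lra.
  rewrite -lerBrDr; apply: fsup_le => j; rewrite lerBrDr addrC -lerBrDr.
  by apply: fsup_le => k; rewrite lerBrDr addrC.
Qed.

End FiniteSup.

(** * Expectation bounds and independent copies *)

Section UpperExpectation.
Context d (T : measurableType d) (R : realType) (P : probability T R).
Implicit Types (f g : T -> R) (a b c : R).

(** Bundles an upper bound on an expectation with the measurability and sign conditions under which
    it is meaningful, so that domination, sums and Markov's inequality compose without side
    conditions. *)
Definition eub f c : Prop :=
  [/\ measurable_fun setT f, forall w, 0 <= f w &
      (\int[P]_w (f w)%:E <= c%:E)%E].

Lemma eub_le f g c : measurable_fun setT f -> (forall w, 0 <= f w) ->
  (forall w, f w <= g w) -> eub g c -> eub f c.
Proof.
move=> mf f0 fg [mg g0 gc]; split=> //; apply: le_trans gc.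
by apply: ge0_le_integral => //=; [move=> w _; rewrite lee_fin | exact/measurable_EFinP
  | exact/measurable_EFinP | move=> w _; rewrite lee_fin].
Qed.

Lemma eubW f a b : a <= b -> eub f a -> eub f b.
Proof. by move=> ab [mf f0 fa]; split=> //; rewrite (le_trans fa)// lee_fin. Qed.

Lemma eub_cst c : 0 <= c -> eub (cst c) c.
Proof.
move=> c0; split=> //.
have -> : (\int[P]_w (cst c w)%:E = c%:E * P setT)%E by exact: (integral_cst P measurableT c%:E).
by rewrite probability_setT mule1.
Qed.

Lemma eubD f g a b : eub f a -> eub g b -> eub (fun w => f w + g w) (a + b).
Proof.
move=> [mf f0 fa] [mg g0 gb]; split; first exact: measurable_funD.
  by move=> w; exact: addr_ge0.
under eq_integral do rewrite EFinD.
rewrite ge0_integralD//=.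
- by rewrite EFinD leeD.
- by move=> w _; rewrite lee_fin.
- exact/measurable_EFinP.
- by move=> w _; rewrite lee_fin.
- exact/measurable_EFinP.
Qed.

Lemma eubZ k f a : 0 <= k -> eub f a -> eub (fun w => k * f w) (k * a).
Proof.
move=> k0 [mf f0 fa]; split; first exact: measurable_funM.
  by move=> w; exact: mulr_ge0.
under eq_integral do rewrite EFinM.
rewrite ge0_integralZl_EFin//.
- by rewrite EFinM lee_wpmul2l// lee_fin.
- by move=> w _; rewrite lee_fin.
- exact/measurable_EFinP.
Qed.

Lemma eub_indic (A : set T) c : measurable A -> (P A <= c%:E)%E ->
  eub (\1_A : T -> R) c.
Proof.
by move=> mA Ac; split => //; rewrite integral_indic// setIT.
Qed.

Lemma measurable_ge f c : measurable_fun setT f ->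
  measurable [set w | c <= f w].
Proof.
move=> mf; have := measurable_fun_ler (measurable_cst c) mf => /(_ measurableT [set true]).
by rewrite setTI; apply => //; rewrite set1_bool.
Qed.

Lemma measurable_gt f c : measurable_fun setT f ->
  measurable [set w | c < f w].
Proof.
move=> mf; have := measurable_fun_ltr (measurable_cst c) mf => /(_ measurableT [set true]).
by rewrite setTI; apply.
Qed.

Lemma eub_markov f a c : eub f c -> 0 < a ->
  (P [set w | (a <= f w)%R] <= (c / a)%:E)%E.
Proof.
move=> [mf f0 fc] a0; have mA := measurable_ge a mf.
rewrite -(@lee_pmul2l _ a%:E)// -EFinM [(a * _)%R]mulrC divfK ?gt_eqF//.
apply: le_trans fc.
have -> : (a%:E * P [set w | (a <= f w)%R] =
    \int[P]_w (a%:E * (\1_[set w | (a <= f w)%R] w)%:E))%E.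
  rewrite ge0_integralZl_EFin// ?ltW//; last exact/measurable_EFinP.
  by rewrite integral_indic// setIT.
apply: ge0_le_integral => //=.
- by move=> w _; rewrite mule_ge0// lee_fin// ltW.
- by apply/measurable_EFinP; exact: measurable_funM.
- exact/measurable_EFinP.
move=> w _; rewrite indicE -EFinM lee_fin.
by case: (boolP (w \in _)) => [|_]; [rewrite inE/= mulr1 | rewrite mulr0].
Qed.

Lemma eub_chernoff f b s : eub (fun w => expR (f w)) (expR b) ->
  (P [set w | (s <= f w)%R] <= (expR (b - s))%:E)%E.
Proof.
move=> /(eub_markov)/(_ (expR_gt0 s)); rewrite expRB.
by under eq_set do rewrite ler_expR.
Qed.

End UpperExpectation.

(** * Product formulas for independent copies *)

Section IndependentCopies.
Context d d' (T : measurableType d) (T' : measurableType d') (R : realType).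
Variables (P : probability T R) (n : nat) (Z0 : T -> T') (Z : 'I_n -> T -> T').
Hypothesis iid : independent_copies P Z0 Z.
Hypothesis mZ0 : measurable_fun setT Z0.
Hypothesis mZ : forall i, measurable_fun setT (Z i).

Lemma iid_code (I : Type) (c : T' -> I) (g : 'I_n -> I) :
  (forall i, measurable (c @^-1` [set i])) ->
  P [set w | forall k, c (Z k w) = g k] =
  (\prod_(k < n) P [set w | c (Z0 w) = g k])%E.
Proof.
move=> mc; case: iid => hlaw hind.
have := hind (fun k => c @^-1` [set g k]) (fun k => mc (g k)).
rewrite (_ : \bigcap_i _ = [set w | forall k, c (Z k w) = g k]); last first.
  by apply/seteqP; split=> [w h k|w h k _]; [exact: h | exact: h].
by move=> ->; apply: eq_bigr => k _; rewrite hlaw.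
Qed.

Lemma measurable_code (I : finType) (c : T' -> I) (A : set I) :
  (forall i, measurable (c @^-1` [set i])) -> measurable (c @^-1` A).
Proof.
move=> mc; rewrite (_ : _ @^-1` _ = \bigcup_(i in A) (c @^-1` [set i])).
  by apply: fin_bigcup_measurable => //; exact: finite_finset.
by apply/seteqP; split=> [w Aw|w [i Ai /= e]]; [exists (c w) | rewrite /= e].
Qed.

Lemma integral_code (I : finType) (c : T' -> I) (r : I -> R) :
  (forall i, measurable (c @^-1` [set i])) -> (forall i, 0 <= r i) ->
  (\int[P]_w (r (c (Z0 w)))%:E =
   (\sum_i fine (P [set w | c (Z0 w) = i]) * r i)%:E)%E.
Proof.
move=> mc r0.
have mp i : measurable [set w | c (Z0 w) = i].
  by have := mZ0 measurableT (mc i); rewrite setTI.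
rewrite (eq_integral (fun w => \sum_(i : I) ((r i)%:E * (\1_[set w | c (Z0 w) = i] w)%:E)%E)).
  rewrite ge0_integral_sum//=.
  - rewrite -sumEFin; apply: eq_bigr => i _.
    rewrite ge0_integralZl_EFin//; last by apply/measurable_EFinP.
    by rewrite integral_indic// setIT EFinM fineK ?fin_num_measure// muleC.
  - by move=> i; apply/measurable_EFinP; exact: measurable_funM.
  - by move=> i w _; rewrite -EFinM lee_fin mulr_ge0.
move=> w _; rewrite (bigD1 (c (Z0 w)))//= big1 ?adde0.
  by rewrite indicE mem_set//= mule1.
move=> i ni; rewrite indicE memNset ?mule0//= => h.
by rewrite h eqxx in ni.
Qed.

(** The integrand is a finite sum over the possible code words of the sample; their probabilities
    factorize, and distributivity of the product over the sum gives the power. *)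
Lemma iid_simple_prod (I : finType) (c : T' -> I) (r : I -> R) :
  (forall i, measurable (c @^-1` [set i])) -> (forall i, 0 <= r i) ->
  (\int[P]_w (\prod_(k < n) r (c (Z k w)))%:E =
   (\int[P]_w (r (c (Z0 w)))%:E) ^+ n)%E.
Proof.
move=> mc r0.
pose p i : R := fine (P [set w | c (Z0 w) = i]).
have mp i : measurable [set w | c (Z0 w) = i].
  by have := mZ0 measurableT (mc i); rewrite setTI.
have pE i : P [set w | c (Z0 w) = i] = (p i)%:E.
  by rewrite /p fineK// fin_num_measure.
rewrite (integral_code mc r0).
pose A (g : {ffun 'I_n -> I}) := [set w | forall k, c (Z k w) = g k].
have mA g : measurable (A g).
  rewrite (_ : A g = \bigcap_k (Z k @^-1` (c @^-1` [set g k]))).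
    apply: fin_bigcap_measurable => // k _.
    by have := mZ k measurableT (mc (g k)); rewrite setTI.
  by apply/seteqP; split=> [w h k _|w h k]; exact: h.
rewrite (eq_integral (fun w => \sum_(g : {ffun 'I_n -> I})
   ((\prod_(k < n) r (g k))%:E * (\1_(A g) w)%:E)%E)).
  rewrite ge0_integral_sum//=.
  - have -> : ((\sum_i p i * r i)%:E ^+ n = ((\sum_i p i * r i) ^+ n)%:E)%E.
      by rewrite EFin_expe.
    rewrite -[n in RHS]card_ord -prodr_const bigA_distr_bigA /= -sumEFin.
    apply: eq_bigr => g _; rewrite ge0_integralZl_EFin//; last 2 first.
    - by apply/measurable_EFinP.
    - by apply: prodr_ge0.
    rewrite integral_indic// setIT [X in (_ * X)%E](iid_code _ mc).
    rewrite (eq_bigr (fun k => (p (g k))%:E)) => [|k _]; last exact: pE.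
    by rewrite prodEFin -EFinM big_split /= mulrC.
  - by move=> g; apply/measurable_EFinP; exact: measurable_funM.
  - by move=> g w _; rewrite -EFinM lee_fin mulr_ge0// prodr_ge0.
move=> w _; rewrite [RHS](bigD1 [ffun k => c (Z k w)])//= [X in (_ + X)%E]big1 ?adde0.
  have h : A [ffun k => c (Z k w)] w by move=> k; rewrite ffunE.
  rewrite indicE (mem_set h) mule1.
  by congr (_%:E); apply: eq_bigr => k _; rewrite ffunE.
move=> g ng; rewrite indicE memNset ?mule0//= => h.
by move/eqP: ng; apply; apply/ffunP => k; rewrite ffunE h.
Qed.

Import HBNNSimple.

(** Independence is given on events only. The product formula thus holds first for functions of a
    finite code, in particular for simple functions, and passes to [f] by monotone convergence of
    its simple approximations. *)
Lemma iid_prod_eub (f : T' -> R) c : measurable_fun setT f ->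
  (forall z, 0 <= f z) -> eub P (fun w => f (Z0 w)) c ->
  eub P (fun w => \prod_(k < n) f (Z k w)) (c ^+ n).
Proof.
move=> mf f0 [_ _ fc].
have mfZ k : measurable_fun setT (fun w => f (Z k w)) by exact: measurableT_comp.
have mprod (h : T' -> R) : measurable_fun setT h ->
    measurable_fun setT (fun w => \prod_(k < n) h (Z k w)).
  move=> mh; apply: measurable_prod => k _; exact: measurableT_comp.
split; [exact: mprod | by move=> w; apply: prodr_ge0 |].
have mf' : measurable_fun setT (EFin \o f) by exact/measurable_EFinP.
pose h m : {nnsfun T' >-> R} := nnsfun_approx measurableT mf' m.
have hcvg z : h ^~ z @ \oo --> f z.
  have := @cvg_nnsfun_approx _ _ _ _ measurableT _ mf' (fun z _ => f0 z) z I.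
  by move/fine_cvgP => [].
have hnd z : {homo (fun m => h m z) : m k / (m <= k)%N >-> m <= k}.
  by move=> m k mk; exact/lefP/nd_nnsfun_approx.
have hf m z : h m z <= f z.
  have := nondecreasing_cvgn_le (hnd z) (cvgP _ (hcvg z)) m.
  by rewrite (cvg_lim _ (hcvg z)).
have h0 m z : 0 <= h m z by exact: fun_ge0.
have mh m : measurable_fun setT (h m) by exact: measurable_funP.
have hle m : (\int[P]_w (\prod_(k < n) h m (Z k w))%:E <= (c ^+ n)%:E)%E.
  (* The finite range of the simple function serves as the alphabet, and its value as the code. *)
  have fr : finite_set (range (h m)) by exact: fimfunP.
  pose S := fset_set (range (h m)).
  have hS z : h m z \in S by rewrite in_fset_set// inE; exists z.
  pose cd z : S := [` hS z]%fset.
  have mcd (i : S) : measurable (cd @^-1` [set i]).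
    rewrite (_ : _ @^-1` _ = h m @^-1` [set val i]).
      by rewrite -[X in measurable X]setTI; exact: mh.
    by apply/seteqP; split=> [z <-//|z /= e]; exact: val_inj.
  have r0 (i : S) : 0 <= val i.
    have := valP i; rewrite in_fset_set// inE => -[z _ <-]; exact: h0.
  rewrite (iid_simple_prod mcd r0).
  have le1 : (\int[P]_w (h m (Z0 w))%:E <= c%:E)%E.
    apply: le_trans fc; apply: ge0_le_integral => //.
    - by move=> w _; rewrite lee_fin h0.
    - by apply/measurable_EFinP; apply: measurableT_comp.
    - by apply/measurable_EFinP; apply: measurableT_comp.
    - by move=> w _; rewrite lee_fin.
  have ge1 : (0 <= \int[P]_w (h m (Z0 w))%:E)%E.
    by apply: integral_ge0 => w _; rewrite lee_fin h0.
  rewrite -[X in (X ^+ n)%E]/(\int[P]_w (h m (Z0 w))%:E)%E.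
  have fin1 : (\int[P]_w (h m (Z0 w))%:E)%E \is a fin_num.
    by rewrite ge0_fin_numE// (le_lt_trans le1)// ltry.
  move: le1 ge1; rewrite -(fineK fin1) !lee_fin -EFin_expe lee_fin => le1 ge1.
  by apply: lerXn2r; rewrite ?nnegrE//; exact: le_trans ge1 le1.
have cvgp w : (\prod_(k < n) h m (Z k w))%:E @[m --> \oo] --> (\prod_(k < n) f (Z k w))%:E.
  apply: cvg_EFin; first by apply: nearW.
  elim: (index_enum _) => [|k s IH].
    by under eq_fun do rewrite big_nil; rewrite big_nil; exact: cvg_cst.
  under eq_fun do rewrite big_cons.
  by rewrite big_cons; apply: cvgM => //; exact: hcvg.
have hn w : {homo (fun m => (\prod_(k < n) h m (Z k w))%:E) : m k / (m <= k)%N >-> (m <= k)%E}.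
  move=> m k mk; rewrite lee_fin; apply: ler_prod => i _.
  by rewrite h0 hnd.
pose g m w := (\prod_(k < n) h m (Z k w))%:E.
have mg m : measurable_fun setT (g m) by apply/measurable_EFinP; exact: mprod.
have g0 m w : setT w -> (0 <= g m w)%E by rewrite lee_fin prodr_ge0.
have := @cvg_monotone_convergence _ _ _ P _ measurableT g mg g0 (fun w _ => hn w).
rewrite (eq_integral (fun w => (\prod_(k < n) f (Z k w))%:E)); last first.
  by move=> w _; exact: cvg_lim (cvgp w).
move=> cv; rewrite -(cvg_lim _ cv)//; apply: lime_le; first exact: cvgP cv.
exact: nearW.
Qed.

Lemma iid_sum_expR (f : T' -> R) b : measurable_fun setT f ->
  eub P (fun w => expR (f (Z0 w))) (expR b) ->
  eub P (fun w => expR (\sum_(k < n) f (Z k w))) (expR (n%:R * b)).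
Proof.
move=> mf fb; have := @iid_prod_eub (expR \o f) (expR b) _ _ fb.
rewrite -expRM_natl; under eq_fun do rewrite -expR_sum.
by apply => [|z]; [exact: measurableT_comp | exact: expR_ge0].
Qed.

Lemma iid_law (i : 'I_n) (B : set T') : measurable B ->
  P [set w | B (Z i w)] = P [set w | B (Z0 w)].
Proof. by move=> mB; case: iid => h _; exact: h. Qed.

End IndependentCopies.

(** * Bernstein tails *)

Lemma sqr_le_expR (R : realType) (k x : R) : 0 < k -> 0 <= x ->
  x ^+ 2 <= (2 * k) ^+ 2 * expR (x / k).
Proof.
move=> k0 x0.
have h : x / (2 * k) <= expR (x / (2 * k)) by exact: id_le_expR.
have -> : x / k = 2 * (x / (2 * k)) by field; lra.
rewrite expRM_natl -exprMn; apply: lerXn2r; rewrite ?nnegrE ?mulr_ge0 ?expR_ge0//; [lra|].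
by rewrite mulrC -ler_pdivrMr//; lra.
Qed.

Lemma le_expR_div (R : realType) (k x : R) : 0 < k -> x <= k * expR (x / k).
Proof. by move=> k0; rewrite mulrC -ler_pdivrMr//; exact: id_le_expR. Qed.

Lemma expR_half_bounds (R : realType) : 3 / 2 <= expR (1 / 2 : R) <= 2.
Proof.
apply/andP; split; first by have := expR_ge1Dx (1 / 2 : R); lra.
have := expR_le_quad (1 / 2 : R); rewrite ger0_norm; lra.
Qed.

(** The left-hand side is the [k]-th layer in the proof of [bern_expR]; [3/2 <= expR (1/2)] makes
    the layers geometric, of total at most 12. *)
Lemma expR_half_geometric (R : realType) (k : nat) :
  expR (k.+1%:R / 2) * (2 * expR (- k%:R)) <= 4 * (2 / 3) ^+ k :> R.
Proof.
have /andP[el eu] := expR_half_bounds R.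
have -> : expR (k.+1%:R / 2) = expR (1 / 2) * expR (1 / 2) ^+ k :> R.
  by rewrite -exprS -expRM_natl; congr expR; lra.
have -> : expR (- k%:R) = (expR (1 / 2) ^+ 2) ^- k :> R.
  by rewrite -!expRM_natl -expRN; congr expR; lra.
have e12 : expR (1 / 2) != 0 :> R by rewrite gt_eqF// expR_gt0.
have -> : expR (1 / 2) * expR (1 / 2) ^+ k * (2 * (expR (1 / 2) ^+ 2) ^- k) =
  2 * expR (1 / 2) * (expR (1 / 2))^-1 ^+ k :> R.
  rewrite -exprM mulnC exprM exprVn.
  by field; rewrite expf_neq0.
apply: ler_pM; rewrite ?mulr_ge0 ?expR_ge0 ?exprn_ge0 ?invr_ge0 ?expR_ge0//; first by lra.
apply: lerXn2r; rewrite ?nnegrE ?invr_ge0 ?expR_ge0//.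
by rewrite -[leRHS]invrK lef_pV2 ?posrE ?expR_gt0//; lra.
Qed.

Lemma sum_geometric_le (R : realType) (m : nat) :
  \sum_(0 <= k < m) 4 * (2 / 3) ^+ k <= 12 :> R.
Proof.
have -> : \sum_(0 <= k < m) 4 * (2 / 3) ^+ k = 12 * (1 - (2 / 3) ^+ m) :> R.
  elim: m => [|m IH]; first by rewrite big_nil expr0; lra.
  by rewrite big_nat_recr//= IH exprS; lra.
have : 0 <= (2 / 3 : R) ^+ m by apply: exprn_ge0; lra.
lra.
Qed.

(* In units of [g] and [e], a variable with Bernstein tails is dominated by
   [max (g * sqrt A) (e * A)] where [A] has exponential tails. *)
Definition bern (R : realType) (g e z : R) : R := Num.min (z ^+ 2 / g ^+ 2) (`|z| / e).

Section Bernstein.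
Variables (R : realType) (g e : R).
Hypotheses (g0 : 0 < g) (e0 : 0 < e).
Implicit Types z : R.
Local Notation A := (bern g e).

Lemma bern_ge0 z : 0 <= A z.
Proof. by rewrite le_min !divr_ge0 ?sqr_ge0// ltW. Qed.

Lemma bern_cases z :
  z ^+ 2 = g ^+ 2 * A z \/ `|z| = e * A z.
Proof.
rewrite /bern; case: leP => _; [left|right].
  by rewrite mulrC divfK// expf_neq0// gt_eqF.
by rewrite mulrC divfK// gt_eqF.
Qed.

Lemma bern_sqr z : z ^+ 2 <= g ^+ 2 * A z + e ^+ 2 * A z ^+ 2.
Proof.
have A0 := bern_ge0 z; have ge2 := sqr_ge0 g; have ee2 := sqr_ge0 e.
case: (bern_cases z) => [->|h].
  by rewrite lerDl mulr_ge0 ?sqr_ge0.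
rewrite -real_normK ?num_real// h exprMn lerDr; exact: mulr_ge0.
Qed.

Lemma bern_le_expR z (k : R) : 0 < k -> k * 4 <= 1 ->
  z ^+ 2 <= 4 / k ^+ 2 * (g ^+ 2 + e ^+ 2) * expR (k * A z).
Proof.
move=> k0 k1; have A0 := bern_ge0 z.
have h1 : A z <= 4 / k ^+ 2 * expR (k * A z).
  have := @le_expR_div _ k^-1 (A z); rewrite invr_gt0 invrK => /(_ k0) h.
  rewrite [_ * k]mulrC in h.
  apply: (le_trans h); rewrite ler_wpM2r ?expR_ge0//.
  rewrite ler_pdivlMr ?exprn_gt0// expr2 mulrA mulVf ?gt_eqF//; lra.
have h2 : A z ^+ 2 <= 4 / k ^+ 2 * expR (k * A z).
  have := @sqr_le_expR _ k^-1 (A z); rewrite invr_gt0 invrK => /(_ k0 A0).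
  by rewrite exprMn exprVn [_ * k]mulrC -natrX.
apply: (le_trans (bern_sqr z)).
have := ler_wpM2l (sqr_ge0 g) h1; have := ler_wpM2l (sqr_ge0 e) h2; lra.
Qed.

(** In the Gaussian regime [|z| = g * sqrt (A z)], and the claim is the inequality between
    arithmetic and geometric means; in the exponential regime [|z| = e * A z], and the bound on
    [theta * e] suffices. *)
Lemma bern_linear z (theta : R) : 0 <= theta -> theta * e <= 1 / 16 ->
  theta * `|z| <= 4 * theta ^+ 2 * g ^+ 2 + A z / 16.
Proof.
move=> t0 te; have A0 := bern_ge0 z; case: (bern_cases z) => [h|->]; last first.
  have : 0 <= 4 * theta ^+ 2 * g ^+ 2 by rewrite mulr_ge0 ?sqr_ge0// mulr_ge0 ?sqr_ge0.
  by have := ler_wpM2r A0 te; lra.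
have [x [x0 hA]] : exists x, 0 <= x /\ A z = 16 * x ^+ 2.
  exists (`|z| / (4 * g)); split; first by rewrite divr_ge0// mulr_ge0// ltW.
  have -> : A z = z ^+ 2 / g ^+ 2 by rewrite h mulrC mulKf// expf_neq0// gt_eqF.
  by rewrite exprMn real_normK ?num_real//; field; rewrite gt_eqF.
have hz : `|z| = 4 * g * x.
  apply/eqP; rewrite -(@eqrXn2 _ 2)//; last by nonneg.
  by rewrite real_normK ?num_real// h hA; apply/eqP; ring.
by rewrite hz hA; have := sqr_ge0 (2 * theta * g - x); lra.
Qed.

Context d (T : measurableType d) (P : probability T R) (Z : T -> R).
Hypothesis mZ : measurable_fun setT Z.
Hypothesis tailZ : forall s, 0 <= s -> (P [set w | (s <= `|Z w|)%R] <=
  (2 * expR (- Num.min (s ^+ 2 / g ^+ 2) (s / e)))%:E)%E.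

Lemma measurable_bern : measurable_fun setT (fun w => A (Z w)).
Proof.
apply: measurable_minr; apply: measurable_funM => //.
  exact: measurable_funX.
exact: measurableT_comp.
Qed.

Lemma bern_tail (a : R) : 0 <= a ->
  (P [set w | (a <= A (Z w))%R] <= (2 * expR (- a))%:E)%E.
Proof.
(* This is the value of [|z|] at which the Bernstein exponent reaches [a]. *)
move=> a0; pose s := Num.max (g * Num.sqrt a) (e * a).
have s0 : 0 <= s by rewrite le_max !mulr_ge0// ltW.
have sg : a <= s ^+ 2 / g ^+ 2.
  rewrite ler_pdivlMr ?exprn_gt0//.
  have -> : a * g ^+ 2 = (g * Num.sqrt a) ^+ 2 by rewrite exprMn sqr_sqrtr// mulrC.
  by apply: lerXn2r; rewrite ?nnegrE ?mulr_ge0 ?sqrtr_ge0 ?(ltW g0)// le_max lexx.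
have se : a <= s / e by rewrite ler_pdivlMr// mulrC le_max lexx orbT.
apply: (@le_trans _ _ (P [set w | (s <= `|Z w|)%R])).
  apply: le_measure; rewrite ?inE.
  - exact: measurable_ge measurable_bern.
  - by apply: measurable_ge; exact: measurableT_comp.
  move=> w /=; rewrite /bern le_min => /andP[h1 h2]; rewrite ge_max; apply/andP; split.
    rewrite -(@ler_pXn2r _ 2)// ?nnegrE ?mulr_ge0 ?sqrtr_ge0 ?(ltW g0)//.
    rewrite exprMn sqr_sqrtr// real_normK ?num_real//.
    by rewrite mulrC -ler_pdivlMr// exprn_gt0.
  by rewrite mulrC -ler_pdivlMr.
apply: (le_trans (tailZ s0)); rewrite lee_fin ler_pM2l// ler_expR lerN2 le_min.
by rewrite sg se.
Qed.

(** [expR (A / 2)] is dominated by the sum over [k] of [expR ((k + 1) / 2)] on the events [k <= A];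
    the single layer [k = floor A] already suffices. The tail bound makes the integrated series
    geometric. *)
Lemma bern_expR : eub P (fun w => expR (A (Z w) / 2)) 12.
Proof.
have mA := measurable_bern.
split.
- by apply: measurableT_comp => //; exact: measurable_funM.
- by move=> w; exact: expR_ge0.
pose c k : R := expR (k.+1%:R / 2).
pose B k := [set w | (k%:R <= A (Z w))%R].
have mB k : measurable (B k) by exact: measurable_ge.
have mcB k : measurable_fun setT (fun w => (c k)%:E * (\1_(B k) w)%:E)%E.
  by apply/measurable_EFinP; apply: measurable_funM.
have cB0 k w : (0 <= (c k)%:E * (\1_(B k) w)%:E)%E.
  by rewrite -EFinM lee_fin mulr_ge0// expR_ge0.
apply: (@le_trans _ _ (\int[P]_w (\sum_(k <oo) ((c k)%:E * (\1_(B k) w)%:E)))%E).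
  have mE : measurable_fun setT (fun w => (expR (A (Z w) / 2))%:E).
    by apply/measurable_EFinP; apply: measurableT_comp => //; exact: measurable_funM.
  have mS : measurable_fun setT (fun w => \sum_(k <oo) ((c k)%:E * (\1_(B k) w)%:E))%E.
    by apply: ge0_emeasurable_sum.
  apply: ge0_le_integral => //.
  move=> w _; pose k := Num.truncn (A (Z w)).
  have [k1 k2] : k%:R <= A (Z w) /\ A (Z w) < k.+1%:R.
    by apply/andP; exact: truncn_itv (bern_ge0 (Z w)).
  apply: le_trans (nneseries_lim_ge k.+1 _); last by move=> *; exact: cB0.
  rewrite big_mkord big_ord_recr /= [X in (_ + X)%E](_ : _ = (c k)%:E); last first.
    by rewrite indicE mem_set// mule1.
  rewrite -[leLHS]add0e leeD//; first by apply: sume_ge0 => i _; exact: cB0.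
  by rewrite lee_fin ler_expR ler_pM2r// ltW.
rewrite integral_nneseries//; apply: lime_le.
  by apply: is_cvg_nneseries => *; apply: integral_ge0 => w _; exact: cB0.
apply: nearW => m.
apply: (@le_trans _ _ (\sum_(0 <= k < m) (4 * (2 / 3) ^+ k)%:E)%E).
  apply: lee_sum => k _.
  rewrite ge0_integralZl_EFin ?expR_ge0//; last by apply/measurable_EFinP.
  rewrite integral_indic// setIT.
  apply: (@le_trans _ _ ((c k)%:E * (2 * expR (- k%:R))%:E)%E).
    by apply: lee_wpmul2l; [rewrite lee_fin expR_ge0 | exact: bern_tail].
  by rewrite -EFinM lee_fin; exact: expR_half_geometric.
rewrite sumEFin lee_fin.
exact: sum_geometric_le.
Qed.

(** Averaging over the sign cancels the linear term, so no centering of [Z] enters: the hyperbolic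
    cosine is at most [1 + z^2 * expR |z|] with [z = theta * Z], and both factors are absorbed by
    [expR (A / 2)]. *)
Lemma bern_cosh (theta : R) : 0 <= theta -> theta * e <= 1 / 16 ->
  eub P (fun w => (expR (theta * Z w) + expR (- (theta * Z w))) / 2)
    (expR ((128 * 128) * theta ^+ 2 * (g ^+ 2 + e ^+ 2))).
Proof.
move=> t0 te.
set G := g ^+ 2 + e ^+ 2; set c := (32 * 32) * theta ^+ 2 * G * expR (4 * theta ^+ 2 * g ^+ 2).
have G0 : 0 <= G by rewrite addr_ge0 ?sqr_ge0.
have c0 : 0 <= c by rewrite /c; nonneg.
(* The constant arises from [12 * 32^2 + 4 <= 128^2], where [32^2 = 4 / (1/16)^2] comes from
   [bern_le_expR] and 12 from [bern_expR]. *)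
have c1 : 1 + c * 12 <= expR ((128 * 128) * theta ^+ 2 * G).
  have t2 := sqr_ge0 theta.
  apply: (@le_trans _ _ (expR (4 * theta ^+ 2 * g ^+ 2 + (12 * (32 * 32)) * theta ^+ 2 * G))).
    have -> : c * 12 = (12 * (32 * 32)) * theta ^+ 2 * G * expR (4 * theta ^+ 2 * g ^+ 2).
      by rewrite /c; ring.
    by apply: affine_le_expR; nonneg.
  rewrite ler_expR.
  have : theta ^+ 2 * g ^+ 2 <= theta ^+ 2 * G.
    by apply: ler_wpM2l => //; rewrite /G lerDl sqr_ge0.
  have := mulr_ge0 t2 G0; lra.
apply: (eubW c1); apply: (@eub_le _ _ _ _ _ (fun w => 1 + c * expR (A (Z w) / 2))).
- apply: measurable_funM => //; apply: measurable_funD; apply: measurableT_comp => //.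
    exact: measurable_funM.
  by apply: measurableT_comp => //; exact: measurable_funM.
- by move=> w; rewrite divr_ge0// addr_ge0// expR_ge0.
- move=> w; have := add_expRN_le (theta * Z w).
  suff : (theta * Z w) ^+ 2 * expR `|theta * Z w| <= c * expR (A (Z w) / 2) by lra.
  have A0 := bern_ge0 (Z w).
  rewrite normrM (ger0_norm t0) exprMn.
  have h1 := @bern_le_expR (Z w) (1 / 16) ltac:(lra) ltac:(lra).
  have h2 : expR (theta * `|Z w|) <= expR (4 * theta ^+ 2 * g ^+ 2) * expR (A (Z w) / 16).
    by rewrite -expRD ler_expR bern_linear.
  have h3 : expR (1 / 16 * A (Z w)) * expR (A (Z w) / 16) <= expR (A (Z w) / 2).
    by rewrite -expRD ler_expR; lra.
  have h4 : Z w ^+ 2 * expR (theta * `|Z w|) <=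
     (32 * 32) * G * expR (1 / 16 * A (Z w)) * (expR (4 * theta ^+ 2 * g ^+ 2) * expR (A (Z w) / 16)).
    apply: ler_pM => //; rewrite ?sqr_ge0 ?expR_ge0//; apply: (le_trans h1).
    by rewrite -/G le_eqVlt; apply/orP; left; apply/eqP; congr (_ * _ * _); field.
  have h5 : 0 <= (32 * 32) * G * expR (4 * theta ^+ 2 * g ^+ 2) by nonneg.
  have := ler_wpM2l (sqr_ge0 theta) h4.
  have := ler_wpM2l (sqr_ge0 theta) (ler_wpM2l h5 h3).
  rewrite /c; lra.
- by apply: eubD; [exact: eub_cst | apply: eubZ => //; exact: bern_expR].
Qed.

End Bernstein.

(** * Means of integrable variables *)

Section Mean.
Context d (T : measurableType d) (R : realType) (P : probability T R).
Implicit Types (V f : T -> R).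

Definition mean V : R := fine (\int[P]_w (V w)%:E).

Local Notation integ V := (P.-integrable setT (EFin \o V)).

Lemma integrable_dom V f c : measurable_fun setT V ->
  (forall w, `|V w| <= f w) -> eub P f c -> integ V.
Proof.
move=> mV Vf [mf f0 fc]; apply/integrableP; split; first exact/measurable_EFinP.
apply: (@le_lt_trans _ _ c%:E); last exact: ltry.
apply: le_trans fc; apply: ge0_le_integral => //=.
- by apply/measurable_EFinP; exact: measurableT_comp.
- exact/measurable_EFinP.
- by move=> w _; rewrite lee_fin.
Qed.

Lemma mean_dom V f c : measurable_fun setT V ->
  (forall w, `|V w| <= f w) -> eub P f c -> `|mean V| <= c.
Proof.
move=> mV Vf fc; have iV := integrable_dom mV Vf fc.
have fV := integrable_fin_num measurableT iV.
rewrite -lee_fin /mean -fine_abse//; rewrite fineK ?abse_fin_num//.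
case: fc => mf f0; apply: le_trans.
have mV' : measurable_fun setT (EFin \o V) by exact/measurable_EFinP.
apply: (le_trans (le_abse_integral P measurableT mV')).
apply: ge0_le_integral => //=.
- by apply/measurable_EFinP; exact: measurableT_comp.
- exact/measurable_EFinP.
- by move=> w _; rewrite lee_fin.
Qed.

Lemma integrable_cst (c : R) : integ (cst c).
Proof.
apply: (@integrable_dom _ (cst `|c|) `|c|) => //; exact: eub_cst.
Qed.

Lemma integrableD_real V f : integ V -> integ f -> integ (fun w => V w + f w).
Proof. by move=> iV /(integrableD measurableT iV). Qed.

Lemma integrableZ_real (c : R) V : integ V -> integ (fun w => c * V w).
Proof. by move=> /(integrableZl measurableT c). Qed.

Lemma meanE V : integ V -> (\int[P]_w (V w)%:E = (mean V)%:E)%E.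
Proof. by move=> iV; rewrite /mean fineK//; exact: integrable_fin_num iV. Qed.

Lemma mean_cst (c : R) : mean (cst c) = c.
Proof.
have e : (\int[P]_w (cst c w)%:E = c%:E * P setT)%E by exact: (integral_cst P measurableT c%:E).
by rewrite /mean e probability_setT mule1.
Qed.

Lemma meanD V f : integ V -> integ f ->
  mean (fun w => V w + f w) = mean V + mean f.
Proof.
move=> iV iF; apply: EFin_inj; rewrite -meanE; last exact: integrableD_real.
under eq_integral do rewrite EFinD.
by rewrite integralD// EFinD -!meanE.
Qed.

Lemma meanZ (c : R) V : integ V -> mean (fun w => c * V w) = c * mean V.
Proof.
move=> iV; apply: EFin_inj; rewrite -meanE; last exact: integrableZ_real.
under eq_integral do rewrite EFinM.
by rewrite (integralZl measurableT iV)// EFinM -meanE.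
Qed.

Lemma mean_sum (I : Type) (s : seq I) (V : I -> T -> R) : (forall i, integ (V i)) ->
  integ (fun w => \sum_(i <- s) V i w) /\
  mean (fun w => \sum_(i <- s) V i w) = \sum_(i <- s) mean (V i).
Proof.
move=> iV; elim: s => [|i s [IH1 IH2]].
  under [X in EFin \o X]eq_fun do rewrite big_nil.
  under [X in mean X]eq_fun do rewrite big_nil.
  by rewrite big_nil; split; [exact: integrable_cst | exact: mean_cst].
under [X in EFin \o X]eq_fun do rewrite big_cons.
under [X in mean X]eq_fun do rewrite big_cons.
rewrite big_cons; split; first exact: integrableD_real.
by rewrite meanD// IH2.
Qed.

Lemma eub_mean V c : integ V -> (forall w, 0 <= V w) -> mean V <= c -> eub P V c.
Proof.
move=> iV V0 Vc; split=> //; last by rewrite meanE// lee_fin.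
by apply/measurable_EFinP; have /integrableP[] := iV.
Qed.

(** [W] dominates the quadratic remainder of the exponential, so [expR (theta * V)] has mean at most
    [1 + theta * mean V + S], hence at most the exponential of [theta * mean V + S]. The factor
    [expR (- theta * mean V)] then recenters. *)
Lemma mgf_centered V W S theta : measurable_fun setT V -> integ V ->
  eub P W S -> (forall w, (theta * V w) ^+ 2 * expR `|theta * V w| <= W w) ->
  eub P (fun w => expR (theta * (V w - mean V))) (expR S).
Proof.
move=> mV iV WS hW; case: (WS) => mW W0 _.
have iW : integ W.
  by apply: (@integrable_dom W W S) => // w; rewrite ger0_norm.
have iU : integ (fun w => 1 + (theta * V w + W w)).
  apply: integrableD_real; first exact: integrable_cst.
  by apply: integrableD_real => //; exact: integrableZ_real.
have mU : mean (fun w => 1 + (theta * V w + W w)) <= 1 + (theta * mean V + S).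
  have iUV : integ (fun w => theta * V w + W w).
    by apply: integrableD_real => //; exact: integrableZ_real.
  rewrite meanD//; last exact: integrable_cst.
  rewrite mean_cst lerD2l meanD//; last exact: integrableZ_real.
  rewrite meanZ// lerD2l -lee_fin -meanE//; by case: WS.
have hU w : expR (theta * V w) <= 1 + (theta * V w + W w).
  by have := expR_le_quad (theta * V w); have := hW w; lra.
have U1 : eub P (fun w => 1 + (theta * V w + W w)) (1 + (theta * mean V + S)).
  by apply: eub_mean => // w; apply: le_trans (hU w); exact: expR_ge0.
have U2 : eub P (fun w => expR (theta * V w)) (expR (theta * mean V + S)).
  have := eub_le _ _ hU U1 => h; apply: (@eubW _ _ _ _ _ (1 + (theta * mean V + S))).
    exact: expR_ge1Dx.
  by apply: h; [apply: measurableT_comp => //; exact: measurable_funM | move=> w; exact: expR_ge0].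
have -> : (fun w => expR (theta * (V w - mean V))) =
   (fun w => expR (- (theta * mean V)) * expR (theta * V w)).
  by apply/funext => w; rewrite -expRD; congr expR; ring.
have -> : expR S = expR (- (theta * mean V)) * expR (theta * mean V + S).
  by rewrite -expRD; congr expR; ring.
by apply: eubZ => //; exact: expR_ge0.
Qed.

End Mean.

(** * Truncated products *)

Section Truncation.
Variables (R : realType) (g e a sg : R).
Hypotheses (g0 : 0 < g) (e0 : 0 < e) (a0 : 0 <= a) (sg0 : 0 < sg).
Local Notation A := (bern g e).

(** The cut is made on the Bernstein exponent and not on [|z|]: the low part is then bounded in
    terms of [a], [g] and [e], and the high part keeps the exponential moment of its exponent. *)
Definition trunc_lo z : R := if A z < a then z else 0.
Definition trunc_hi z : R := if A z < a then 0 else z.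
Definition bern_hi z : R := if A z < a then 0 else A z.

Lemma trunc_lo_hi z : z = trunc_lo z + trunc_hi z.
Proof. by rewrite /trunc_lo /trunc_hi; case: ifP => _; rewrite ?addr0 ?add0r. Qed.

Lemma bern_hi_ge0 z : 0 <= bern_hi z.
Proof. by rewrite /bern_hi; case: ifP => // _; exact: bern_ge0. Qed.

Lemma trunc_hi_sqr z :
  trunc_hi z ^+ 2 <= g ^+ 2 * bern_hi z + e ^+ 2 * bern_hi z ^+ 2.
Proof.
rewrite /trunc_hi /bern_hi; case: ifP => _; last exact: bern_sqr.
by rewrite expr0n /= !mulr0 addr0.
Qed.

Lemma trunc_lo_bound h z : 0 <= h -> g ^+ 2 * a + e ^+ 2 * a ^+ 2 <= h ^+ 2 ->
  `|trunc_lo z| <= h.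
Proof.
move=> h0 hh; rewrite /trunc_lo; case: ltP => [Aa|_]; last by rewrite normr0.
rewrite -(@ler_pXn2r _ 2)// ?nnegrE// real_normK ?num_real//.
apply: (le_trans (bern_sqr g0 e0 z)); apply: le_trans hh.
have A0 := bern_ge0 g e0 z.
apply: lerD; apply: ler_wpM2l; rewrite ?sqr_ge0//; first exact: ltW.
by apply: lerXn2r; rewrite ?nnegrE//; exact: ltW.
Qed.

Lemma trunc_abs_le z : `|z| <= 8 * (g + e) * expR (A z / 8).
Proof.
have := @bern_le_expR _ g e g0 e0 z (1 / 4) ltac:(lra) ltac:(lra).
have -> : 4 / (1 / 4) ^+ 2 = 64 :> R by field.
move=> h; rewrite -(@ler_pXn2r _ 2)// ?nnegrE//; last by nonneg.
rewrite real_normK ?num_real// !exprMn -expRM_natl.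
have -> : 2%:R * (A z / 8) = 1 / 4 * A z by field.
apply: (le_trans h); rewrite ler_wpM2r ?expR_ge0//.
have : 0 <= g * e by nonneg.
lra.
Qed.

Lemma measurable_bern_fun : measurable_fun setT A.
Proof.
apply: measurable_minr; apply: measurable_funM => //.
Qed.

Lemma measurable_trunc_lo : measurable_fun setT trunc_lo.
Proof.
apply: measurable_fun_ifT => //.
by apply: measurable_fun_ltr => //; exact: measurable_bern_fun.
Qed.

Lemma measurable_trunc_hi : measurable_fun setT trunc_hi.
Proof.
apply: measurable_fun_ifT => //.
by apply: measurable_fun_ltr => //; exact: measurable_bern_fun.
Qed.

Lemma measurable_bern_hi : measurable_fun setT bern_hi.
Proof.
apply: measurable_fun_ifT => //; last exact: measurable_bern_fun.
by apply: measurable_fun_ltr => //; exact: measurable_bern_fun.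
Qed.

Context d (T : measurableType d) (P : probability T R) (Z xi : T -> R).
Hypothesis mZ : measurable_fun setT Z.
Hypothesis mxi : measurable_fun setT xi.
Hypothesis tailZ : forall s, 0 <= s -> (P [set w | (s <= `|Z w|)%R] <=
  (2 * expR (- Num.min (s ^+ 2 / g ^+ 2) (s / e)))%:E)%E.
Hypothesis xi1 : eub P (fun w => expR (`|xi w| / sg)) 2.

(** A common integrable majorant for all products of [xi] and [Z]. The two factors may be dependent,
    so the geometric mean of their exponential moments is used: each factor contributes half of its
    exponent. *)
Definition envelope w : R := expR (`|xi w| / sg) + expR (A (Z w) / 2).

Lemma envelope_eub : eub P envelope (2 + 12).
Proof. exact: (eubD xi1 (bern_expR g0 e0 mZ tailZ)). Qed.

Lemma expR_le_envelope w :
  expR (`|xi w| / sg / 2) * expR (A (Z w) / 4) <= envelope w / 2.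
Proof.
rewrite -expRD; apply: (le_trans (add_expR_le _ _)); rewrite ler_pM2r//.
by rewrite le_eqVlt; apply/orP; left; apply/eqP; congr (expR _ + expR _); lra.
Qed.

Lemma abs_product_le w : `|xi w * Z w| <= 8 * sg * (g + e) * envelope w.
Proof.
rewrite normrM.
have h1 : `|xi w| <= 2 * sg * expR (`|xi w| / sg / 2).
  have := @le_expR_div _ 2 (`|xi w| / sg) ltac:(lra).
  by rewrite ler_pdivrMr//; lra.
have h2 := trunc_abs_le (Z w).
have h3 : expR (A (Z w) / 8) <= expR (A (Z w) / 4).
  by rewrite ler_expR; have := bern_ge0 g e0 (Z w); lra.
have h4 : `|xi w| * `|Z w| <= (2 * sg * expR (`|xi w| / sg / 2)) * (8 * (g + e) * expR (A (Z w) / 4)).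
  apply: ler_pM => //; apply: (le_trans h2); rewrite ler_wpM2l//; nonneg.
have h5 : 0 <= sg * (g + e) by nonneg.
have := ler_wpM2l h5 (expR_le_envelope w); lra.
Qed.

Lemma integrable_product : P.-integrable setT (EFin \o (fun w => xi w * Z w)).
Proof.
apply: (@integrable_dom _ _ _ _ _ (fun w => 8 * sg * (g + e) * envelope w)).
- exact: measurable_funM.
- exact: abs_product_le.
- by apply: eubZ; [nonneg | exact: envelope_eub].
Qed.

Lemma measurable_lo_product : measurable_fun setT (fun w => xi w * trunc_lo (Z w)).
Proof.
by apply: measurable_funM => //; apply: measurableT_comp => //; exact: measurable_trunc_lo.
Qed.

Lemma measurable_hi_product : measurable_fun setT (fun w => xi w * trunc_hi (Z w)).
Proof.
by apply: measurable_funM => //; apply: measurableT_comp => //; exact: measurable_trunc_hi.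
Qed.

Lemma integrable_lo_product :
  P.-integrable setT (EFin \o (fun w => xi w * trunc_lo (Z w))).
Proof.
apply: (@integrable_dom _ _ _ _ _ (fun w => 8 * sg * (g + e) * envelope w)).
- exact: measurable_lo_product.
- move=> w; apply: le_trans (abs_product_le w); rewrite !normrM ler_wpM2l//.
  by rewrite /trunc_lo; case: ifP => // _; rewrite normr0.
- by apply: eubZ; [nonneg | exact: envelope_eub].
Qed.

Lemma hi_product_le w :
  `|xi w * trunc_hi (Z w)| <= 8 * sg * (g + e) * expR (- (a / 8)) * envelope w.
Proof.
have c0 : 0 <= 8 * sg * (g + e) * expR (- (a / 8)) by nonneg.
have E0 : 0 <= envelope w by rewrite /envelope; nonneg.
rewrite /trunc_hi; case: ltP => [_|aA]; first by rewrite mulr0 normr0 mulr_ge0.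
rewrite normrM.
have h1 : `|xi w| <= 2 * sg * expR (`|xi w| / sg / 2).
  have := @le_expR_div _ 2 (`|xi w| / sg) ltac:(lra).
  by rewrite ler_pdivrMr//; lra.
have h2 := trunc_abs_le (Z w).
have h3 : expR (A (Z w) / 8) <= expR (- (a / 8)) * expR (A (Z w) / 4).
  by rewrite -expRD ler_expR; lra.
have h4 : `|xi w| * `|Z w| <= (2 * sg * expR (`|xi w| / sg / 2)) *
    (8 * (g + e) * (expR (- (a / 8)) * expR (A (Z w) / 4))).
  apply: ler_pM => //; apply: (le_trans h2); rewrite ler_wpM2l//; nonneg.
have := ler_wpM2l c0 (expR_le_envelope w); lra.
Qed.

Lemma mean_hi_product : `|mean P (fun w => xi w * trunc_hi (Z w))| <=
  8 * sg * (g + e) * expR (- (a / 8)) * (2 + 12).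
Proof.
apply: (mean_dom measurable_hi_product hi_product_le).
by apply: eubZ; [nonneg | exact: envelope_eub].
Qed.

Lemma integrable_hi_product :
  P.-integrable setT (EFin \o (fun w => xi w * trunc_hi (Z w))).
Proof.
apply: (integrable_dom measurable_hi_product hi_product_le).
by apply: eubZ; [nonneg | exact: envelope_eub].
Qed.

Lemma mean_product_split : mean P (fun w => xi w * Z w) =
  mean P (fun w => xi w * trunc_lo (Z w)) + mean P (fun w => xi w * trunc_hi (Z w)).
Proof.
rewrite -meanD; [|exact: integrable_lo_product|exact: integrable_hi_product].
by congr (mean P _); apply/funext => w; rewrite -mulrDr -trunc_lo_hi.
Qed.

(** With one factor bounded by [h], the product is as sub-exponential as [xi]: the restriction on
    [theta] gives [|theta * xi * trunc_lo Z| <= |xi| / (4 * sg)], which leaves room for the two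
    squares of the remainder within [envelope]. *)
Lemma mgf_lo_product (h theta : R) : 0 <= h ->
  g ^+ 2 * a + e ^+ 2 * a ^+ 2 <= h ^+ 2 -> `|theta| * sg * h <= 1 / 4 ->
  eub P (fun w => expR (theta * (xi w * trunc_lo (Z w) -
                                 mean P (fun w => xi w * trunc_lo (Z w)))))
    (expR ((64 * 32) * theta ^+ 2 * sg ^+ 2 * (g ^+ 2 + e ^+ 2) * (2 + 12))).
Proof.
move=> h0 hh th; apply: (mgf_centered measurable_lo_product integrable_lo_product
  (W := fun w => (64 * 32) * theta ^+ 2 * sg ^+ 2 * (g ^+ 2 + e ^+ 2) * envelope w)).
  by apply: eubZ; [nonneg | exact: envelope_eub].
move=> w; set B := `|xi w| / sg.
have xB : `|xi w| = sg * B by rewrite /B mulrC divfK// gt_eqF.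
have B0 : 0 <= B by rewrite /B divr_ge0// ltW.
have h1 : `|theta * (xi w * trunc_lo (Z w))| <= B / 4.
  rewrite !normrM xB.
  have l := ler_wpM2l (mulr_ge0 (normr_ge0 theta) (mulr_ge0 (ltW sg0) B0))
    (trunc_lo_bound (Z w) h0 hh).
  by have := ler_wpM2l B0 th; lra.
have h2 : B ^+ 2 <= 64 * expR (B / 4).
  by apply: (le_trans (@sqr_le_expR _ 4 B _ B0)) => //; rewrite -natrM -natrX.
have h3 : trunc_lo (Z w) ^+ 2 <= 64 * (g ^+ 2 + e ^+ 2) * expR (A (Z w) / 4).
  have := @bern_le_expR _ g e g0 e0 (Z w) (1 / 4) ltac:(lra) ltac:(lra).
  have -> : 4 / (1 / 4) ^+ 2 = 64 :> R by field.
  have -> : 1 / 4 * A (Z w) = A (Z w) / 4 by ring.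
  apply: le_trans; rewrite /trunc_lo; case: ifP => // _.
  by rewrite expr0n /= sqr_ge0.
rewrite exprMn exprMn -[xi w ^+ 2]real_normK ?num_real// xB exprMn.
have h4 : B ^+ 2 * trunc_lo (Z w) ^+ 2 * expR `|theta * (xi w * trunc_lo (Z w))| <=
  (64 * expR (B / 4)) * (64 * (g ^+ 2 + e ^+ 2) * expR (A (Z w) / 4)) * expR (B / 4).
  apply: ler_pM; [nonneg | nonneg | | by rewrite ler_expR].
  by apply: ler_pM; [nonneg | nonneg | |].
have h5 : expR (B / 4) * expR (B / 4) = expR (`|xi w| / sg / 2).
  by rewrite -expRD -/B; congr expR; field.
have c0 : 0 <= theta ^+ 2 * sg ^+ 2 by nonneg.
have c1 : 0 <= 64 * 64 * (theta ^+ 2 * sg ^+ 2 * (g ^+ 2 + e ^+ 2)) by nonneg.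
have := ler_wpM2l c0 h4; have := ler_wpM2l c1 (expR_le_envelope w).
rewrite -h5; lra.
Qed.

(** The exponential exceeds 1 only where [A >= a], and there [expR (A / 4) <= expR (- a / 4) * expR
    (A / 2)]. Over [n] copies the total exponent is [12 * n * expR (- a / 4)], which stays small for
    a suitable cut. *)
Lemma mgf_bern_hi :
  eub P (fun w => expR (bern_hi (Z w) / 4)) (expR (12 * expR (- (a / 4)))).
Proof.
apply: (@eubW _ _ _ _ _ (1 + expR (- (a / 4)) * 12)).
  by rewrite [_ * 12]mulrC; exact: expR_ge1Dx.
apply: (@eub_le _ _ _ _ _ (fun w => 1 + expR (- (a / 4)) * expR (A (Z w) / 2))).
- apply: measurableT_comp => //; apply: measurable_funM => //.
  by apply: measurableT_comp => //; exact: measurable_bern_hi.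
- by move=> w; exact: expR_ge0.
- move=> w; rewrite /bern_hi -expRD; case: ltP => aA.
    by rewrite mul0r expR0 lerDl expR_ge0.
  have : expR (A (Z w) / 4) <= expR (- (a / 4) + A (Z w) / 2) by rewrite ler_expR; lra.
  lra.
by apply: eubD; [exact: eub_cst | apply: eubZ; [nonneg | exact: bern_expR]].
Qed.

End Truncation.

(** * One link of the multiplier process *)

Lemma probability_setU3 d (T : measurableType d) (R : realType)
    (P : probability T R) (A B1 B2 B3 : set T) (b1 b2 b3 : R) :
  measurable A -> measurable B1 -> measurable B2 -> measurable B3 ->
  A `<=` B1 `|` B2 `|` B3 ->
  (P B1 <= b1%:E)%E -> (P B2 <= b2%:E)%E -> (P B3 <= b3%:E)%E ->
  (P A <= (b1 + b2 + b3)%:E)%E.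
Proof.
move=> mA m1 m2 m3 AB h1 h2 h3.
apply: (@le_trans _ _ (P (B1 `|` B2 `|` B3))).
  apply: le_measure; rewrite ?inE//; apply: measurableU => //; exact: measurableU.
apply: (le_trans (measureU2 _ _ _)) => //; first exact: measurableU.
rewrite !EFinD; apply: leeD => //.
by apply: (le_trans (measureU2 _ _ _)) => //; exact: leeD.
Qed.

Lemma probability_bigU d (T : measurableType d) (R : realType)
    (P : probability T R) (I : Type) (s : seq I) (B : I -> set T) (b : I -> R) :
  (forall i, measurable (B i)) -> (forall i, (P (B i) <= (b i)%:E)%E) ->
  measurable (\big[setU/set0]_(i <- s) B i) /\
  (P (\big[setU/set0]_(i <- s) B i) <= (\sum_(i <- s) b i)%:E)%E.
Proof.
move=> mB hB; elim: s => [|i s [m IH]].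
  by rewrite !big_nil measure0; split.
rewrite !big_cons; split; first exact: measurableU.
rewrite EFinD; apply: le_trans (leeD (hB i) IH); exact: measureU2.
Qed.

Lemma expR_divN (R : realType) (x k : R) : expR (x / k) * expR (- (x / k)) = 1.
Proof. by rewrite -expRD subrr expR0. Qed.

(** The Cauchy-Schwarz inequality with a free weight [c] in place of square roots. *)
Lemma young_sum (R : realType) n (u v : 'I_n -> R) (c U V : R) : 0 < c ->
  \sum_k u k ^+ 2 <= U -> \sum_k v k ^+ 2 <= V ->
  `|\sum_k u k * v k| <= (c * U + c^-1 * V) / 2.
Proof.
move=> c0 hU hV; apply: (le_trans (ler_norm_sum _ _ _)).
apply: (@le_trans _ _ (\sum_k (c * u k ^+ 2 + c^-1 * v k ^+ 2) / 2)).
  apply: ler_sum => k _; rewrite normrM.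
  have h := sqr_ge0 (c * `|u k| - `|v k|).
  rewrite -(real_normK (num_real (u k))) -(real_normK (num_real (v k))).
  rewrite -(ler_pM2l c0).
  have -> : c * ((c * `|u k| ^+ 2 + c^-1 * `|v k| ^+ 2) / 2) =
    ((c * `|u k|) ^+ 2 + `|v k| ^+ 2) / 2.
    by field; rewrite gt_eqF.
  lra.
rewrite -mulr_suml big_split /= -!mulr_sumr ler_pM2r//.
by apply: lerD; apply: ler_wpM2l => //; rewrite ?invr_ge0 ltW.
Qed.

Section MultiplierLink.
Context d d' (T : measurableType d) (T' : measurableType d') (R : realType).
Variables (P : probability T R) (n : nat) (Z0 : T -> T') (Z : 'I_n -> T -> T').
Hypothesis iid : independent_copies P Z0 Z.
Hypothesis mZ0 : measurable_fun setT Z0.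
Hypothesis mZ : forall i, measurable_fun setT (Z i).
Variables (xi : T' -> R) (sg b : R).
Hypotheses (mxi : measurable_fun setT xi) (sg0 : 0 < sg) (b1 : 1 <= b).
Hypothesis bn : b ^+ 2 = n%:R.
Hypothesis xi1 : eub P (fun w => expR (`|xi (Z0 w)| / sg)) 2.

Let b0 : 0 < b. Proof. exact: lt_le_trans b1. Qed.

(** The squares have no exponential moment. Restricted to [B <= b], however,
    [B^2 / (2 * b) <= B / 2] has one, and the sum of these exceeds [17 * b] with probability at most
    [expR (- b)]. The exceptions [B > b] have probability at most [2 * expR (- b)] each; there are
    [n = b^2] of them, and [b^2 * expR (- b) <= 16 * expR (- b / 2)]. Hence [34 = 2 * 17] and
    [33 = 1 + 2 * 16]. *)
Lemma multiplier_norm :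
  (P [set w | (34 * sg ^+ 2 * b ^+ 2 < \sum_k xi (Z k w) ^+ 2)%R] <=
   (33 * expR (- (b / 2)))%:E)%E.
Proof.
move: (b0) (b1) (sg0) => b0' b1' sg0'.
pose B z := `|xi z| / sg.
have mB : measurable_fun setT B by apply: measurable_funM => //; exact: measurableT_comp.
have B0 z : 0 <= B z by rewrite /B divr_ge0// ltW.
have xB z : xi z ^+ 2 = sg ^+ 2 * B z ^+ 2.
  rewrite -real_normK ?num_real// -exprMn /B; congr (_ ^+ _).
  by rewrite mulrC divfK// gt_eqF.
pose f z := (if B z <= b then B z ^+ 2 else 0) / (2 * b).
have mf : measurable_fun setT f.
  apply: measurable_funM => //; apply: measurable_fun_ifT => //.
    exact: measurable_fun_ler.
  exact: measurable_funX.
have E1 : eub P (fun w => expR (f (Z0 w))) (expR (16 / b)).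
  apply: (@eubW _ _ _ _ _ (1 + 8 / b * 2)).
    by apply: le_trans (expR_ge1Dx _); lra.
  apply: (@eub_le _ _ _ _ _ (fun w => 1 + 8 / b * expR (`|xi (Z0 w)| / sg))).
  - by apply: measurableT_comp => //; exact: measurableT_comp.
  - by move=> w; exact: expR_ge0.
  - move=> w; rewrite -/(B (Z0 w)) /f; set z := Z0 w; have Bz := B0 z.
    have c0 : 0 <= 8 / b by rewrite divr_ge0// ltW.
    case: ifP => Bb; last by rewrite mul0r expR0 lerDl mulr_ge0// expR_ge0.
    set y := B z ^+ 2 / (2 * b).
    have y0 : 0 <= y by rewrite divr_ge0 ?sqr_ge0// mulr_ge0// ltW.
    have yB : y <= B z / 2.
      rewrite /y ler_pdivrMr ?mulr_gt0// expr2.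
      by have := ler_wpM2l Bz Bb; lra.
    have h1 : expR y <= 1 + y * expR y.
      have := expR_ge1Dx (- y) => /(ler_wpM2l (expR_ge0 y)).
      by rewrite -expRD subrr expR0; lra.
    have h2 : y <= 8 / b * expR (B z / 2).
      have := @sqr_le_expR _ 2 (B z) ltac:(lra) Bz.
      rewrite /y ler_pdivrMr ?mulr_gt0//.
      have -> : 8 / b * expR (B z / 2) * (2 * b) = 16 * expR (B z / 2) by field; rewrite ?gt_eqF.
      lra.
    apply: (le_trans h1); rewrite lerD2l.
    have -> : B z = B z / 2 + B z / 2 by lra.
    by rewrite expRD mulrA; apply: ler_pM => //; rewrite ?expR_ge0 ?ler_expR.
  - by apply: eubD; [exact: eub_cst | apply: eubZ => //; rewrite divr_ge0// ltW].
pose S w := \sum_(k < n) f (Z k w).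
have mS : measurable_fun setT S.
  by apply: measurable_sum => k; exact: measurableT_comp.
have E2 : (P [set w | (17 * b <= S w)%R] <= (expR (- b))%:E)%E.
  have := eub_chernoff (17 * b) (iid_sum_expR iid mZ0 mZ mf E1).
  have -> // : n%:R * (16 / b) - 17 * b = - b.
  by rewrite -bn; field; rewrite ?gt_eqF.
pose F k := [set w | b < B (Z k w)].
have mF k : measurable (F k).
  by apply: measurable_gt; exact: measurableT_comp.
have PF k : (P (F k) <= (2 * expR (- b))%:E)%E.
  rewrite (_ : F k = [set w | [set z | b < B z] (Z k w)])// (iid_law iid); last first.
    exact: measurable_gt.
  apply: (@le_trans _ _ (P [set w | (expR b <= expR (`|xi (Z0 w)| / sg))%R])).
    apply: le_measure; rewrite ?inE.
    - by apply: measurable_gt; exact: measurableT_comp.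
    - by apply: measurable_ge; case: xi1.
    - by move=> w /= h; rewrite ler_expR ltW.
  by apply: (le_trans (eub_markov xi1 (expR_gt0 b))); rewrite expRN.
have [mU PU] := probability_bigU (index_enum 'I_n) mF PF.
have hb2 : b ^+ 2 * expR (- b) <= 16 * expR (- (b / 2)).
  have h := ler_wpM2r (expR_ge0 (- b)) (@sqr_le_expR _ 2 b ltac:(lra) (ltW b0)).
  have e : expR (b / 2) * expR (- b) = expR (- (b / 2)) by rewrite -expRD; congr (expR _); field.
  by move: h e; lra.
have hb1 : expR (- b) <= expR (- (b / 2)) by rewrite ler_expR; lra.
apply: (@le_trans _ _ (P ([set w | (17 * b <= S w)%R] `|` \big[setU/set0]_(k <- index_enum 'I_n) F k))).
  have mxi2 : measurable_fun setT (fun w => \sum_k xi (Z k w) ^+ 2).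
    apply: measurable_sum => k; apply: measurable_funX; exact: measurableT_comp.
  apply: le_measure; rewrite ?inE.
  - exact: measurable_gt.
  - by apply: measurableU => //; exact: measurable_ge.
  move=> w /= hw; case: (pselect (exists k, b < B (Z k w))) => [[k hk]|nk].
    by right; rewrite -bigcup_seq; exists k => //=; rewrite mem_index_enum.
  left; rewrite leNgt; apply/negP => hS; move: hw; apply/negP; rewrite -leNgt.
  have e : \sum_k xi (Z k w) ^+ 2 = sg ^+ 2 * (2 * b) * S w.
    rewrite /S mulr_sumr; apply: eq_bigr => k _; rewrite xB /f ifT; last first.
      by rewrite leNgt; apply/negP => hk; apply: nk; exists k.
    by field; rewrite ?gt_eqF.
  rewrite e.
  have c0 : 0 <= sg ^+ 2 * (2 * b) by nonneg.
  by have := ler_wpM2l c0 (ltW hS); lra.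
have mS17 := measurable_ge (17 * b) mS.
apply: (@le_trans _ _ (P [set w | (17 * b <= S w)%R] +
  P (\big[setU/set0]_(k <- index_enum 'I_n) F k))%E); first exact: measureU2.
apply: (@le_trans _ _ (expR (- b) + n%:R * (2 * expR (- b)))%:E); last first.
  by rewrite lee_fin -bn; lra.
rewrite EFinD; apply: leeD; first exact: E2.
apply: (le_trans PU).
by rewrite lee_fin sumr_const card_ord [leRHS]mulr_natl.
Qed.

Variables (zeta : T' -> R) (g e r : R).
Hypotheses (mzeta : measurable_fun setT zeta) (g0 : 0 < g) (e0 : 0 < e) (r1 : 1 <= r).
Hypothesis tailZ : forall s, 0 <= s -> (P [set w | (s <= `|zeta (Z0 w)|)%R] <=
  (2 * expR (- Num.min (s ^+ 2 / g ^+ 2) (s / e)))%:E)%E.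

Let r0 : 0 < r. Proof. exact: lt_le_trans r1. Qed.
(** The upper bounds [ab] and [abr] keep the low part below [b * (g / r + e)]. Conversely [a] is
    large enough for the high part: [exp_a4] makes the total exponent of [mgf_bern_hi] at most a
    multiple of [r^2], and [exp_a8] does the same for the bias of the truncation, relative to
    [b * r]. *)
Let a : R := Num.min (b ^+ 2 / r ^+ 2) b.
Let a0 : 0 <= a.
Proof. by rewrite le_min divr_ge0 ?sqr_ge0 ?(ltW b0). Qed.
Let ab : a <= b. Proof. by rewrite ge_min lexx orbT. Qed.
Let abr : a <= b ^+ 2 / r ^+ 2. Proof. by rewrite ge_min lexx. Qed.

Let exp_a4 : b ^+ 2 * expR (- (a / 4)) <= 64 * r ^+ 2.
Proof.
move: (b0) (b1) (r0) (r1) => b0' b1' r0' r1'.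
rewrite /a; case: (leP (b ^+ 2 / r ^+ 2) b) => _.
  set y := b ^+ 2 / r ^+ 2.
  have hb : b ^+ 2 = r ^+ 2 * y by rewrite /y mulrC divfK// expf_neq0// gt_eqF.
  have h : y * expR (- (y / 4)) <= 4.
    have h := ler_wpM2r (expR_ge0 (- (y / 4))) (@le_expR_div _ 4 y ltac:(lra)).
    by have := expR_divN y 4; lra.
  rewrite hb; have := ler_wpM2l (sqr_ge0 r) h; have := sqr_ge0 r; lra.
have h := ler_wpM2r (expR_ge0 (- (b / 4))) (@sqr_le_expR _ 4 b ltac:(lra) (ltW b0)).
have eb := expR_divN b 4.
have : 1 <= r ^+ 2 by rewrite -(expr1n _ 2) lerXn2r// nnegrE ltW.
by move: h eb; lra.
Qed.

Let exp_a8 : b ^+ 2 * expR (- (a / 8)) <= 8 * b * r.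
Proof.
move: (b0) (b1) (r0) (r1) => b0' b1' r0' r1'.
rewrite /a; case: (leP (b ^+ 2 / r ^+ 2) b) => _.
  pose y := b / r.
  have y0 : 0 <= y by rewrite divr_ge0// ltW.
  have -> : b ^+ 2 / r ^+ 2 = y ^+ 2 by rewrite /y exprMn exprVn.
  have h : y * expR (- (y ^+ 2 / 8)) <= 8.
    have h1 : y ^+ 2 <= (2 * expR (y ^+ 2 / 8)) ^+ 2.
      rewrite [leRHS]exprMn -expRM_natl; have -> : 2%:R * (y ^+ 2 / 8) = y ^+ 2 / 4 by field.
      have := @le_expR_div _ 4 (y ^+ 2) ltac:(lra).
      by have -> : 2 ^+ 2 = 4 :> R by ring.
    have : y <= 2 * expR (y ^+ 2 / 8).
      by rewrite -(@ler_pXn2r _ 2)// nnegrE//; nonneg.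
    move=> /(ler_wpM2r (expR_ge0 (- (y ^+ 2 / 8)))).
    by have := expR_divN (y ^+ 2) 8; lra.
  have -> : b ^+ 2 = b * r * y by rewrite /y; field; rewrite ?gt_eqF.
  have c0 : 0 <= b * r by nonneg.
  have := ler_wpM2l c0 h; lra.
have h := @le_expR_div _ 8 b ltac:(lra).
have h2 : b * expR (- (b / 8)) <= 8.
  have := ler_wpM2r (expR_ge0 (- (b / 8))) h.
  by have := expR_divN b 8; lra.
have := ler_wpM2l (ltW b0) h2; have : b <= b * r by rewrite ler_pMr.
lra.
Qed.

Let m := mean P (fun w => xi (Z0 w) * zeta (Z0 w)).
(** With [r = u * sqrt (2^s)], the sums of [Q] along a chain are bounded by the two gamma sums. *)
Let Q := r * g + r ^+ 2 * e.

(** The centered sum is split into the centered low part, the high part and minus [n] times the mean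
    of the high part. The first is treated by Chernoff's bound for both signs; the second by
    [young_sum] with the bound on the [xi^2] assumed in the event; the third is deterministic. The
    exponent [7 * r^2] beats the [64^(2^s)] links of a level with room to spare. *)
Lemma multiplier_link :
  (P [set w | (200 * 400 * sg * b * Q <=
                 `|\sum_k (xi (Z k w) * zeta (Z k w) - m)|)%R /\
              (\sum_k xi (Z k w) ^+ 2 <= 34 * sg ^+ 2 * b ^+ 2)%R] <=
   (3 * expR (- (7 * r ^+ 2)))%:E)%E.
Proof.
move: (b0) (b1) (r0) (r1) (sg0) (g0) (e0) => b0' b1' r0' r1' sg0' g0' e0'.
move: (exp_a4) (exp_a8) => exp_a4' exp_a8'.
have mzZ : measurable_fun setT (fun w => zeta (Z0 w)) by exact: measurableT_comp.
have mxZ : measurable_fun setT (fun w => xi (Z0 w)) by exact: measurableT_comp.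
pose lo z := xi z * trunc_lo g e a (zeta z).
pose hi z := trunc_hi g e a (zeta z).
pose bh z := bern_hi g e a (zeta z).
have mlo : measurable_fun setT lo.
  by apply: measurable_funM => //; apply: measurableT_comp => //; exact: measurable_trunc_lo.
have mhi : measurable_fun setT hi.
  by apply: measurableT_comp => //; exact: measurable_trunc_hi.
have mbh : measurable_fun setT bh.
  by apply: measurableT_comp => //; exact: measurable_bern_hi.
pose m1 := mean P (fun w => lo (Z0 w)).
pose m2 := mean P (fun w => xi (Z0 w) * hi (Z0 w)).
have mE : m = m1 + m2 by exact: (mean_product_split a g0 e0 sg0 mzZ mxZ tailZ xi1).
have Q0 : 0 < Q by rewrite addr_gt0// mulr_gt0// exprn_gt0.
have rr : r <= r ^+ 2 by rewrite expr2 ler_pMr.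
have geQ : r * (g + e) <= Q by rewrite /Q mulrDr lerD2l ler_pM2r.
pose h := b * (g / r + e).
have h0 : 0 <= h by rewrite /h; nonneg.
have hh : g ^+ 2 * a + e ^+ 2 * a ^+ 2 <= h ^+ 2.
  have x1 := ler_wpM2l (sqr_ge0 g) abr.
  have x2 : e ^+ 2 * a ^+ 2 <= e ^+ 2 * b ^+ 2.
    by rewrite ler_wpM2l ?sqr_ge0// lerXn2r// nnegrE ltW.
  apply: (le_trans (lerD x1 x2)).
  have -> : g ^+ 2 * (b ^+ 2 / r ^+ 2) = (b * (g / r)) ^+ 2 by field; rewrite ?gt_eqF.
  have -> : e ^+ 2 * b ^+ 2 = (b * e) ^+ 2 by ring.
  have : 0 <= (b * (g / r)) * (b * e) by nonneg.
  rewrite /h mulrDr; lra.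
(* Bernstein scale for a deviation of exponent [r^2]: a variance term and a term for the sup bound
   [h]. The choice of [h] gives [r^2 * h = b * Q], so both are of order [b * Q]; [theta] is the
   matching Chernoff parameter. *)
pose D := b * r * (g + e) + r ^+ 2 * h.
have r2h : r ^+ 2 * h = b * Q by rewrite /h /Q; field; rewrite ?gt_eqF.
have brge : 0 < b * r * (g + e) by rewrite !mulr_gt0// addr_gt0.
have D0 : 0 < D by rewrite /D r2h addr_gt0// mulr_gt0.
have DQ : D <= 2 * b * Q.
  by rewrite /D r2h; have := ler_wpM2l (ltW b0) geQ; lra.
pose theta := r ^+ 2 / (4 * sg * D).
have th0 : 0 < theta by rewrite divr_gt0 ?exprn_gt0// !mulr_gt0.
have thD : theta * (sg * D) = r ^+ 2 / 4 by rewrite /theta; field; rewrite ?gt_eqF.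
have thh : theta * sg * h <= 1 / 4.
  have -> : theta * sg * h = r ^+ 2 * h / D / 4 by rewrite /theta; field; rewrite ?gt_eqF.
  have : r ^+ 2 * h / D <= 1 by rewrite ler_pdivrMr// mul1r /D lerDr ltW.
  lra.
pose S0 := (64 * 32) * theta ^+ 2 * sg ^+ 2 * (g ^+ 2 + e ^+ 2) * (2 + 12).
have nS : n%:R * S0 <= 32 * (7 * 8) * r ^+ 2.
  have x1 : theta * sg * (b * (g + e)) <= r / 4.
    rewrite -(ler_pM2r D0).
    have -> : theta * sg * (b * (g + e)) * D = r * (b * r * (g + e)) / 4.
      by rewrite /theta; field; rewrite ?gt_eqF.
    have : r * (b * r * (g + e)) <= r * D.
      by rewrite ler_pM2l// /D lerDl mulr_ge0// sqr_ge0.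
    lra.
  have x2 : (theta * sg * (b * (g + e))) ^+ 2 <= (r / 4) ^+ 2.
    by rewrite lerXn2r// nnegrE; nonneg.
  have x3 : g ^+ 2 + e ^+ 2 <= (g + e) ^+ 2.
    have : 0 <= g * e by nonneg.
    lra.
  have c0 : 0 <= theta ^+ 2 * sg ^+ 2 * b ^+ 2 by nonneg.
  have := ler_wpM2l c0 x3; rewrite -bn /S0; lra.
(* As [theta * sg * D = r^2 / 4], the level is [1799 * r^2]; the exponential moment costs at most
   [1792 * r^2], which leaves [7 * r^2]. *)
pose E1 := [set w | (theta * sg * (257 * 28 * D) <= \sum_k theta * (lo (Z k w) - m1))%R].
pose E2 := [set w | (theta * sg * (257 * 28 * D) <= \sum_k - theta * (lo (Z k w) - m1))%R].
(* [775 = 12 * 64 + 7], with 12 from [mgf_bern_hi] and 64 from [exp_a4]. *)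
pose E3 := [set w | (775 * r ^+ 2 <= \sum_k bh (Z k w) / 4)%R].
have mf t : measurable_fun setT (fun z => t * (lo z - m1)).
  by apply: measurable_funM => //; exact: measurable_funB.
have P12 t : `|t| = theta ->
  (P [set w | (theta * sg * (257 * 28 * D) <= \sum_k t * (lo (Z k w) - m1))%R] <=
     (expR (- (7 * r ^+ 2)))%:E)%E.
  move=> tt.
  have tt2 : t ^+ 2 = theta ^+ 2 by rewrite -tt real_normK ?num_real.
  have := mgf_lo_product g0 e0 a0 sg0 mzZ mxZ tailZ xi1 (theta := t) h0 hh.
  rewrite tt tt2 => /(_ thh) hm.
  apply: (le_trans (eub_chernoff _ (iid_sum_expR iid mZ0 mZ (mf t) hm))).
  rewrite lee_fin ler_expR -/S0.
  have -> : theta * sg * (257 * 28 * D) = 257 * 28 * (theta * (sg * D)) by ring.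
  rewrite thD; lra.
have P1 : (P E1 <= (expR (- (7 * r ^+ 2)))%:E)%E by apply: P12; rewrite gtr0_norm.
have P2 : (P E2 <= (expR (- (7 * r ^+ 2)))%:E)%E by apply: P12; rewrite normrN gtr0_norm.
have P3 : (P E3 <= (expR (- (7 * r ^+ 2)))%:E)%E.
  have mbh4 : measurable_fun setT (fun z => bh z / 4) by exact: measurable_funM.
  apply: (le_trans (eub_chernoff _ (iid_sum_expR iid mZ0 mZ mbh4
    (mgf_bern_hi a g0 e0 mzZ tailZ)))).
  by rewrite lee_fin ler_expR -bn; lra.
have -> : 3 * expR (- (7 * r ^+ 2)) =
  expR (- (7 * r ^+ 2)) + expR (- (7 * r ^+ 2)) + expR (- (7 * r ^+ 2)) by ring.
apply: (probability_setU3 _ _ _ _ _ P1 P2 P3).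
- apply: measurableI.
    apply: measurable_ge; apply: measurableT_comp => //; apply: measurable_sum => k.
    by apply: measurable_funB => //; apply: measurable_funM; exact: measurableT_comp.
  have mx2 : measurable_fun setT (fun w => \sum_k xi (Z k w) ^+ 2).
    apply: measurable_sum => k; apply: measurable_funX; exact: measurableT_comp.
  have := measurable_gt (34 * sg ^+ 2 * b ^+ 2) mx2 => /measurableC.
  by congr (measurable _); apply/seteqP; split=> w /=; rewrite leNgt => /negP.
- apply: measurable_ge; apply: measurable_sum => k; exact: (measurableT_comp (mf _) (mZ k)).
- apply: measurable_ge; apply: measurable_sum => k; exact: (measurableT_comp (mf _) (mZ k)).
- apply: measurable_ge; apply: measurable_sum => k; apply: measurable_funM => //.
  exact: measurableT_comp.
move=> w /= [hbig hx]; apply: contrapT => /not_orP[/not_orP[n1 n2] n3].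
move: n1 n2 n3; rewrite /E1 /E2 /E3 /= => /negP + /negP + /negP.
rewrite -!ltNge => n1 n2 n3.
clear hh h0 thh nS brge rr P1 P2 P3 P12 exp_a4' thD r2h.
have t1 : `|\sum_k (lo (Z k w) - m1)| <= 2 * b * Q * (257 * 28) * sg.
  apply: (@le_trans _ _ (sg * (257 * 28 * D))); last first.
    by move: (ler_wpM2l (ltW sg0) DQ); lra.
  have l1 : theta * \sum_k (lo (Z k w) - m1) < theta * (sg * (257 * 28 * D)).
    by rewrite mulr_sumr [ltRHS]mulrA.
  have l2 : - theta * \sum_k (lo (Z k w) - m1) < theta * (sg * (257 * 28 * D)).
    by rewrite mulr_sumr [ltRHS]mulrA.
  rewrite mulNr -mulrN in l2; rewrite !ltr_pM2l// in l1 l2.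
  clear n1 n2 n3 DQ geQ mE b0' b1' r0' r1' sg0' g0' e0' exp_a8'.
  by rewrite ler_norml; apply/andP; split; lra.
clear n1 n2 DQ.
have bh0 k : 0 <= bh (Z k w) by exact: bern_hi_ge0.
(* [3100 = 4 * 775] is the bound on the sum [U] of the high exponents, in units of [r^2]. The
   squares of the high parts add up to at most [g^2 * U + e^2 * U^2], since the sum of squares of
   nonnegative numbers is at most the square of their sum. *)
pose Y := 31 * 100 * Q.
have sY : \sum_k hi (Z k w) ^+ 2 <= Y ^+ 2.
  pose U := \sum_k bh (Z k w).
  have U0 : 0 <= U by apply: sumr_ge0.
  have Ur : U <= 31 * 100 * r ^+ 2 by move: n3; rewrite -mulr_suml -/U; lra.
  apply: (@le_trans _ _ (g ^+ 2 * U + e ^+ 2 * U ^+ 2)).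
    apply: (@le_trans _ _ (\sum_k (g ^+ 2 * bh (Z k w) + e ^+ 2 * bh (Z k w) ^+ 2))).
      by apply: ler_sum => k _; exact: trunc_hi_sqr.
    rewrite big_split /= -!mulr_sumr -/U lerD2l ler_wpM2l ?sqr_ge0//.
    rewrite expr2 {2}/U mulr_sumr; apply: ler_sum => k _.
    rewrite expr2 ler_wpM2r// /U (bigD1 k)//= lerDl; exact: sumr_ge0.
  have x1 := ler_wpM2l (sqr_ge0 g) Ur.
  have x2 : U ^+ 2 <= (31 * 100 * r ^+ 2) ^+ 2.
    by rewrite lerXn2r// nnegrE; nonneg.
  have x3 := ler_wpM2l (sqr_ge0 e) x2.
  apply: (le_trans (lerD x1 x3)); rewrite /Y /Q.
  have : 0 <= (r * g) * (r ^+ 2 * e) by nonneg.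
  have : 0 <= (r * g) ^+ 2 by nonneg.
  lra.
clear n3.
have t2 : `|\sum_k xi (Z k w) * hi (Z k w)| <= 18 * sg * b * Y.
  have Y0 : 0 < Y by rewrite !mulr_gt0.
  have c0 : 0 < Y / (sg * b) by rewrite divr_gt0// mulr_gt0.
  apply: (le_trans (young_sum c0 hx sY)).
  have -> : (Y / (sg * b) * (34 * sg ^+ 2 * b ^+ 2) + (Y / (sg * b))^-1 * Y ^+ 2) / 2 =
    35 / 2 * (sg * b * Y) by field; rewrite ?gt_eqF.
  have : 0 <= sg * b * Y by nonneg.
  lra.
have t3 : `|n%:R * m2| <= 8 * 8 * 14 * sg * b * Q.
  rewrite normrM ger0_norm// -bn.
  have x1 := mean_hi_product a g0 e0 sg0 mzZ mxZ tailZ xi1.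
  have x2 := ler_wpM2l (sqr_ge0 b) x1.
  apply: (le_trans x2).
  have c0 : 0 <= 8 * sg * (g + e) * 14 by nonneg.
  have x3 := ler_wpM2l c0 exp_a8.
  have c1 : 0 <= 8 * 8 * 14 * sg * b by nonneg.
  have x4 := ler_wpM2l c1 geQ.
  move: x3 x4; lra.
have split : \sum_k (xi (Z k w) * zeta (Z k w) - m) =
   \sum_k (lo (Z k w) - m1) + \sum_k xi (Z k w) * hi (Z k w) - n%:R * m2.
  have -> : n%:R * m2 = \sum_(k < n) m2 by rewrite sumr_const card_ord mulr_natl.
  rewrite -big_split -sumrB /=; apply: eq_bigr => k _.
  rewrite mE [zeta (Z k w)](trunc_lo_hi g e a) /lo /hi; ring.
(* The three parts amount to [14392 + 55800 + 896 = 71088] times [sg * b * Q], below [200 * 400]. *)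
move: hbig; rewrite split.
have := ler_normB (\sum_k (lo (Z k w) - m1) + \sum_k xi (Z k w) * hi (Z k w)) (n%:R * m2).
have := ler_normD (\sum_k (lo (Z k w) - m1)) (\sum_k xi (Z k w) * hi (Z k w)).
have : 0 < sg * b * Q by rewrite !mulr_gt0.
move: t1 t2 t3; rewrite /Y.
clear geQ mE b0' b1' r0' r1' sg0' g0' e0' exp_a8' split; lra.
Qed.

End MultiplierLink.

(** * Chaining *)

Section Seminorm.
Variables (R : realType) (p : nat) (N : 'rV[R]_p -> R).
Hypothesis sN : seminorm N.

Lemma seminorm0 : N 0 = 0.
Proof. by case: sN => _ h; have := h 0 0; rewrite scale0r normr0 mul0r. Qed.

Lemma seminormN v : N (- v) = N v.
Proof. by case: sN => _ h; rewrite -scaleN1r h normrN1 mul1r. Qed.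

Lemma seminorm_ge0 v : 0 <= N v.
Proof.
case: (sN) => h _; have := h v (- v).
by rewrite subrr seminorm0 seminormN; lra.
Qed.

Lemma seminormB u v w : N (u - v) <= N (w - v) + N (w - u).
Proof.
case: (sN) => h _; have := h (w - v) (- (w - u)); rewrite seminormN.
by rewrite (_ : w - v - (w - u) = u - v)// opprB addrC addrA subrK.
Qed.

End Seminorm.

Section AdmissibleChain.
Variables (R : realType) (p : nat).
Local Notation V := 'rV[R]_p.
Variables (N : V -> R) (alpha : nat) (S : set V) (a : R).
Hypothesis sN : seminorm N.
Hypothesis gammaN : (gamma alpha S N < a%:E)%E.

(** Replaces an almost optimal admissible sequence by real data: the block [B s v] of [v], a list
    [Ls s] of blocks, and the diameter [x s v], which is finite because the partial sums stay below
    [a]. *)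
Lemma gamma_blocks : exists (B : nat -> V -> set V) (Ls : nat -> seq (set V))
    (x : nat -> V -> R),
  [/\ forall s v, S v -> [/\ B s v \in Ls s, B s v v & B s v `<=` S],
      forall s, (size (Ls s) <= 2 ^ (2 ^ s))%N,
      forall v, S v -> B 0%N v = S,
      forall s v, S v -> 0 <= x s v /\ forall u, B s v u -> N (v - u) <= x s v
    & forall k v, S v ->
        \sum_(0 <= s < k) 2 `^ (s%:R / alpha%:R) * x s v <= a].
Proof.
move/ereal_inf_lt: gammaN => [_ [A [hpart href h0 hcard] <-] hlt].
pose diam s v := diameter (fun v w => N (v - w)) (pblock (A s) id v).
have blockP s v : S v -> A s (pblock (A s) id v) /\ pblock (A s) id v v.
  move=> Sv; have [cov _ _] := hpart s.
  by apply: (@getPex _ (fun B => A s B /\ B v)); move: Sv; rewrite -cov => -[B AB Bv]; exists B.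
have blockS s v : S v -> pblock (A s) id v `<=` S.
  move=> Sv; have [cov _ _] := hpart s => u hu.
  by rewrite -cov; exists (pblock (A s) id v) => //; exact: (blockP s v Sv).1.
have diam0 s v : S v -> (0 <= diam s v)%E.
  move=> Sv; apply: ereal_sup_ubound; have [_ vv] := blockP s v Sv.
  by exists v => //; exists v => //=; rewrite subrr seminorm0.
have c0 s : 0 < 2 `^ (s%:R / alpha%:R) :> R by rewrite powR_gt0.
have term0 s v : S v -> (0 <= (2 `^ (s%:R / alpha%:R))%:E * diam s v)%E.
  by move=> Sv; rewrite mule_ge0 ?diam0// lee_fin ltW.
have partial k v : S v ->
  (\sum_(0 <= s < k) (2 `^ (s%:R / alpha%:R))%:E * diam s v <= a%:E)%E.
  move=> Sv; apply: le_trans (ltW hlt).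
  apply: le_trans; last first.
    by apply: ereal_sup_ubound; exists v => //; exact: erefl.
  by apply: nneseries_lim_ge => s _ _; exact: term0.
have diam_fin s v : S v -> diam s v = (fine (diam s v))%:E.
  move=> Sv; rewrite fineK// ge0_fin_numE ?diam0// ltNge leye_eq; apply/negP => /eqP dy.
  have := partial s.+1 v Sv; rewrite big_nat_recr//= dy gt0_muley ?lte_fin//.
  rewrite addey ?leye_eq//; apply/eqP => e.
  have : (0 <= -oo :> \bar R)%E by rewrite -e; apply: sume_ge0 => i _; exact: term0.
  by [].
exists (fun s v => pblock (A s) id v), (fun s => enum_fset (fset_set (A s))),
  (fun s v => fine (diam s v)).
have le_card s : (A s #<= `I_(2 ^ 2 ^ s))%card.
  case: s => [|s]; last exact: hcard.
  by rewrite (card_le_eql h0) card_le_II.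
split.
- move=> s v Sv; have [h1 h2] := blockP s v Sv; split => //; last exact: blockS.
  by rewrite in_fset_set ?inE//; apply/finite_set_leP; exists (2 ^ 2 ^ s)%N.
- by move=> s; exact: geq_card_fset_set.
- move=> v Sv; have [cov _ _] := hpart 0%N.
  rewrite -[RHS]cov; apply/seteqP; split.
    by move=> u hu; exists (pblock (A 0%N) id v) => //; exact: (blockP 0%N v Sv).1.
  move=> u [B AB Bu]; suff -> : pblock (A 0%N) id v = B by [].
  have : (A 0%N #<= `I_1)%card by case/card_eqPle: h0.
  move=> /geq_card_fset_set; set X := fset_set _ => cX.
  have fA : finite_set (A 0%N) by apply/finite_set_leP; exists 1%N; case/card_eqPle: h0.
  have hB : B \in X by rewrite in_fset_set// inE.
  have hP : pblock (A 0%N) id v \in X.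
    by rewrite in_fset_set// inE; exact: (blockP 0%N v Sv).1.
  have hB' : B \in enum_fset X by [].
  have hP' : pblock (A 0%N) id v \in enum_fset X by [].
  move: cX hB' hP'; case: (enum_fset X) => [//|C [|//]] _.
  by rewrite !mem_seq1 => /eqP eB /eqP eP; rewrite eP eB.
- move=> s v Sv; split; first exact: fine_ge0 (diam0 s v Sv).
  move=> u hu; rewrite -lee_fin -diam_fin//; apply: ereal_sup_ubound.
  by exists v; [exact: (blockP s v Sv).2 | exists u].
- move=> k v Sv; rewrite -lee_fin -sumEFin; apply: le_trans (partial k v Sv).
  by apply: lee_sum => s _; rewrite EFinM -diam_fin.
Qed.
End AdmissibleChain.

(* Points of [F] are reached from a common base point along [k] links; the link
   at level [s] is taken from a list of at most [64 ^ 2 ^ s] vectors. The slack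
   [delta] keeps all link norms positive. *)
Definition chained (R : realType) (p : nat) (N1 N2 : 'rV[R]_p -> R)
    (F : seq 'rV[R]_p) (a1 a2 : R) : Prop :=
  exists (k : nat) (L : nat -> seq 'rV[R]_p) (s0 : 'rV[R]_p) (delta : R),
  [/\ 0 < delta, forall s, (size (L s) <= 64 ^ (2 ^ s))%N &
   forall v, v \in F -> exists w : nat -> 'rV[R]_p,
    [/\ v - s0 = \sum_(0 <= s < k) w s, forall s, (s < k)%N -> w s \in L s,
        \sum_(0 <= s < k) 2 ^+ s * (N1 (w s) + delta) <= 3 * a1 &
        \sum_(0 <= s < k) Num.sqrt (2 ^+ s) * (N2 (w s) + delta) <= 3 * a2]].

Section Chaining.
Variables (R : realType) (p : nat).
Local Notation V := 'rV[R]_p.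
Variables (N1 N2 : V -> R).
Hypotheses (sN1 : seminorm N1) (sN2 : seminorm N2).

(** The weights increase, so [c s] may be raised to [c s.+1] and the sum reindexed; the new last
    term vanishes by [x k = 0]. *)
Lemma sum_shift_le (c x : nat -> R) k :
  (forall s, 0 <= c s <= c s.+1) -> (forall s, 0 <= x s) -> x k = 0 ->
  \sum_(0 <= s < k) c s * x s.+1 <= \sum_(0 <= s < k) c s * x s.
Proof.
move=> hc x0 xk.
have e : \sum_(0 <= s < k.+1) c s * x s = \sum_(0 <= s < k) c s * x s.
  by rewrite big_nat_recr//= xk mulr0 addr0.
rewrite -e big_nat_recl// -[leLHS]add0r; apply: lerD.
  by rewrite mulr_ge0//; case/andP: (hc 0%N).
by apply: ler_sum => s _; apply: ler_wpM2r => //; case/andP: (hc s).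
Qed.

(** A link is compared with the distances from [v] to its two endpoints. The factor 3 counts these
    two sums and the total slack, which is at most [delta * 2^k]. *)
Lemma chain_link_sum (N : V -> R) (c : nat -> R) (pi : nat -> V) v k delta a :
  seminorm N -> (forall s, 0 <= c s <= c s.+1) -> pi k = v ->
  (forall s, c s <= 2 ^+ s) -> 0 <= delta -> delta * 2 ^+ k <= a ->
  \sum_(0 <= s < k) c s * N (v - pi s) <= a ->
  \sum_(0 <= s < k) c s * (N (pi s.+1 - pi s) + delta) <= 3 * a.
Proof.
move=> sN hc pik c2 d0 hd ha.
have h1 : \sum_(0 <= s < k) c s * N (v - pi s.+1) <= \sum_(0 <= s < k) c s * N (v - pi s).
  apply: (@sum_shift_le c (fun s => N (v - pi s))) => // [s|].
    exact: seminorm_ge0.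
  by rewrite pik subrr seminorm0.
have h2 : \sum_(0 <= s < k) c s * delta <= a.
  apply: le_trans hd; rewrite -mulr_suml mulrC ler_wpM2l//.
  elim: k {pik ha h1} => [|k IH]; first by rewrite big_nil.
  by rewrite big_nat_recr//= exprS; have := c2 k; lra.
apply: (@le_trans _ _ (\sum_(0 <= s < k) (c s * N (v - pi s) + c s * N (v - pi s.+1) + c s * delta))).
  apply: ler_sum => s _; rewrite -!mulrDr ler_wpM2l//; first by case/andP: (hc s).
  rewrite lerD2r; apply: (le_trans (seminormB sN _ _ v)); first by [].
rewrite !big_split /=; lra.
Qed.

Lemma sqrt_pow2_mono s : 0 <= Num.sqrt ((2 : R) ^+ s) <= Num.sqrt (2 ^+ s.+1).
Proof. by rewrite sqrtr_ge0 /= ler_wsqrtr// exprS ler_peMl ?exprn_ge0// ler1n. Qed.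

Lemma pow2_mono s : 0 <= (2 : R) ^+ s <= 2 ^+ s.+1.
Proof. by rewrite exprn_ge0//= exprS ler_peMl ?exprn_ge0// ler1n. Qed.

Lemma sqrt_pow2_le s : Num.sqrt (2 ^+ s) <= 2 ^+ s :> R.
Proof.
have h : 1 <= 2 ^+ s :> R by rewrite exprn_ege1// ler1n.
rewrite -[leRHS]ger0_norm ?exprn_ge0// -sqrtr_sqr ler_wsqrtr//.
by rewrite expr2 ler_peMl ?exprn_ge0.
Qed.

Lemma chained_proj (F : seq V) k (pi : nat -> V -> V) (Rs : nat -> seq V) s0 a1 a2 :
  0 < a1 -> 0 < a2 -> (forall s, (size (Rs s) <= 2 ^ (2 ^ s.+1))%N) ->
  (forall s v, v \in F -> (s <= k)%N -> pi s v \in Rs s) ->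
  (forall v, v \in F -> pi 0%N v = s0) -> (forall v, v \in F -> pi k v = v) ->
  (forall v, v \in F -> \sum_(0 <= s < k) 2 ^+ s * N1 (v - pi s v) <= a1) ->
  (forall v, v \in F -> \sum_(0 <= s < k) Num.sqrt (2 ^+ s) * N2 (v - pi s v) <= a2) ->
  chained N1 N2 F a1 a2.
Proof.
move=> a10 a20 hR hpi h0 hk h1 h2.
exists k, (fun s => [seq u - v | v <- Rs s, u <- Rs s.+1]), s0, (Num.min a1 a2 / 2 ^+ k).
have pk : 0 < 2 ^+ k :> R by rewrite exprn_gt0.
have d0 : 0 < Num.min a1 a2 / 2 ^+ k by rewrite divr_gt0// lt_min a10.
split => // [s|v vF].
  (* Origin of the base 64: [2^(2^(s+1)) * 2^(2^(s+2)) = 2^(6 * 2^s)]. *)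
  rewrite size_allpairs; apply: leq_trans (leq_mul (hR s) (hR s.+1)) _.
  rewrite -expnD -[64%N]/(2 ^ 6)%N -expnM leq_exp2l// !expnS.
  by rewrite !mulnA -mulnDl.
exists (fun s => pi s.+1 v - pi s v); split.
- by rewrite telescope_sumr// hk// h0.
- move=> s sk; apply/allpairsP; exists (pi s v, pi s.+1 v) => /=.
  by split=> //; apply: hpi => //; exact: ltnW.
- apply: (@chain_link_sum N1 (fun s => 2 ^+ s) (pi ^~ v) v) => //.
  + exact: pow2_mono.
  + exact: hk.
  + exact: ltW.
  + by rewrite divfK ?gt_eqF// ge_min lexx.
  + exact: h1.
- apply: (@chain_link_sum N2 (fun s => Num.sqrt (2 ^+ s)) (pi ^~ v) v) => //.
  + exact: sqrt_pow2_mono.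
  + exact: hk.
  + exact: sqrt_pow2_le.
  + exact: ltW.
  + by rewrite divfK ?gt_eqF// ge_min lexx orbT.
  + exact: h2.
Qed.

Lemma size_le_double_exp (F : seq V) s : (size F <= s)%N -> (size F <= 2 ^ (2 ^ s.+1))%N.
Proof.
move=> h; apply: (leq_trans (ltnW (ltn_expl (size F) (ltnSn 1)))).
rewrite leq_exp2l// (leq_trans h)// (leq_trans (ltnW (ltn_expl s (ltnSn 1))))//.
by rewrite leq_exp2l.
Qed.

Lemma powR_half s : 2 `^ (s%:R / 2%:R) = Num.sqrt (2 ^+ s) :> R.
Proof. by rewrite powRrM powR_mulrn// -powR12_sqrt ?exprn_ge0// div1r. Qed.

Lemma powR_one s : 2 `^ (s%:R / 1%:R) = 2 ^+ s :> R.
Proof. by rewrite divr1 powR_mulrn. Qed.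

Lemma chained_gamma (S : set V) (F : seq V) a1 a2 :
  (forall v, v \in F -> S v) -> 0 < a1 -> 0 < a2 ->
  (gamma 1 S N1 < a1%:E)%E -> (gamma 2 S N2 < a2%:E)%E -> chained N1 N2 F a1 a2.
Proof.
move=> FS a10 a20 g1 g2.
have [B1 [L1 [x1 [p1 c1 z1 d1 e1]]]] := gamma_blocks sN1 g1.
have [B2 [L2 [x2 [p2 c2 z2 d2 e2]]]] := gamma_blocks sN2 g2.
(* From level [size F] on, the list [F] itself meets the cardinality bound, so the chain may end at
   the point. *)
pose k := size F.
(* Both partitions are followed at once through the intersections of their blocks; the square of
   [2^(2^s)] is [2^(2^(s+1))]. The default 0 arises only for disjoint blocks, never for two blocks
   of the same point. *)
pose rep (C1 C2 : set V) : V := xget 0 (C1 `&` C2).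
pose pi s v := if (s < k)%N then rep (B1 s v) (B2 s v) else v.
have repP s v : S v -> B1 s v (rep (B1 s v) (B2 s v)) /\ B2 s v (rep (B1 s v) (B2 s v)).
  move=> Sv; have [_ h1 _] := p1 s v Sv; have [_ h2 _] := p2 s v Sv.
  by apply: (@xgetI _ 0 (B1 s v `&` B2 s v) v).
apply: (@chained_proj F k pi
  (fun s => if (s < k)%N then [seq rep C1 C2 | C1 <- L1 s, C2 <- L2 s] else F)
  (rep S S)) => //.
- move=> s; case: ifPn => [_|]; last by rewrite -leqNgt; exact: size_le_double_exp.
  rewrite size_allpairs; apply: leq_trans (leq_mul (c1 s) (c2 s)) _.
  by rewrite -expnD leq_exp2l// expnS mul2n addnn.
- move=> s v vF _; rewrite /pi; case: ifP => // _; have Sv := FS v vF.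
  have [h1 _ _] := p1 s v Sv; have [h2 _ _] := p2 s v Sv.
  by apply/allpairsP; exists (B1 s v, B2 s v).
- move=> v vF; have Sv := FS v vF; rewrite /pi ifT ?z1 ?z2//.
  by rewrite /k; case: (F) vF.
- by move=> v vF; rewrite /pi ltnn.
- move=> v vF; have Sv := FS v vF; apply: le_trans (e1 k v Sv).
  rewrite !big_nat; apply: ler_sum => s /andP[_ sk]; rewrite powR_one.
  rewrite ler_wpM2l ?exprn_ge0// /pi sk; exact: (d1 s v Sv).2 _ (repP s v Sv).1.
- move=> v vF; have Sv := FS v vF; apply: le_trans (e2 k v Sv).
  rewrite !big_nat; apply: ler_sum => s /andP[_ sk]; rewrite powR_half.
  rewrite ler_wpM2l ?sqrtr_ge0// /pi sk; exact: (d2 s v Sv).2 _ (repP s v Sv).2.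
Qed.

(** The chain that waits at 0 and jumps to the point at the last level; no optimality is sought. *)
Lemma chained_finite (F : seq V) : exists2 a : R, 0 < a & chained N1 N2 F a a.
Proof.
pose k := size F.
pose b v := \sum_(0 <= s < k) 2 ^+ s * N1 v + \sum_(0 <= s < k) Num.sqrt (2 ^+ s) * N2 v.
have n1 v : 0 <= \sum_(0 <= s < k) 2 ^+ s * N1 v.
  by apply: sumr_ge0 => s _; rewrite mulr_ge0 ?exprn_ge0// seminorm_ge0.
have n2 v : 0 <= \sum_(0 <= s < k) Num.sqrt (2 ^+ s) * N2 v.
  by apply: sumr_ge0 => s _; rewrite mulr_ge0 ?sqrtr_ge0// seminorm_ge0.
pose a := 1 + \sum_(v <- F) b v.
have ba v : v \in F -> b v <= a.
  move=> vF; rewrite /a (big_rem v vF) /=.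
  have : 0 <= \sum_(v <- rem v F) b v by apply: sumr_ge0 => u _; exact: addr_ge0.
  lra.
have a0 : 0 < a.
  have : 0 <= \sum_(v <- F) b v by apply: sumr_ge0 => u _; exact: addr_ge0.
  rewrite /a; lra.
exists a => //.
apply: (@chained_proj F k (fun s v => if (s < k)%N then 0 else v)
  (fun s => if (s < k)%N then [:: 0] else F) 0) => //.
- move=> s; case: ifPn => [_|]; first by rewrite expn_gt0.
  by rewrite -leqNgt; exact: size_le_double_exp.
- by move=> s v vF _; case: ifP; rewrite ?inE.
- by move=> v vF; rewrite ifT// /k; case: (F) vF.
- by move=> v vF; rewrite ltnn.
- move=> v vF; apply: le_trans (ba v vF); rewrite /b -[leLHS]addr0 lerD//.
  by rewrite !big_nat; apply: ler_sum => s /andP[_ ->]; rewrite subr0.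
- move=> v vF; apply: le_trans (ba v vF); rewrite /b -[leLHS]add0r lerD//.
  by rewrite !big_nat; apply: ler_sum => s /andP[_ ->]; rewrite subr0.
Qed.

End Chaining.

(** * The multiplier process *)

(** Six of the seven units of [u^2] pay for the factor 64. With [x = expR (- u^2) <= 1/2], the
    remaining terms are at most [3 * x^(2^s) <= 3 * x * 2^(-s)]. *)
Lemma sum_expR_pow2_le (R : realType) (u : R) k : 1 <= u ->
  \sum_(0 <= s < k) (64 ^ (2 ^ s))%:R * (3 * expR (- (7 * (u ^+ 2 * 2 ^+ s)))) <=
  6 * expR (- u ^+ 2).
Proof.
move=> u1; set x := expR (- u ^+ 2).
have x0 : 0 <= x by exact: expR_ge0.
have u2 : 1 <= u ^+ 2 by rewrite exprn_ege1.
have e2 : 2 <= expR 1 :> R by have := expR_ge1Dx (1 : R); lra.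
have x12 : x <= 1 / 2.
  have : expR (- u ^+ 2) <= expR (- 1) by rewrite ler_expR lerN2.
  have h : expR 1 * expR (- 1) = 1 :> R by rewrite -expRD subrr expR0.
  have := ler_wpM2r (expR_ge0 (-1)) e2; rewrite h -/x; lra.
have e64 : 64 <= expR 6 :> R.
  have -> : 64 = 2 ^+ 6 :> R by ring.
  by rewrite -[6]mulr1 expRM_natl lerXn2r// nnegrE// expR_ge0.
have h64 : 64 * expR (- (7 * u ^+ 2)) <= x.
  have := ler_wpM2r (expR_ge0 (- (7 * u ^+ 2))) e64.
  move/le_trans; apply; rewrite -expRD ler_expR; lra.
have term s : (64 ^ (2 ^ s))%:R * (3 * expR (- (7 * (u ^+ 2 * 2 ^+ s)))) <=
    3 * x * (1 / 2) ^+ s.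
  have -> : - (7 * (u ^+ 2 * 2 ^+ s)) = (2 ^ s)%:R * - (7 * u ^+ 2) :> R.
    by rewrite natrX; ring.
  rewrite expRM_natl natrX mulrCA -exprMn.
  have : (64%:R * expR (- (7 * u ^+ 2))) ^+ (2 ^ s) <= x ^+ (2 ^ s).
    by rewrite lerXn2r// nnegrE; nonneg.
  have h1 : x ^+ (2 ^ s) <= x ^+ s.+1.
    by rewrite ler_wiXn2l//; [lra | exact: ltn_expl].
  have h2 : x ^+ s <= (1 / 2) ^+ s by rewrite lerXn2r// nnegrE; lra.
  have := ler_wpM2l x0 h2; rewrite exprS in h1; lra.
have geo : \sum_(0 <= s < k) (1 / 2) ^+ s = 2 * (1 - (1 / 2) ^+ k) :> R.
  elim: k => [|k IH]; first by rewrite big_nil expr0; lra.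
  by rewrite big_nat_recr//= IH exprS; lra.
apply: (@le_trans _ _ (\sum_(0 <= s < k) 3 * x * (1 / 2) ^+ s)).
  by apply: ler_sum => s _.
rewrite -mulr_sumr geo.
have : 0 <= (1 / 2 : R) ^+ k by rewrite exprn_ge0.
by move/(ler_wpM2l x0); lra.
Qed.

Section MultiplierProcess.
Context d d' (T : measurableType d) (T' : measurableType d') (R : realType).
Variables (P : probability T R) (n : nat) (Z0 : T -> T') (Z : 'I_n -> T -> T').
Hypothesis iid : independent_copies P Z0 Z.
Hypothesis mZ0 : measurable_fun setT Z0.
Hypothesis mZ : forall i, measurable_fun setT (Z i).
Variables (xi : T' -> R) (sg b : R).
Hypotheses (mxi : measurable_fun setT xi) (sg0 : 0 < sg) (b1 : 1 <= b).
Hypothesis bn : b ^+ 2 = n%:R.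
Hypothesis xi1 : eub P (fun w => expR (`|xi (Z0 w)| / sg)) 2.
Variables (p : nat) (Ng Ne : 'rV[R]_p -> R) (ell : 'rV[R]_p -> T' -> R).
Hypotheses (sNg : seminorm Ng) (sNe : seminorm Ne).
Hypothesis mell : forall v, measurable_fun setT (ell v).
Hypothesis ellD : forall (c : R) u v z, ell (c *: u + v) z = c * ell u z + ell v z.
Hypothesis ell_tail : forall v g e, 0 < g -> 0 < e -> Ng v <= g -> Ne v <= e ->
  forall s, 0 <= s -> (P [set w | (s <= `|ell v (Z0 w)|)%R] <=
  (2 * expR (- Num.min (s ^+ 2 / g ^+ 2) (s / e)))%:E)%E.

Definition cross_mean v : R := mean P (fun w => xi (Z0 w) * ell v (Z0 w)).

Lemma integrable_cross v :
  P.-integrable setT (EFin \o (fun w => xi (Z0 w) * ell v (Z0 w))).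
Proof.
have g0 : 0 < Ng v + 1 by have := seminorm_ge0 sNg v; lra.
have e0 : 0 < Ne v + 1 by have := seminorm_ge0 sNe v; lra.
apply: (integrable_product g0 e0 sg0 _ _ _ xi1).
- exact: measurableT_comp.
- exact: measurableT_comp.
- by apply: ell_tail => //; rewrite lerDl.
Qed.

Lemma cross_meanD (c : R) u v : cross_mean (c *: u + v) = c * cross_mean u + cross_mean v.
Proof.
rewrite -meanZ; last exact: integrable_cross.
rewrite -meanD; [| by apply: integrableZ_real; exact: integrable_cross | exact: integrable_cross].
by congr (mean P _); apply/funext => w; rewrite ellD; ring.
Qed.

Definition multiplier v w : R :=
  \sum_(k < n) (xi (Z k w) * ell v (Z k w) - cross_mean v).

Lemma multiplierD (c : R) u v w :
  multiplier (c *: u + v) w = c * multiplier u w + multiplier v w.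
Proof.
rewrite /multiplier mulr_sumr -big_split /=; apply: eq_bigr => k _.
by rewrite ellD cross_meanD; ring.
Qed.

Lemma multiplier0 w : multiplier 0 w = 0.
Proof. by have := multiplierD (-1) 0 0 w; rewrite scaler0 addr0; lra. Qed.

Lemma multiplier_sum k (f : nat -> 'rV[R]_p) w :
  multiplier (\sum_(0 <= s < k) f s) w = \sum_(0 <= s < k) multiplier (f s) w.
Proof.
elim: k => [|k IH]; first by rewrite !big_nil multiplier0.
rewrite !big_nat_recr//= -IH [in LHS]addrC -[f k]scale1r multiplierD scale1r; ring.
Qed.

Lemma measurable_multiplier v : measurable_fun setT (multiplier v).
Proof.
apply: measurable_sum => k; apply: measurable_funB => //.
by apply: measurable_funM; exact: measurableT_comp.
Qed.

(** Union bound over all links with [r = u * sqrt (2^s)]. The event on the [xi^2] is common to the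
    links and is excluded once, so its probability is not multiplied by their number. Only
    increments from [s0] are controlled. *)
Lemma multiplier_chained (F : seq 'rV[R]_p) a1 a2 u : 1 <= u ->
  chained Ne Ng F a1 a2 ->
  exists (s0 : 'rV[R]_p) (E : set T), [/\ measurable E,
    (P E <= (33 * expR (- (b / 2)) + 6 * expR (- u ^+ 2))%:E)%E &
    forall w, ~ E w -> forall v, v \in F ->
      `|multiplier (v - s0) w| <= 200 * 400 * 3 * u ^+ 2 * sg * b * (a1 + a2)].
Proof.
move=> u1 [k [L [s0 [delta [d0 sizeL chL]]]]].
have u0 : 0 < u by lra.
pose r s : R := u * Num.sqrt (2 ^+ s).
have r1 s : 1 <= r s.
  rewrite /r -[leLHS]mulr1; apply: ler_pM => //.
  by rewrite -[leLHS]sqrtr1 ler_wsqrtr// exprn_ege1// ler1n.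
have r2 s : r s ^+ 2 = u ^+ 2 * 2 ^+ s.
  by rewrite exprMn sqr_sqrtr// exprn_ge0.
pose Q s v := r s * (Ng v + delta) + r s ^+ 2 * (Ne v + delta).
pose Bad s v := [set w | (200 * 400 * sg * b * Q s v <= `|multiplier v w|)%R /\
    (\sum_k xi (Z k w) ^+ 2 <= 34 * sg ^+ 2 * b ^+ 2)%R].
have mx2 : measurable_fun setT (fun w => \sum_k xi (Z k w) ^+ 2).
  apply: measurable_sum => i; apply: measurable_funX; exact: measurableT_comp.
have mBad s v : measurable (Bad s v).
  apply: measurableI.
    apply: measurable_ge; apply: measurableT_comp => //; exact: measurable_multiplier.
  have := measurable_gt (34 * sg ^+ 2 * b ^+ 2) mx2 => /measurableC.
  by congr (measurable _); apply/seteqP; split=> w /=; rewrite leNgt => /negP.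
have PBad s v : (P (Bad s v) <= (3 * expR (- (7 * (u ^+ 2 * 2 ^+ s))))%:E)%E.
  rewrite -r2.
  have g0 : 0 < Ng v + delta by have := seminorm_ge0 sNg v; lra.
  have e0 : 0 < Ne v + delta by have := seminorm_ge0 sNe v; lra.
  apply: (multiplier_link iid mZ0 mZ mxi sg0 b1 bn xi1 (mell v) g0 e0 (r1 s)).
  by apply: ell_tail => //; rewrite lerDl ltW.
pose BL s := \big[setU/set0]_(v <- L s) Bad s v.
have mBL s : measurable (BL s) by have [] := probability_bigU (L s) (mBad s) (PBad s).
have PBL s : (P (BL s) <= ((64 ^ (2 ^ s))%:R * (3 * expR (- (7 * (u ^+ 2 * 2 ^+ s)))))%:E)%E.
  have [_ h] := probability_bigU (L s) (mBad s) (PBad s).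
  apply: (le_trans h); rewrite lee_fin big_const_seq count_predT iter_addr_0 -[leLHS]mulr_natl.
  by apply: ler_wpM2r; [nonneg | rewrite ler_nat].
pose B0 := [set w | (34 * sg ^+ 2 * b ^+ 2 < \sum_k xi (Z k w) ^+ 2)%R].
have mB0 : measurable B0 by exact: measurable_gt.
pose BA := \big[setU/set0]_(s <- iota 0 k) BL s.
have [mBA PBA] := probability_bigU (iota 0 k) mBL PBL.
exists s0, (B0 `|` BA); split.
- exact: measurableU.
- apply: (@le_trans _ _ (P B0 + P BA)%E); first exact: measureU2.
  rewrite EFinD; apply: leeD; first exact: (multiplier_norm iid mZ0 mZ mxi sg0 b1 bn xi1).
  apply: (le_trans PBA); rewrite lee_fin.
  have := sum_expR_pow2_le k u1; by rewrite /index_iota subn0.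
move=> w /not_orP[nB0 nBA] v vF.
have hx : \sum_k xi (Z k w) ^+ 2 <= 34 * sg ^+ 2 * b ^+ 2.
  by rewrite leNgt; apply/negP.
have [f [vE fL s1 s2]] := chL v vF.
have c0 : 0 <= 200 * 400 * sg * b by have b0 : 0 <= b := le_trans ler01 b1; nonneg.
have link s : (s < k)%N -> `|multiplier (f s) w| <= 200 * 400 * sg * b * Q s (f s).
  move=> sk; rewrite leNgt; apply/negP => h; apply: nBA.
  rewrite /BA -bigcup_seq; exists s => /=; first by rewrite mem_iota.
  rewrite /BL -bigcup_seq; exists (f s) => /=; first exact: fL.
  by split=> //; exact: ltW.
rewrite vE multiplier_sum; apply: (le_trans (ler_norm_sum _ _ _)).
apply: (@le_trans _ _ (\sum_(0 <= s < k) (200 * 400 * sg * b) * (u ^+ 2 *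
   (Num.sqrt (2 ^+ s) * (Ng (f s) + delta) + 2 ^+ s * (Ne (f s) + delta))))).
  rewrite !big_nat; apply: ler_sum => s /andP[_ sk]; apply: (le_trans (link s sk)).
  apply: ler_wpM2l => //; rewrite /Q r2 /r.
  have uu : u <= u ^+ 2 by rewrite expr2 ler_pMr.
  have G0 : 0 <= Num.sqrt (2 ^+ s) * (Ng (f s) + delta).
    by rewrite mulr_ge0 ?sqrtr_ge0//; have := seminorm_ge0 sNg (f s); lra.
  have := ler_wpM2r G0 uu; lra.
rewrite -mulr_sumr -mulr_sumr big_split /=.
have : 0 <= 200 * 400 * sg * b * u ^+ 2 by rewrite mulr_ge0 ?sqr_ge0.
by move/ler_wpM2l => /(_ _ _ (lerD s2 s1)); lra.
Qed.

End MultiplierProcess.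

(** * Rademacher walks *)

Section Dot.
Variables (R : realType) (p : nat).
Implicit Types (u v w : 'rV[R]_p) (c : R).

Lemma dotC u v : dot u v = dot v u.
Proof. by apply: eq_bigr => i _; rewrite mulrC. Qed.

Lemma dot_linear w c u v : dot w (c *: u + v) = c * dot w u + dot w v.
Proof.
rewrite /dot mulr_sumr -big_split /=; apply: eq_bigr => i _.
by rewrite !mxE; ring.
Qed.

Lemma dotZr w c u : dot w (c *: u) = c * dot w u.
Proof. by rewrite /dot mulr_sumr; apply: eq_bigr => i _; rewrite mxE mulrCA. Qed.

End Dot.

Lemma conv_hull_linear_le (R : realType) (p : nat) (S : set 'rV[R]_p)
    (L : 'rV[R]_p -> R) (c : R) v :
  (forall (a : R) u w, L (a *: u + w) = a * L u + L w) ->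
  (forall s, S s -> L s <= c) -> conv_hull S v -> L v <= c.
Proof.
move=> lin hS; suff sub : conv_hull S `<=` [set x | L x <= c] by exact: sub.
apply: smallest_sub; last by move=> s /hS.
move=> x y l; rewrite !inE /= => Lx Ly.
have LZ (a : R) u : L (a *: u) = a * L u.
  by have := lin a u 0; have := lin (-1) 0 0; rewrite !scaler0 !addr0; lra.
have -> : L (conv l x y) = l%:num * L x + (1 - l%:num) * L y.
  by rewrite -[(1 - _) * L y]LZ -lin.
have l0 : 0 <= l%:num :> R by [].
have l1 : 0 <= 1 - l%:num :> R by rewrite subr_ge0.
have := ler_wpM2l l0 Lx; have := ler_wpM2l l1 Ly; lra.
Qed.

Section RademacherChain.
Variables (R : realType) (I : finType) (q : I -> R) (p : nat).
Hypothesis q_ge0 : forall i, 0 <= q i.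
Hypothesis q_sum1 : \sum_i q i = 1.
Variables (r : I -> 'rV[R]_p) (n : nat) (b : R).
Hypotheses (b1 : 1 <= b) (bn : b ^+ 2 = n%:R).

Definition half_weight (y : I * bool) : R := q y.1 / 2.

Lemma half_weight_ge0 y : 0 <= half_weight y.
Proof. by rewrite divr_ge0. Qed.

Lemma sum_half_weight (f : I * bool -> R) :
  \sum_y half_weight y * f y = \sum_i q i * ((f (i, true) + f (i, false)) / 2).
Proof.
rewrite (eq_bigr (fun y => half_weight (y.1, y.2) * f (y.1, y.2))); last by case.
rewrite -(pair_bigA _ (fun i s => half_weight (i, s) * f (i, s))) /=.
by apply: eq_bigr => i _; rewrite big_bool /half_weight /=; lra.
Qed.

Lemma half_weight_sum1 : \sum_y half_weight y = 1.
Proof.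
have := sum_half_weight (fun=> 1); under eq_bigr do rewrite mulr1.
by move=> ->; rewrite -mulr_suml q_sum1; lra.
Qed.

Definition signed_dot (y : I * bool) (v : 'rV[R]_p) : R :=
  if y.2 then dot (r y.1) v else - dot (r y.1) v.

Definition walk (z : seq (I * bool)) (v : 'rV[R]_p) : R := \sum_(y <- z) signed_dot y v.

Lemma walk_linear z c u v : walk z (c *: u + v) = c * walk z u + walk z v.
Proof.
rewrite /walk mulr_sumr -big_split /=; apply: eq_bigr => y _.
by rewrite /signed_dot; case: ifP => _; rewrite dot_linear; ring.
Qed.

Lemma walk0 z : walk z 0 = 0.
Proof. by have := walk_linear z (-1) 0 0; rewrite scaler0 addr0; lra. Qed.

Lemma walk_sum z k (f : nat -> 'rV[R]_p) :
  walk z (\sum_(0 <= s < k) f s) = \sum_(0 <= s < k) walk z (f s).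
Proof.
elim: k => [|k IH]; first by rewrite !big_nil walk0.
rewrite !big_nat_recr//= -IH [in LHS]addrC -[f k]scale1r walk_linear scale1r; ring.
Qed.

Local Notation E := (iexp half_weight n).

Lemma mean_walk v : E (walk^~ v) = 0.
Proof.
elim: n => [|m IH] /=; first by rewrite /walk big_nil.
rewrite (eq_bigr (fun y => half_weight y * signed_dot y v)).
  by rewrite sum_half_weight big1// => i _; rewrite /signed_dot /= subrr mul0r mulr0.
move=> y _; congr (_ * _).
rewrite (eq_iexp _ _ (h2 := fun z => signed_dot y v + walk z v)).
  by rewrite iexpD// IH addr0 iexp_cst//; exact: half_weight_sum1.
by move=> z; rewrite /walk big_cons.
Qed.

Lemma walk_mgf v (theta B : R) :
  \sum_i q i * ((expR (theta * dot (r i) v) + expR (- (theta * dot (r i) v))) / 2) <= expR B ->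
  E (fun z => expR (theta * `|walk z v|)) <= 2 * expR (n%:R * B).
Proof.
move=> hB.
have mgf (t : R) : \sum_y half_weight y * expR (t * signed_dot y v) <= expR B ->
    E (fun z => expR (t * walk z v)) <= expR (n%:R * B).
  move=> ht.
  rewrite (eq_iexp _ _ (h2 := fun z => \prod_(y <- z) expR (t * signed_dot y v))).
    rewrite iexp_prod ?expRM_natl ?lerXn2r ?nnegrE ?expR_ge0//.
    by apply: sumr_ge0 => y _; rewrite mulr_ge0 ?expR_ge0 ?half_weight_ge0.
  by move=> z; rewrite /walk mulr_sumr expR_sum.
have h1 : E (fun z => expR (theta * walk z v)) <= expR (n%:R * B).
  apply: mgf; apply: le_trans hB; rewrite sum_half_weight.
  by apply: ler_sum => i _; rewrite /signed_dot /= mulrN.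
have h2 : E (fun z => expR (- theta * walk z v)) <= expR (n%:R * B).
  apply: mgf; apply: le_trans hB; rewrite sum_half_weight.
  by apply: ler_sum => i _; rewrite /signed_dot /= mulrN !mulNr opprK addrC.
apply: (@le_trans _ _ (E (fun z => expR (theta * walk z v) + expR (- theta * walk z v)))).
  apply: le_iexp => [|z _]; first exact: half_weight_ge0.
  case: (ger0P (walk z v)) => _; first by rewrite lerDl expR_ge0.
  by rewrite mulrN mulNr lerDr expR_ge0.
rewrite iexpD; lra.
Qed.

Lemma sum_expRN_pow2_le k : \sum_(0 <= s < k) expR (- 2 ^+ s) <= 1 :> R.
Proof.
have e2 : 2 <= expR 1 :> R by have := expR_ge1Dx (1 : R); lra.
have x12 : expR (- 1) <= 1 / 2 :> R.
  have h : expR 1 * expR (- 1) = 1 :> R by rewrite -expRD subrr expR0.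
  by have := ler_wpM2r (expR_ge0 (-1)) e2; rewrite h; lra.
apply: (@le_trans _ _ (\sum_(0 <= s < k) (1 / 2) ^+ s.+1)).
  apply: ler_sum => s _; have -> : - 2 ^+ s = (2 ^ s)%:R * (- 1) :> R by rewrite natrX mulrN1.
  rewrite expRM_natl; apply: (@le_trans _ _ ((1 / 2) ^+ (2 ^ s))).
    by rewrite lerXn2r// nnegrE ?expR_ge0//; lra.
  by rewrite ler_wiXn2l//; [lra | exact: ltn_expl].
suff -> : \sum_(0 <= s < k) (1 / 2) ^+ s.+1 = 1 - (1 / 2) ^+ k :> R.
  by have : 0 <= (1 / 2 : R) ^+ k by [rewrite exprn_ge0]; lra.
elim: k => [|k IH]; first by rewrite big_nil expr0 subrr.
by rewrite big_nat_recr//= IH !exprS; lra.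
Qed.

Variables (N1 N2 : 'rV[R]_p -> R) (k : nat) (L : nat -> seq 'rV[R]_p) (delta : R).
Hypothesis sizeL : forall s, (size (L s) <= 64 ^ (2 ^ s))%N.
Hypothesis N1_gt0 : forall v, 0 < N1 v + delta.
Hypothesis N2_gt0 : forall v, 0 < N2 v + delta.

(** Bernstein deviation of the walk along a link for the exponent [2^s]. The parameter [link_theta]
    satisfies both constraints of Bernstein's regime: [theta * (N1 v + delta) <= 1/16], and [n *
    theta^2 * (N2 v + delta)^2 <= 2^s / 256]. *)
Definition link_scale s v : R :=
  b * Num.sqrt (2 ^+ s) * (N2 v + delta) + 2 ^+ s * (N1 v + delta).
Definition link_theta s v : R := 2 ^+ s / (16 * link_scale s v).

Lemma link_scale_gt0 s v : 0 < link_scale s v.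
Proof.
have b0 : 0 < b := lt_le_trans ltr01 b1.
by rewrite addr_gt0// !mulr_gt0// ?sqrtr_gt0 exprn_gt0.
Qed.

Hypothesis link_mgf : forall s v, (s < k)%N -> v \in L s ->
  \sum_i q i * ((expR (link_theta s v * dot (r i) v) +
                 expR (- (link_theta s v * dot (r i) v))) / 2) <=
  expR ((2 * (128 * 128) + 1) * link_theta s v ^+ 2 * (N2 v + delta) ^+ 2).

(** One random variable that bounds the normalized overshoot of every link at once, since
    [y <= c^-1 * expR (c * y)] with [c = 2^s / 16]. It plays the role of a union bound where a mean,
    and not a tail, is wanted. *)
Definition excess (z : seq (I * bool)) : R := \sum_(0 <= s < k) \sum_(v <- L s)
  16 / 2 ^+ s * expR (2 ^+ s / 16 * (`|walk z v| / link_scale s v - 16 * 136)).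

Lemma excess_term_ge0 z s v :
  0 <= 16 / 2 ^+ s * expR (2 ^+ s / 16 * (`|walk z v| / link_scale s v - 16 * 136)).
Proof. by rewrite mulr_ge0 ?expR_ge0// divr_ge0// exprn_ge0. Qed.

Lemma walk_le_excess z s v : (s < k)%N -> v \in L s ->
  `|walk z v| <= link_scale s v * (16 * 136 + excess z).
Proof.
move=> sk vL; have D0 := link_scale_gt0 s v.
rewrite mulrC -ler_pdivrMr// addrC -lerBlDr.
have c0 : 0 < 2 ^+ s / 16 :> R by rewrite divr_gt0// exprn_gt0.
set y := _ - _.
have h1 : y <= 16 / 2 ^+ s * expR (2 ^+ s / 16 * y).
  have -> : 16 / 2 ^+ s = (2 ^+ s / 16)^-1 :> R by rewrite invf_div.
  by rewrite mulrC ler_pdivlMr// mulrC; exact: id_le_expR.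
apply: (le_trans h1); rewrite /excess big_mkord (bigD1 (Ordinal sk))//=.
rewrite (big_rem v vL) /= -addrA lerDl; apply: addr_ge0.
  by apply: sumr_ge0 => u _; exact: excess_term_ge0.
by apply: sumr_ge0 => t _; apply: sumr_ge0 => u _; exact: excess_term_ge0.
Qed.

(** The exponential moment of a link costs [129 * 2^s], because [(2 * 128^2 + 1) / 256 <= 129]. The
    shift [16 * 136] brings in [- 136 * 2^s]; of the remaining [- 7 * 2^s], the number of links uses
    up 6. *)
Lemma mean_excess : E excess <= 32.
Proof.
have hterm s v : (s < k)%N -> v \in L s ->
    E (fun z => 16 / 2 ^+ s * expR (2 ^+ s / 16 * (`|walk z v| / link_scale s v - 16 * 136))) <=
    32 * expR (- (7 * 2 ^+ s)).
  move=> sk vL; have D0 := link_scale_gt0 s v; have G0 := N2_gt0 v.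
  have b0 : 0 < b := lt_le_trans ltr01 b1.
  have q0 : 0 < 2 ^+ s :> R by rewrite exprn_gt0.
  have q1 : 1 <= 2 ^+ s :> R by rewrite exprn_ege1// ler1n.
  have nB : n%:R * ((2 * (128 * 128) + 1) * link_theta s v ^+ 2 * (N2 v + delta) ^+ 2) <=
      129 * 2 ^+ s.
    set G := N2 v + delta; rewrite -bn /link_theta.
    have hD : b * Num.sqrt (2 ^+ s) * G <= link_scale s v.
      by rewrite lerDl mulr_ge0// ltW.
    have hD2 : (b * Num.sqrt (2 ^+ s) * G) ^+ 2 <= link_scale s v ^+ 2.
      by rewrite lerXn2r// nnegrE; [nonneg | exact: ltW].
    have hq : Num.sqrt (2 ^+ s) ^+ 2 = 2 ^+ s :> R by rewrite sqr_sqrtr// ltW.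
    rewrite !exprMn hq in hD2.
    have -> : b ^+ 2 * ((2 * (128 * 128) + 1) * (2 ^+ s / (16 * link_scale s v)) ^+ 2 * G ^+ 2) =
      (2 * (128 * 128) + 1) / 256 * 2 ^+ s * (b ^+ 2 * 2 ^+ s * G ^+ 2 / link_scale s v ^+ 2).
      by field; rewrite gt_eqF.
    have h1 : b ^+ 2 * 2 ^+ s * G ^+ 2 / link_scale s v ^+ 2 <= 1.
      by rewrite ler_pdivrMr ?exprn_gt0// mul1r.
    have c0 : 0 <= (2 * (128 * 128) + 1) / 256 * 2 ^+ s :> R by nonneg.
    by have := ler_wpM2l c0 h1; lra.
  have hm := walk_mgf (link_mgf sk vL).
  have e1 : E (fun z => expR (link_theta s v * `|walk z v|)) <= 2 * expR (129 * 2 ^+ s).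
    by apply: (le_trans hm); rewrite ler_pM2l// ler_expR.
  rewrite (eq_iexp _ _ (h2 := fun z =>
    (16 / 2 ^+ s * expR (- (136 * 2 ^+ s))) * expR (link_theta s v * `|walk z v|))); last first.
    move=> z; rewrite -[RHS]mulrA -expRD; congr (_ * expR _).
    by rewrite /link_theta; field; rewrite gt_eqF.
  rewrite iexpZ.
  have c0 : 0 <= 16 / 2 ^+ s * expR (- (136 * 2 ^+ s)) :> R by nonneg.
  apply: (le_trans (ler_wpM2l c0 e1)).
  have -> : 16 / 2 ^+ s * expR (- (136 * 2 ^+ s)) * (2 * expR (129 * 2 ^+ s)) =
    32 / 2 ^+ s * (expR (- (136 * 2 ^+ s)) * expR (129 * 2 ^+ s)) :> R by ring.
  rewrite -expRD; have -> : - (136 * 2 ^+ s) + 129 * 2 ^+ s = - (7 * 2 ^+ s) :> R by ring.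
  by rewrite ler_wpM2r ?expR_ge0// ler_pdivrMr//; lra.
have e64 : 64 <= expR 6 :> R.
  have e2 : 2 <= expR 1 :> R by have := expR_ge1Dx (1 : R); lra.
  have -> : 64 = 2 ^+ 6 :> R by ring.
  by rewrite -[6]mulr1 expRM_natl lerXn2r// nnegrE// expR_ge0.
rewrite /excess iexp_sum//; last exact: half_weight_sum1.
apply: (@le_trans _ _ (\sum_(0 <= s < k) 32 * expR (- 2 ^+ s))).
  rewrite !big_nat; apply: ler_sum => s /andP[_ sk].
  rewrite iexp_sum//; last exact: half_weight_sum1.
  apply: (@le_trans _ _ (\sum_(v <- L s) 32 * expR (- (7 * 2 ^+ s)))).
    by rewrite !big_seq; apply: ler_sum => v vL; exact: hterm.
  rewrite big_const_seq count_predT iter_addr_0 -[leLHS]mulr_natl.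
  have h1 : (size (L s))%:R <= expR (6 * 2 ^+ s) :> R.
    apply: (@le_trans _ _ ((64 ^ (2 ^ s))%:R)); first by rewrite ler_nat.
    have -> : 6 * 2 ^+ s = (2 ^ s)%:R * 6 :> R by rewrite natrX mulrC.
    by rewrite expRM_natl natrX lerXn2r// nnegrE ?expR_ge0.
  have := ler_wpM2r (expR_ge0 (- (7 * 2 ^+ s))) h1; rewrite -expRD.
  by have -> : 6 * 2 ^+ s + - (7 * 2 ^+ s) = - 2 ^+ s :> R by [ring]; lra.
by rewrite -mulr_sumr; have := sum_expRN_pow2_le k; lra.
Qed.

Variables (F : seq 'rV[R]_p) (s0 : 'rV[R]_p) (a1 a2 : R).
Hypothesis chL : forall v, v \in F -> exists w : nat -> 'rV[R]_p,
    [/\ v - s0 = \sum_(0 <= s < k) w s, forall s, (s < k)%N -> w s \in L s,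
        \sum_(0 <= s < k) 2 ^+ s * (N1 (w s) + delta) <= 3 * a1 &
        \sum_(0 <= s < k) Num.sqrt (2 ^+ s) * (N2 (w s) + delta) <= 3 * a2].

Lemma excess_ge0 z : 0 <= excess z.
Proof.
by apply: sumr_ge0 => t _; apply: sumr_ge0 => u _; exact: excess_term_ge0.
Qed.

Lemma walk_chain_le z v : v \in F ->
  walk z v <= walk z s0 + (16 * 136 + excess z) * (3 * (b * a2 + a1)).
Proof.
move=> vF; have [w [vE wL h1 h2]] := chL vF.
have -> : walk z v = walk z s0 + walk z (v - s0).
  have := walk_linear z 1 (v - s0) s0; rewrite scale1r subrK mul1r => ->.
  by rewrite addrC.
rewrite lerD2l vE walk_sum; apply: (le_trans (ler_norm _)).
apply: (le_trans (ler_norm_sum _ _ _)).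
apply: (@le_trans _ _ (\sum_(0 <= s < k) (16 * 136 + excess z) *
  (b * (Num.sqrt (2 ^+ s) * (N2 (w s) + delta)) + 2 ^+ s * (N1 (w s) + delta)))).
  rewrite !big_nat; apply: ler_sum => s /andP[_ sk].
  have := walk_le_excess z sk (wL s sk); rewrite mulrC /link_scale => /le_trans; apply.
  by rewrite mulrA.
rewrite -mulr_sumr; apply: ler_wpM2l.
  by have := excess_ge0 z; lra.
rewrite big_split /= -mulr_sumr.
have b0 : 0 <= b := le_trans ler01 b1.
have := ler_wpM2l b0 h2; lra.
Qed.

(** The walk is linear in the direction, so its bound on [F] extends to the convex hull. The term at
    the base point [s0] has mean zero. *)
Lemma mean_sup_walk (J : finType) (j0 : J) (D : J -> 'rV[R]_p) (c : R) : 0 < c ->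
  0 <= a1 -> 0 <= a2 ->
  (forall j, conv_hull [set` F] (c *: D j)) ->
  E (fun z => fsup j0 (fun j => walk z (D j))) <=
  c^-1 * (17 * 130 * (3 * (b * a2 + a1))).
Proof.
move=> c0 a10 a20 hD.
have b0 : 0 <= b := le_trans ler01 b1.
pose M := 3 * (b * a2 + a1).
have M0 : 0 <= M by rewrite /M; nonneg.
apply: (@le_trans _ _ (E (fun z => c^-1 * (walk z s0 + (16 * 136 * M + M * excess z))))).
  apply: le_iexp => [|z _]; first exact: half_weight_ge0.
  apply: fsup_le => j; rewrite -(ler_pM2l c0) mulrA mulfV ?gt_eqF// mul1r.
  have -> : c * walk z (D j) = walk z (c *: D j).
    by have := walk_linear z c (D j) 0; rewrite addr0 walk0 addr0 => ->.
  apply: (conv_hull_linear_le (walk_linear z) _ (hD j)) => s /= sF.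
  apply: (le_trans (walk_chain_le z sF)); rewrite -/M; lra.
rewrite iexpZ iexpD mean_walk add0r iexpD !iexpZ iexp_cst//; last exact: half_weight_sum1.
rewrite ler_pM2l ?invr_gt0// -/M.
(* [16 * 136 + 32 = 2208 <= 17 * 130]. *)
by have := ler_wpM2l M0 mean_excess; lra.
Qed.

End RademacherChain.

(** * The quadratic process *)

Definition norm1 (R : realType) (p : nat) (v : 'rV[R]_p) : R := \sum_j `|v ord0 j|.

Lemma norm1_ge0 (R : realType) (p : nat) (v : 'rV[R]_p) : 0 <= norm1 v.
Proof. exact: sumr_ge0. Qed.

Lemma dotB_le_norm1 (R : realType) (p : nat) (x y v : 'rV[R]_p) (eta : R) :
  (forall j, `|x ord0 j - y ord0 j| <= eta) -> `|dot x v - dot y v| <= eta * norm1 v.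
Proof.
move=> h; rewrite /dot -sumrB /norm1 mulr_sumr; apply: (le_trans (ler_norm_sum _ _ _)).
by apply: ler_sum => j _; rewrite -mulrBl normrM ler_wpM2r.
Qed.

Lemma positive_lower_bound (R : realType) (s : seq R) : (forall x, x \in s -> 0 < x) ->
  exists2 eta : R, 0 < eta & forall x, x \in s -> eta <= x.
Proof.
elim: s => [_|x s IH hs]; first by exists 1.
have [|eta e0 he] := IH; first by move=> y ys; apply: hs; rewrite inE ys orbT.
exists (Num.min x eta).
  by rewrite lt_min e0 hs// mem_head.
move=> y; rewrite inE => /orP[/eqP ->|ys]; first by rewrite ge_min lexx.
by rewrite ge_min he ?orbT.
Qed.

(** The hyperbolic cosine increases with the absolute value, and a shift by [h] multiplies it by at
    most [expR h]. *)
Lemma add_expRN_shift (R : realType) (x y h : R) : 0 <= h -> `|x| <= `|y| + h ->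
  expR x + expR (- x) <= expR h * (expR y + expR (- y)).
Proof.
have norm z : expR z + expR (- z) = expR `|z| + expR (- `|z|) :> R.
  by case: (ger0P z) => _ //; rewrite opprK addrC.
move=> h0; rewrite (norm x) (norm y); move: `|x| `|y| (normr_ge0 x) (normr_ge0 y).
move=> {x y norm} a c a0 c0 ac.
have inv z : expR z * expR (- z) = 1 :> R by rewrite -expRD subrr expR0.
apply: (@le_trans _ _ (expR (c + h) + expR (- (c + h)))).
  have i1 := inv a; have i2 := inv (c + h).
  have e1 : 1 <= expR a by have := expR_ge1Dx a; lra.
  have le : expR a <= expR (c + h) by rewrite ler_expR.
  have p0 : expR (- a) * expR (- (c + h)) <= 1.
    by rewrite -expRD expR_le1; lra.
  have key : expR (- a) - expR (- (c + h)) =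
    (expR (c + h) - expR a) * (expR (- a) * expR (- (c + h))).
    transitivity (expR (- a) * (expR (c + h) * expR (- (c + h))) -
      (expR a * expR (- a)) * expR (- (c + h))); last by ring.
    by rewrite i1 i2; ring.
  have d0 : 0 <= expR (c + h) - expR a by rewrite subr_ge0.
  by have := ler_wpM2l d0 p0; rewrite -key; lra.
rewrite mulrDr -!expRD [h + c]addrC lerD2l ler_expR; lra.
Qed.

(** * Discretization of the law of the vector *)

Section Quantizer.
Context d d' (T : measurableType d) (T' : measurableType d') (R : realType).
Variables (P : probability T R) (Z0 : T -> T').
Hypothesis mZ0 : measurable_fun setT Z0.
Variables (p : nat) (vec : T' -> 'rV[R]_p).
Hypothesis mvec : forall j, measurable_fun setT (fun z => vec z ord0 j).
Hypothesis vec1 : forall j, exists c, eub P (fun w => `|vec (Z0 w) ord0 j|) c.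

(** A grid of mesh [eta] on a box of half-side [M], with one more letter for the outside, decoded as
    the zero vector; this choice makes the one-sided bound hold everywhere. [M] is large enough for
    Markov's inequality to give the outside probability at most [eta]. *)
Lemma quantizer (eta : R) : 0 < eta ->
  exists (I : finType) (code : T' -> I) (r : I -> 'rV[R]_p) (A : set T'),
  [/\ forall i, measurable (code @^-1` [set i]),
      forall z v, `|dot (r (code z)) v| <= `|dot (vec z) v| + eta * norm1 v,
      measurable A,
      (P [set w | ~ A (Z0 w)] <= eta%:E)%E
    & forall z, A z -> forall v, `|dot (r (code z)) v - dot (vec z) v| <= eta * norm1 v].
Proof.
move=> eta0.
have /choice[c hc] := vec1.
have c0 j : 0 <= c j.
  case: (hc j) => _ h0 hj; rewrite -lee_fin; apply: le_trans hj.
  by apply: integral_ge0 => w _; rewrite lee_fin.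
pose M := (1 + \sum_j c j) / eta.
have C0 : 0 <= \sum_j c j by exact: sumr_ge0.
have M0 : 0 < M by rewrite divr_gt0//; lra.
pose K := Num.truncn (2 * M / eta).
pose y z j := (vec z ord0 j + M) / eta.
pose A := [set z | forall j, `|vec z ord0 j| < M].
have mabs j : measurable_fun setT (fun z => `|vec z ord0 j|) by exact: measurableT_comp.
have mAj j : measurable [set z | `|vec z ord0 j| < M].
  have := measurableC (measurable_ge M (mabs j)).
  by congr (measurable _); apply/seteqP; split=> z /=; rewrite ltNge => /negP.
have mA : measurable A.
  rewrite (_ : A = \bigcap_(j in setT) [set z | `|vec z ord0 j| < M]).
    by apply: fin_bigcap_measurable => //; exact: finite_finset.
  by apply/seteqP; split=> [z h j _|z h j]; exact: h.
have my j : measurable_fun setT (fun z => y z j).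
  by apply: measurable_funM => //; exact: measurable_funD.
pose code z : option {ffun 'I_p -> 'I_K.+1} :=
  if [forall j, `|vec z ord0 j| < M] then Some [ffun j => inord (Num.truncn (y z j))]
  else None.
pose r (i : option {ffun 'I_p -> 'I_K.+1}) : 'rV[R]_p :=
  if i is Some f then \row_j ((f j)%:R * eta - M) else 0.
have AP z : reflect (A z) [forall j, `|vec z ord0 j| < M].
  by apply: (iffP forallP).
have y0 z j : A z -> 0 <= y z j.
  move=> /(_ j); rewrite ltr_norml => /andP[h1 _].
  by rewrite divr_ge0// ?ltW//; lra.
have yK z j : A z -> (Num.truncn (y z j) < K.+1)%N.
  move=> /(_ j); rewrite ltr_norml => /andP[_ h2]; rewrite ltnS; apply: le_truncn.
  rewrite ler_pM2r ?invr_gt0//; lra.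
have close z : A z -> forall v, `|dot (r (code z)) v - dot (vec z) v| <= eta * norm1 v.
  move=> Az v; apply: dotB_le_norm1 => j.
  rewrite /code (introT (AP z) Az) /r mxE ffunE inordK ?yK//.
  have /andP[t1 t2] := truncn_itv (y0 z j Az).
  have e : vec z ord0 j = y z j * eta - M by rewrite /y divfK ?gt_eqF// addrK.
  rewrite e; move: t1 t2; rewrite -(ler_pM2r eta0) -(ltr_pM2r eta0) -natr1 mulrDl mul1r.
  by move=> t1 t2; rewrite ler_norml; apply/andP; split; lra.
exists (option {ffun 'I_p -> 'I_K.+1} : finType), code, r, A; split => //.
- case=> [f|]; last first.
    rewrite (_ : _ @^-1` _ = ~` A); first exact: measurableC.
    apply/seteqP; split=> z /=; rewrite /code.
      by case: AP.
    by move=> nA; case: AP.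
  rewrite (_ : _ @^-1` _ = A `&` \bigcap_(j in setT)
     ([set z | (f j)%:R <= y z j] `\` [set z | (f j).+1%:R <= y z j])).
    apply: measurableI => //; apply: fin_bigcap_measurable => [|j _].
      exact: finite_finset.
    by apply: measurableD; exact: measurable_ge.
  apply/seteqP; split=> z /=; rewrite /code.
    case: AP => // Az [<-]; split=> // j _ /=; rewrite ffunE inordK ?yK//.
    have /andP[t1 t2] := truncn_itv (y0 z j Az).
    by split=> //; rewrite leNgt t2.
  move=> [Az h]; case: AP => // _; congr Some; apply/ffunP => j; rewrite ffunE.
  apply: val_inj; rewrite /= inordK ?yK//; have [/= h1 /negP] := h j I.
  rewrite -ltNge => h2; apply/eqP; rewrite truncn_eq ?y0//.
  by rewrite h1 h2.
- move=> z v; case: (pselect (A z)) => [Az|nA].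
    have := close z Az v; have := ler_normD (dot (r (code z)) v - dot (vec z) v) (dot (vec z) v).
    rewrite subrK; lra.
  rewrite /code; case: AP => // _.
  have -> : dot (r None) v = 0 by rewrite /dot big1// => j _; rewrite mxE mul0r.
  by rewrite normr0 addr_ge0// mulr_ge0 ?norm1_ge0// ltW.
- pose B j := [set w | M <= `|vec (Z0 w) ord0 j|].
  have mB j : measurable (B j) by case: (hc j) => m _ _; exact: measurable_ge.
  have PB j : (P (B j) <= (c j / M)%:E)%E by exact: eub_markov (hc j) M0.
  have [mU PU] := probability_bigU (index_enum 'I_p) mB PB.
  apply: (@le_trans _ _ (\sum_(j <- index_enum 'I_p) c j / M)%:E); last first.
    rewrite lee_fin -mulr_suml ler_pdivrMr// /M mulrC divfK ?gt_eqF//; lra.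
  apply: le_trans PU; apply: le_measure; rewrite ?inE//.
    have := mZ0 measurableT (measurableC mA); rewrite setTI.
    by congr (measurable _).
  move=> w /existsNP[j /negP]; rewrite -leNgt => h.
  by rewrite -bigcup_seq; exists j => //=; rewrite mem_index_enum.
Qed.

End Quantizer.

Lemma measurable_dot d (T : measurableType d) (R : realType) (p : nat)
    (f : T -> 'rV[R]_p) v :
  (forall j, measurable_fun setT (fun z => f z ord0 j)) ->
  measurable_fun setT (fun z => dot (f z) v).
Proof. by move=> mf; apply: measurable_sum => j; exact: measurable_funM. Qed.

Lemma clamp_cases (R : realType) (c : R) :
  [\/ c <= 0 /\ Num.min 1 (Num.max 0 c) = 0,
      0 <= c <= 1 /\ Num.min 1 (Num.max 0 c) = c
    | 1 <= c /\ Num.min 1 (Num.max 0 c) = 1].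
Proof.
have [c0|c0] := leP c 0.
  by apply: Or31; split=> //; rewrite min_r.
have [c1|c1] := leP 1 c; first by apply: Or33.
by apply: Or32; split; rewrite ?ltW.
Qed.

Lemma clamp_lipschitz (R : realType) (c c' : R) :
  `|Num.min 1 (Num.max 0 c) - Num.min 1 (Num.max 0 c')| <= `|c - c'|.
Proof.
have h1 := ler_norm (c - c'); have h2 := ler_norm (c' - c); rewrite distrC in h2.
by rewrite ler_norml; case: (clamp_cases c) => -[hc ->];
  case: (clamp_cases c') => -[hc' ->]; apply/andP; split; lra.
Qed.

Lemma sqr_ge_quarter (R : realType) (tau x y c f : R) : 0 < tau ->
  0 <= 2 * `|x| / tau - 2 -> `|x| <= `|y| + c -> c <= tau / 2 -> f <= 1 ->
  tau ^+ 2 / 4 * f <= y ^+ 2.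
Proof.
move=> tau0 hx h1 h2 f1.
have h3 : tau <= `|x|.
  by move: hx; rewrite subr_ge0 ler_pdivlMr//; lra.
have h4 : tau / 2 <= `|y| by lra.
have h5 : (tau / 2) ^+ 2 <= `|y| ^+ 2.
  by rewrite lerXn2r// nnegrE; lra.
rewrite real_normK ?num_real// in h5.
have c0 : 0 <= tau ^+ 2 / 4 by rewrite divr_ge0// sqr_ge0.
by have := ler_wpM2l c0 f1; lra.
Qed.

(** * Lower bound for the quadratic process *)

Section SmallBallLowerBound.
Context d d' (T : measurableType d) (T' : measurableType d') (R : realType).
Variables (P : probability T R) (n : nat) (Z0 : T -> T') (Z : 'I_n -> T -> T').
Hypothesis iid : independent_copies P Z0 Z.
Hypothesis mZ0 : measurable_fun setT Z0.
Hypothesis mZ : forall i, measurable_fun setT (Z i).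
Variables (p : nat) (vec : T' -> 'rV[R]_p) (Ng Ne : 'rV[R]_p -> R).
Hypothesis mvec : forall j, measurable_fun setT (fun z => vec z ord0 j).
Hypothesis vec1 : forall j, exists c, eub P (fun w => `|vec (Z0 w) ord0 j|) c.
Hypotheses (sNg : seminorm Ng) (sNe : seminorm Ne).
Hypothesis vec_tail : forall v g e, 0 < g -> 0 < e -> Ng v <= g -> Ne v <= e ->
  forall s, 0 <= s -> (P [set w | (s <= `|dot (vec (Z0 w)) v|)%R] <=
  (2 * expR (- Num.min (s ^+ 2 / g ^+ 2) (s / e)))%:E)%E.
Variables (b u tau Q t : R).
Hypotheses (bn : b ^+ 2 = n%:R) (u1 : 1 <= u) (tau0 : 0 < tau) (t0 : 0 < t).
Hypotheses (Q0 : 0 < Q) (Q1 : Q <= 1) (ubQ : 40 * u <= b * Q).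
Variables (F : seq 'rV[R]_p) (a1 a2 : R).
Hypothesis chF : chained Ne (Ng \+ Ne) F a1 a2.
Hypotheses (a1_ge0 : 0 <= a1) (a2_ge0 : 0 <= a2).
Hypothesis a12 : 500 * 500 * (b * a2 + a1) <= b ^+ 2 * Q * (t * tau).
Variables (J : finType) (j0 : J) (D : J -> 'rV[R]_p).
Hypothesis hullD : forall j, conv_hull [set` F] (t *: D j).
Hypothesis ballD : forall j,
  (Q%:E <= P [set w | (2 * tau <= `|dot (vec (Z0 w)) (D j)|)%R])%E.

Let dotvec v := fun z => dot (vec z) v.

Let mdot v : measurable_fun setT (dotvec v).
Proof. exact: measurable_dot. Qed.

(** Quantization moves the inner product by at most [eta * norm1 v], which costs a factor
    [expR (theta^2 * G^2)]: the [+ 1] in the constant. The doubling of [128^2] comes from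
    [e <= G]. *)
Lemma link_mgf_quantized (I : finType) (code : T' -> I) (r : I -> 'rV[R]_p)
    (v : 'rV[R]_p) (G e theta eta : R) :
  (forall i, measurable (code @^-1` [set i])) ->
  (forall z v, `|dot (r (code z)) v| <= `|dot (vec z) v| + eta * norm1 v) ->
  0 < G -> 0 < e -> e <= G -> Ng v <= G -> Ne v <= e -> 0 <= theta ->
  theta * e <= 1 / 16 -> 0 <= eta -> eta * norm1 v <= theta * G ^+ 2 ->
  \sum_i fine (P [set w | code (Z0 w) = i]) *
     ((expR (theta * dot (r i) v) + expR (- (theta * dot (r i) v))) / 2) <=
  expR ((2 * (128 * 128) + 1) * theta ^+ 2 * G ^+ 2).
Proof.
move=> mc rle G0 e0 eG vG ve th0 the eta0 etaG.
pose f i := (expR (theta * dot (r i) v) + expR (- (theta * dot (r i) v))) / 2.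
have f0 i : 0 <= f i by rewrite /f; nonneg.
have mdZ : measurable_fun setT (fun w => dot (vec (Z0 w)) v).
  exact: (measurableT_comp (mdot v) mZ0).
have cosh := bern_cosh G0 e0 mdZ (vec_tail G0 e0 vG ve) th0 the.
have mf : measurable_fun setT (fun w => f (code (Z0 w))).
  have mcode : measurable_fun setT (f \o code).
    move=> _ B mB; rewrite setTI comp_preimage; exact: measurable_code.
  exact: (measurableT_comp mcode mZ0).
have h := eub_le mf (fun w => f0 (code (Z0 w))) _
  (eubZ (expR_ge0 (theta * (eta * norm1 v))) cosh).
have /h[_ _] : forall w, f (code (Z0 w)) <= expR (theta * (eta * norm1 v)) *
  ((expR (theta * dot (vec (Z0 w)) v) + expR (- (theta * dot (vec (Z0 w)) v))) / 2).
  move=> w; rewrite /f mulrA ler_pM2r//; apply: add_expRN_shift.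
    by rewrite mulr_ge0// mulr_ge0// norm1_ge0.
  by rewrite !normrM (ger0_norm th0) -mulrDr ler_wpM2l.
rewrite (integral_code P mZ0 mc f0) lee_fin => /le_trans; apply.
rewrite -expRD ler_expR.
have h1 := ler_wpM2l th0 etaG.
have h2 : e ^+ 2 <= G ^+ 2 by rewrite lerXn2r// nnegrE ltW.
have h3 := ler_wpM2l (sqr_ge0 theta) h2.
lra.
Qed.

Lemma quadratic_lower :
  (P [set w | exists j, (\sum_k dot (vec (Z k w)) (D j) ^+ 2 <
      b ^+ 2 * (tau ^+ 2 * Q / 8))%R] <= (expR (- u ^+ 2))%:E)%E.
Proof.
move: (u1) (tau0) (t0) (Q0) (Q1) (ubQ) => u1' tau0' t0' Q0' Q1' ubQ'.
have b40 : 40 <= b.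
  rewrite leNgt; apply/negP => hb.
  have : b * Q < 40 * Q by rewrite ltr_pM2r.
  lra.
have b0 : 0 < b by lra.
have b1 : 1 <= b by lra.
case: chF => k [L [s0 [delta [d0 sizeL chL]]]].
have N10 v : 0 < Ne v + delta by have := seminorm_ge0 sNe v; lra.
have N20 v : 0 < (Ng \+ Ne)%R v + delta.
  have g0 := seminorm_ge0 sNg v; have e0 := seminorm_ge0 sNe v.
  by rewrite -[(_ \+ _) v]/(Ng v + Ne v); lra.
pose th s v := link_theta b Ne (Ng \+ Ne) delta s v.
have th0 s v : 0 < th s v.
  by rewrite /th /link_theta divr_gt0 ?exprn_gt0// mulr_gt0// link_scale_gt0.
pose SD := 1 + \sum_j norm1 (D j).
have SD1 : 1 <= SD by rewrite lerDl sumr_ge0// => j _; exact: norm1_ge0.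
(* All the upper bounds that the mesh must obey: for the loss in the mean of [f], for the error on
   the directions [D j], and for the exponential moments of the links. The list is finite, so a
   positive mesh exists. *)
pose tests := [:: Q / 4; tau / 2 / SD] ++
  flatten [seq [seq th s v * ((Ng \+ Ne)%R v + delta) ^+ 2 / (1 + norm1 v) | v <- L s] | s <- iota 0 k].
have [|eta eta0 heta] := @positive_lower_bound R tests.
  move=> x; rewrite mem_cat !inE => /orP[/orP[/eqP ->|/eqP ->]|].
  - by rewrite divr_gt0.
  - by rewrite !divr_gt0//; lra.
  move=> /flattenP[l /mapP[s _ ->]] /mapP[v _ ->].
  apply: divr_gt0; last by have := norm1_ge0 v; lra.
  by apply: mulr_gt0; [exact: th0 | apply: exprn_gt0; exact: N20].
have etaQ : eta <= Q / 4 by apply: heta; rewrite mem_cat mem_head.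
have etaD j : eta * norm1 (D j) <= tau / 2.
  have h : eta <= tau / 2 / SD by apply: heta; rewrite mem_cat !inE eqxx orbT.
  have jS : norm1 (D j) <= SD.
    rewrite /SD (bigD1 j)//= addrCA lerDl addr_ge0// sumr_ge0// => i _; exact: norm1_ge0.
  apply: (@le_trans _ _ (eta * SD)); first by rewrite ler_wpM2l// ltW.
  by rewrite -ler_pdivlMr//; lra.
have etaL s v : (s < k)%N -> v \in L s ->
    eta * norm1 v <= th s v * ((Ng \+ Ne)%R v + delta) ^+ 2.
  move=> sk vL; have n0 := norm1_ge0 v.
  have h : eta <= th s v * ((Ng \+ Ne)%R v + delta) ^+ 2 / (1 + norm1 v).
    apply: heta; rewrite mem_cat; apply/orP; right; apply/flattenP.
    exists [seq th s v * ((Ng \+ Ne)%R v + delta) ^+ 2 / (1 + norm1 v) | v <- L s].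
      by apply/mapP; exists s => //; rewrite mem_iota.
    by apply/mapP; exists v.
  move: h; rewrite ler_pdivlMr; last by lra.
  by have := eta0; lra.
have [I [code [r [A [mc rle mA PA close]]]]] := quantizer mZ0 mvec vec1 eta0.
pose q i := fine (P [set w | code (Z0 w) = i]).
have q0 i : 0 <= q i by exact: fine_ge0.
have q1 : \sum_i q i = 1.
  have := integral_code P mZ0 mc (r := fun=> 1 : R) (fun=> ler01).
  have -> : (\int[P]_w 1%:E = 1%:E * P setT)%E by exact: (integral_cst P measurableT 1%:E).
  rewrite probability_setT mule1 => -[->].
  by apply: eq_bigr => i _; rewrite mulr1.
have mgf s v : (s < k)%N -> v \in L s ->
  \sum_i q i * ((expR (th s v * dot (r i) v) + expR (- (th s v * dot (r i) v))) / 2) <=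
  expR ((2 * (128 * 128) + 1) * th s v ^+ 2 * ((Ng \+ Ne)%R v + delta) ^+ 2).
  move=> sk vL.
  have g0 := seminorm_ge0 sNg v; have e0 := seminorm_ge0 sNe v.
  apply: (@link_mgf_quantized I code r v ((Ng \+ Ne)%R v + delta) (Ne v + delta) _ eta) => //.
  - by rewrite -[(_ \+ _) v]/(Ng v + Ne v); lra.
  - by rewrite -[(_ \+ _) v]/(Ng v + Ne v); lra.
  - by lra.
  - exact: ltW.
  - rewrite /th /link_theta.
    have D0 := link_scale_gt0 b1 N10 N20 s v.
    rewrite mulrAC ler_pdivrMr ?mulr_gt0//.
    have : 2 ^+ s * (Ne v + delta) <= link_scale b Ne (Ng \+ Ne) delta s v.
      by rewrite /link_scale lerDr mulr_ge0 ?mulr_ge0 ?sqrtr_ge0// ltW.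
    lra.
  - exact: ltW.
  - exact: etaL.
(* Lipschitz ramp, 0 up to [tau] and 1 from [3/2 * tau] on: it tolerates an error [tau / 2] both
   from the small-ball level [2 * tau] downwards and from [tau] to [tau / 2]. *)
pose f i j := Num.min 1 (Num.max 0 (2 * `|dot (r i) (D j)| / tau - 2)).
have f01 i j : 0 <= f i j <= 1.
  by rewrite /f le_min ler01 le_max lexx ge_min lexx.
(* Twice the Lipschitz constant [2 / tau] of the ramp, as [fl] requires. *)
pose D' j := (4 / tau) *: D j.
pose l i j := dot (r i) (D' j).
have fl i j j' : 2 * `|f i j - f i j'| <= `|l i j - l i j'|.
  rewrite /l /D' !dotZr -mulrBr normrM (ger0_norm (_ : 0 <= 4 / tau)); last by rewrite divr_ge0// ltW.
  have := ler_dist_dist (dot (r i) (D j)) (dot (r i) (D j')).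
  set x := dot (r i) (D j); set y := dot (r i) (D j') => hxy.
  have clamp := @clamp_lipschitz R.
  have := clamp (2 * `|x| / tau - 2) (2 * `|y| / tau - 2).
  have -> : 2 * `|x| / tau - 2 - (2 * `|y| / tau - 2) = 2 / tau * (`|x| - `|y|) by ring.
  rewrite normrM (ger0_norm (_ : 0 <= 2 / tau)); last by rewrite divr_ge0// ltW.
  have c0 : 0 <= 4 / tau by rewrite divr_ge0// ltW.
  by have := ler_wpM2l c0 hxy; rewrite /f; lra.
(* On the small-ball event and inside the box, the decoded vector has inner product at least
   [3/2 * tau], so the ramp equals 1; the outside of the box costs [eta]. *)
have fmean j : Q - eta <= \sum_i q i * f i j.
  have f0 i : 0 <= f i j by case/andP: (f01 i j).
  have mfc : measurable_fun setT (fun w => f (code (Z0 w)) j).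
    have mcode : measurable_fun setT ((fun i => f i j) \o code).
      move=> _ B mB; rewrite setTI comp_preimage; exact: measurable_code.
    exact: (measurableT_comp mcode mZ0).
  have mnA : measurable [set w | ~ A (Z0 w)].
    by have := mZ0 measurableT (measurableC mA); rewrite setTI.
  have mBj : measurable [set w | 2 * tau <= `|dot (vec (Z0 w)) (D j)|].
    apply: measurable_ge; apply: measurableT_comp => //.
    exact: (measurableT_comp (mdot (D j)) mZ0).
  have ef : eub P (fun w => f (code (Z0 w)) j) (\sum_i q i * f i j).
    by split=> //; rewrite (integral_code P mZ0 mc f0).
  have mi : measurable_fun setT
    (\1_[set w | 2 * tau <= `|dot (vec (Z0 w)) (D j)|] : T -> R) by [].
  have := eub_le mi (fun w => ler0n _ _) _ (eubD (eub_indic mnA PA) ef).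
  case.
    move=> w; rewrite !indicE.
    case: (boolP (w \in [set w | 2 * tau <= _])) => [|_]; last by rewrite addr_ge0.
    rewrite inE /= => hw; case: (pselect (A (Z0 w))) => [Aw|nA]; last first.
      by rewrite mem_set//= lerDl.
    suff -> : f (code (Z0 w)) j = 1 by rewrite lerDr.
    have h1 := close _ Aw (D j); have h2 := etaD j.
    have h3 := ler_normD (dot (r (code (Z0 w))) (D j)) (dot (vec (Z0 w)) (D j) - dot (r (code (Z0 w))) (D j)).
    rewrite addrC subrK distrC in h3.
    have h4 : 3 / 2 * tau <= `|dot (r (code (Z0 w))) (D j)| by lra.
    have h5 : 1 <= 2 * `|dot (r (code (Z0 w))) (D j)| / tau - 2.
      by rewrite lerBrDr ler_pdivlMr//; lra.
    by rewrite /f max_r ?min_l//; lra.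
  move=> _ _; rewrite integral_indic// setIT => h.
  by have := le_trans (ballD j) h; rewrite lee_fin; lra.
(* With this choice [n * lam^2 = u^2]. *)
pose lam := u / b.
have lam01 : 0 <= lam <= 1.
  rewrite divr_ge0 ?ler_pdivrMr//=; [|lra|lra].
  have : b * Q <= b * 1 by rewrite ler_pM2l.
  lra.
pose Lam := iter n (rademacher_step q l) (fsup j0) (fun=> 0).
have main := iexp_mgf_sup q0 q1 f01 fl n (fun=> 0) (fsup_suplike j0 q0) lam01.
have LamE : Lam <= b ^+ 2 * Q / 8.
  rewrite /Lam iter_stepE.
  rewrite (eq_iexp _ _ (h2 := fun z => fsup j0 (fun j => walk r z (D' j)))); last first.
    move=> z; congr (fsup j0 _); apply/funext => j; rewrite add0r.
    by apply: eq_bigr => y _.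
  have c0 : 0 < t * tau / 4 by rewrite divr_gt0// mulr_gt0.
  have hull' j : conv_hull [set` F] ((t * tau / 4) *: D' j).
    rewrite /D' scalerA (_ : t * tau / 4 * (4 / tau) = t)//.
    by field; rewrite gt_eqF.
  have := mean_sup_walk q0 q1 b1 bn sizeL N10 N20 mgf chL j0 c0 a1_ge0 a2_ge0 hull'.
  move/le_trans; apply.
  (* Here [17 * 130 * 3 * 4 * 8 = 212160 <= 500 * 500], the constant in [a12]. *)
  rewrite mulrC ler_pdivrMr//.
  have := a12; have : 0 <= b * a2 + a1 by rewrite addr_ge0// mulr_ge0// ltW.
  by lra.
pose bad (z : seq I) := [exists j, \sum_(i <- z) f i j < b ^+ 2 * Q / 2].
have lam0 : 0 <= lam by case/andP: lam01.
(* A bad word has deficit at least [n * (Q - eta) - n * Q / 2], hence at least [n * Q / 4] because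
   [eta <= Q / 4]. *)
have key : expR (lam * (b ^+ 2 * Q / 4)) * \sum_(z : n.-tuple I | bad z) \prod_(i <- z) q i <=
    expR (n%:R * (expR 1 * lam ^+ 2)) * expR (lam * Lam).
  apply: le_trans main; apply: iexp_markov => // z zn /existsP[j hj].
  rewrite ler_expR ler_wpM2l//.
  apply: le_trans (fsup_ub j0 (fun j => 0 + \sum_(i <- z) centered q f i j) j).
  rewrite add0r /centered sumrB big_const_seq count_predT iter_addr_0 zn.
  rewrite -[X in X - _]mulr_natl -bn.
  have := ler_wpM2l (sqr_ge0 b) (fmean j); have := ler_wpM2l (sqr_ge0 b) etaQ.
  lra.
(* The exponent is at most [4 * u^2 + u * b * Q / 8 - u * b * Q / 4], and [b * Q >= 40 * u] brings
   it down to [- u^2]. *)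
have hsum : \sum_(z : n.-tuple I | bad z) \prod_(i <- z) q i <= expR (- u ^+ 2).
  have c0 := expR_gt0 (lam * (b ^+ 2 * Q / 4)).
  rewrite -(ler_pM2l c0); apply: (le_trans key); rewrite -!expRD ler_expR -bn.
  have h1 := ler_wpM2l lam0 LamE.
  have e4 : expR 1 <= 4 :> R.
    have /andP[_ h] := expR_half_bounds R.
    have -> : expR 1 = expR (1 / 2) * expR (1 / 2) :> R by rewrite -expRD; congr expR; lra.
    have -> : 4 = 2 * 2 :> R by ring.
    by apply: ler_pM => //; exact: expR_ge0.
  have lb : lam * b = u by rewrite /lam divfK// gt_eqF.
  have e1 : b ^+ 2 * (expR 1 * lam ^+ 2) = expR 1 * u ^+ 2 by rewrite -lb; ring.
  have e2 : lam * (b ^+ 2 * Q / 8) = u * (b * Q) / 8 by rewrite -lb; ring.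
  have e3 : lam * (b ^+ 2 * Q / 4) = u * (b * Q) / 4 by rewrite -lb; ring.
  rewrite e1 e3; rewrite e2 in h1.
  have h2 : u * (40 * u) <= u * (b * Q) by rewrite ler_wpM2l//; lra.
  have h3 := ler_wpM2r (sqr_ge0 u) e4.
  lra.
(* Return to the sample space: the failure event is covered by the events of the bad code words,
   whose probabilities are the weights just summed. *)
pose B (z : n.-tuple I) := [set w | forall k, code (Z k w) = tnth z k].
have mB z : measurable (B z).
  rewrite (_ : B z = \bigcap_k (Z k @^-1` (code @^-1` [set tnth z k]))).
    apply: fin_bigcap_measurable => [|i _]; first exact: finite_finset.
    by have := mZ i measurableT (mc (tnth z i)); rewrite setTI.
  by apply/seteqP; split=> [w h i _|w h i]; exact: h.
have PB z : (P (B z) <= (\prod_(i <- z) q i)%:E)%E.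
  rewrite (iid_code iid _ mc) big_tuple -prodEFin le_eqVlt; apply/orP; left; apply/eqP.
  apply: eq_bigr => i _; rewrite /q fineK// fin_num_measure//.
  by have := mZ0 measurableT (mc (tnth z i)); rewrite setTI.
pose zs := [seq z : n.-tuple I <- enum {:n.-tuple I} | bad (tval z)].
have [mU PU] := probability_bigU zs mB PB.
have subU : [set w | exists j, \sum_k dot (vec (Z k w)) (D j) ^+ 2 <
    b ^+ 2 * (tau ^+ 2 * Q / 8)] `<=` \big[setU/set0]_(z <- zs) B z.
  move=> w [j hj]; rewrite -bigcup_seq; pose z := [tuple code (Z k w) | k < n].
  exists z; last by move=> i; rewrite tnth_mktuple.
  rewrite /= mem_filter mem_enum andbT; apply/existsP; exists j.
  have -> : \sum_(i <- z) f i j = \sum_k f (code (Z k w)) j.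
    by rewrite big_tuple; apply: eq_bigr => i _; rewrite tnth_mktuple.
  have fle i : tau ^+ 2 / 4 * f (code (Z i w)) j <= dot (vec (Z i w)) (D j) ^+ 2.
    have h1 := rle (Z i w) (D j); have h2 := etaD j.
    have /andP[f0 f1] := f01 (code (Z i w)) j.
    case: (clamp_cases (2 * `|dot (r (code (Z i w))) (D j)| / tau - 2)) => [[_ e]|[/andP[hc _] _]|[hc _]].
    - by rewrite /f e mulr0 sqr_ge0.
    - exact: sqr_ge_quarter tau0 hc h1 h2 f1.
    - exact: sqr_ge_quarter tau0 (le_trans ler01 hc) h1 h2 f1.
  have h : tau ^+ 2 / 4 * \sum_k f (code (Z k w)) j <= \sum_k dot (vec (Z k w)) (D j) ^+ 2.
    by rewrite mulr_sumr; apply: ler_sum => i _.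
  have t4 : 0 < tau ^+ 2 / 4 by rewrite divr_gt0// exprn_gt0.
  rewrite -(ltr_pM2l t4); apply: (le_lt_trans h); apply: (lt_le_trans hj).
  by rewrite le_eqVlt; apply/orP; left; apply/eqP; field.
apply: (@le_trans _ _ (\sum_(z <- zs) \prod_(i <- z) q i)%:E); last first.
  by rewrite lee_fin big_filter big_enum_cond.
apply: le_trans PU; apply: le_measure; rewrite ?inE//.
rewrite (_ : [set w | _] = \bigcup_(j in [set: J]) [set w | \sum_k dot (vec (Z k w)) (D j) ^+ 2 <
    b ^+ 2 * (tau ^+ 2 * Q / 8)]); last first.
  by apply/seteqP; split=> [w [j hj]|w [j _ hj]]; exists j.
apply: fin_bigcup_measurable => [|j _]; first exact: finite_finset.
have ms : measurable_fun setT (fun w => \sum_k dot (vec (Z k w)) (D j) ^+ 2).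
  apply: measurable_sum => i; apply: measurable_funX.
  exact: (measurableT_comp (mdot (D j)) (mZ i)).
have := measurableC (measurable_ge (b ^+ 2 * (tau ^+ 2 * Q / 8)) ms).
by congr (measurable _); apply/seteqP; split=> w /=; rewrite ltNge => /negP.
Qed.

End SmallBallLowerBound.

(** * Borel vectors and sub-exponential variables *)

Lemma measurable_coord (R : realType) (p : nat) (j : 'I_p) :
  measurable_fun setT (fun z : borel_rV R p => (z : 'rV[R]_p) ord0 j).
Proof.
apply: (measurability _ (RGenOpens.measurableE R)).
move=> _ [_ [a [b ->] <-]]; rewrite setTI; apply: sub_sigma_algebra.
have /continuousP := @coord_continuous R 1 p ord0 j; apply; exact: interval_open.
Qed.

Lemma le_ediv (R : realType) (a x g : R) : 0 <= a -> 0 <= x -> x <= g -> 0 < g ->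
  ((a / g)%:E <= a%:E / x%:E)%E.
Proof.
move=> a0 x0 xg g0; rewrite inver; case: ifPn => [_|xn].
  case: (ltgtP a 0) a0 => // [a0 _|-> _]; last by rewrite mul0r mul0e.
  by rewrite gt0_muley ?leey// lte_fin.
rewrite -EFinM lee_fin ler_wpM2l// lef_pV2 ?posrE// lt_neqAle eq_sym xn//.
Qed.

Section Tails.
Context d (T : measurableType d) (R : realType) (P : probability T R).
Variables (p : nat) (Ng Ne : 'rV[R]_p -> R) (x : T -> 'rV[R]_p).
Hypotheses (sNg : seminorm Ng) (sNe : seminorm Ne).
Hypothesis mx : forall j, measurable_fun setT (fun w => x w ord0 j).
Hypothesis bx : generic_bernstein P x Ng Ne.

(** Positive upper bounds in place of the semi-norms dispose of the conventions for division by
    zero; everything else is done with such bounds. *)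
Lemma bernstein_tail v g e : 0 < g -> 0 < e -> Ng v <= g -> Ne v <= e ->
  forall s, 0 <= s -> (P [set w | (s <= `|dot (x w) v|)%R] <=
  (2 * expR (- Num.min (s ^+ 2 / g ^+ 2) (s / e)))%:E)%E.
Proof.
move=> g0 e0 vg ve s s0; apply: (le_trans (bx v s0)).
rewrite [leRHS]EFinM lee_wpmul2l//.
set m := Num.min _ _; rewrite -[(expR (- m))%:E]/(expeR (- m%:E)%E) /m.
rewrite lee_expeR leeN2 EFin_min le_min; apply/andP; split.
  rewrite ge_min; apply/orP; left; apply: le_ediv; rewrite ?sqr_ge0 ?exprn_gt0//.
  by rewrite lerXn2r// nnegrE ?(seminorm_ge0 sNg)// ltW.
by rewrite ge_min; apply/orP; right; apply: le_ediv; rewrite ?(seminorm_ge0 sNe).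
Qed.

Lemma measurable_dotx v : measurable_fun setT (fun w => dot (x w) v).
Proof. exact: measurable_dot. Qed.

Lemma coord_eub j : exists c, eub P (fun w => `|x w ord0 j|) c.
Proof.
pose v := delta_mx ord0 j : 'rV[R]_p.
have g0 : 0 < Ng v + 1 by have := seminorm_ge0 sNg v; lra.
have e0 : 0 < Ne v + 1 by have := seminorm_ge0 sNe v; lra.
have vg : Ng v <= Ng v + 1 by rewrite lerDl.
have ve : Ne v <= Ne v + 1 by rewrite lerDl.
have B := bern_expR g0 e0 (measurable_dotx v) (bernstein_tail g0 e0 vg ve).
exists (8 * ((Ng v + 1) + (Ne v + 1)) * 12).
have c0 : 0 <= 8 * ((Ng v + 1) + (Ne v + 1)).
  by rewrite mulr_ge0// addr_ge0// ltW.
apply: (eub_le _ _ _ (eubZ c0 B)) => [|w|w]; [exact: measurableT_comp | exact: normr_ge0 |].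
have -> : x w ord0 j = dot (x w) v.
  rewrite /dot (bigD1 j)//= big1 ?addr0 ?mxE ?eqxx ?mulr1// => i ij.
  by rewrite mxE /= (negbTE ij) mulr0.
apply: (le_trans (trunc_abs_le g0 e0 _)); apply: ler_wpM2l; first exact: c0.
by rewrite ler_expR; have := bern_ge0 (Ng v + 1) e0 (dot (x w) v); lra.
Qed.

(** With [a = th * |z|], [expR (a / 48) <= 1 + expR a / 24] and [expR a <= 2 * expR (A / 2)]. The
    mean is at most [1 + 12 / 12 = 2], which explains the scale [48 / th]. *)
Lemma dot_sub_exponential v : exists2 s : R, 0 < s &
  eub P (fun w => expR (`|dot (x w) v| / s)) 2.
Proof.
have vg : Ng v <= Ng v + 1 by rewrite lerDl.
have ve : Ne v <= Ne v + 1 by rewrite lerDl.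
have g0 : 0 < Ng v + 1 by have := seminorm_ge0 sNg v; lra.
have e0 : 0 < Ne v + 1 by have := seminorm_ge0 sNe v; lra.
set g := Ng v + 1 in g0 vg; set e := Ne v + 1 in e0 ve.
pose th := (16 * (g + e))^-1.
have ge0 : 0 < 16 * (g + e) by rewrite mulr_gt0// addr_gt0.
have th0 : 0 < th by rewrite invr_gt0.
have thge : th * (16 * (g + e)) = 1 by rewrite mulVf// gt_eqF.
have the : th * e <= 1 / 16 by have : 0 < th * g by [rewrite mulr_gt0]; lra.
have thg : th * g <= 1 / 16 by have : 0 < th * e by [rewrite mulr_gt0]; lra.
exists (48 / th); first by rewrite divr_gt0.
have B := bern_expR g0 e0 (measurable_dotx v) (bernstein_tail g0 e0 vg ve).
have e2 : expR (1 / 64) <= 2 :> R.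
  have /andP[_ h] := expR_half_bounds R; apply: le_trans h; rewrite ler_expR; lra.
apply: (@eubW _ _ _ _ _ (1 + 1 / 12 * 12)); first by lra.
have c12 : 0 <= 1 / 12 :> R by lra.
apply: (eub_le _ _ _ (eubD (eub_cst P ler01) (eubZ c12 B))).
- apply: measurableT_comp => //; apply: measurable_funM => //.
  by apply: measurableT_comp => //; exact: measurable_dotx.
- by move=> w; exact: expR_ge0.
move=> w /=; set z := dot (x w) v.
have A0 := bern_ge0 g e0 z.
have lin := bern_linear g0 e0 z (ltW th0) the.
set a := th * `|z| in lin.
have a0 : 0 <= a by rewrite mulr_ge0// ltW.
have -> : `|z| / (48 / th) = a / 48 by rewrite invf_div mulrA (mulrC (`|z|) th).
have al : a <= 1 / 64 + bern g e z / 2.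
  have : (th * g) ^+ 2 <= (1 / 16) ^+ 2.
    by rewrite lerXn2r// nnegrE; [rewrite mulr_ge0// ltW | lra].
  rewrite exprMn; lra.
have h1 : expR (a / 48) <= 1 + a / 48 * expR (a / 48).
  have := expR_ge1Dx (- (a / 48)) => /(ler_wpM2l (expR_ge0 (a / 48))).
  by rewrite -expRD subrr expR0; lra.
have h2 : a / 2 <= expR (a / 2) by exact: id_le_expR.
have h3 : a / 48 * expR (a / 48) <= 1 / 24 * expR a.
  have -> : expR a = expR (a / 2) * expR (a / 2) by rewrite -expRD; congr expR; lra.
  rewrite mulrA; apply: ler_pM; [lra | exact: expR_ge0 | lra | by rewrite ler_expR; lra].
have h4 : expR a <= 2 * expR (bern g e z / 2).
  apply: (@le_trans _ _ (expR (1 / 64 + bern g e z / 2))); first by rewrite ler_expR.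
  by rewrite expRD ler_wpM2r ?expR_ge0.
lra.
Qed.

End Tails.

Section Psi1.
Context d (T : measurableType d) (R : realType) (P : probability T R).
Implicit Types Z : T -> R.

(** The strict inequality yields an admissible scale below [s] without appeal to attainment of the
    infimum; the exponential moment decreases as the scale grows. *)
Lemma psi1_eub Z (s : R) : measurable_fun setT Z -> (psi1_norm P Z < s%:E)%E ->
  0 < s /\ eub P (fun w => expR (`|Z w| / s)) 2.
Proof.
move=> mZ /ereal_inf_lt[_ [r [r0 hr] <-]]; rewrite lte_fin => rs.
have s0 : 0 < s by exact: lt_trans rs.
split=> //.
have er : eub P (fun w => expR (`|Z w| / r)) 2.
  split => //; last by move: hr; rewrite unlock.
  by apply: measurableT_comp => //; apply: measurable_funM => //; exact: measurableT_comp.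
apply: (eub_le _ _ _ er) => //.
  by apply: measurableT_comp => //; apply: measurable_funM => //; exact: measurableT_comp.
by move=> w; rewrite ler_expR ler_wpM2l// lef_pV2 ?posrE// ltW.
Qed.

Lemma eub_psi1 Z (s : R) : 0 < s -> eub P (fun w => expR (`|Z w| / s)) 2 ->
  (psi1_norm P Z <= s%:E)%E.
Proof.
move=> s0 [_ _ h]; apply: ereal_inf_lbound; exists s => //; split => //.
by rewrite unlock.
Qed.

Lemma psi1_ge0 Z : (0 <= psi1_norm P Z)%E.
Proof. by apply: le_ereal_inf_tmp => _ [s [s0 _] <-]; rewrite lee_fin ltW. Qed.

Lemma eub_expR_sub Z1 Z2 (s1 s2 : R) : measurable_fun setT Z1 -> measurable_fun setT Z2 ->
  0 < s1 -> 0 < s2 ->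
  eub P (fun w => expR (`|Z1 w| / s1)) 2 -> eub P (fun w => expR (`|Z2 w| / s2)) 2 ->
  eub P (fun w => expR (`|Z1 w - Z2 w| / (2 * (s1 + s2)))) 2.
Proof.
move=> m1 m2 s10 s20 h1 h2; have s0 : 0 < 2 * (s1 + s2) by lra.
apply: (@eubW _ _ _ _ _ (1 / 2 * (2 + 2))); first by lra.
have c12 : 0 <= 1 / 2 :> R by lra.
apply: (eub_le _ _ _ (eubZ c12 (eubD h1 h2))).
- apply: measurableT_comp => //; apply: measurable_funM => //.
  by apply: measurableT_comp => //; exact: measurable_funB.
- by move=> w; exact: expR_ge0.
move=> w; apply: (@le_trans _ _ (expR (`|Z1 w| / (2 * (s1 + s2)) + `|Z2 w| / (2 * (s1 + s2))))).
  by rewrite ler_expR -mulrDl ler_wpM2r ?invr_ge0 ?ler_normB// ltW.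
apply: (le_trans (add_expR_le _ _)); rewrite mulrC mul1r ler_pM2l ?invr_gt0//.
have e (z s : R) : 0 < s -> s <= s1 + s2 -> 2 * (`|z| / (2 * (s1 + s2))) <= `|z| / s.
  move=> sp sl; have -> : 2 * (`|z| / (2 * (s1 + s2))) = `|z| / (s1 + s2) by field; lra.
  by rewrite ler_wpM2l// lef_pV2 ?posrE//; lra.
by apply: lerD; rewrite ler_expR e//; lra.
Qed.

End Psi1.

(** * Convexity and localization *)

Section ConvexHull.
Variables (R : realType) (p : nat).
Local Notation V := 'rV[R]_p.

Lemma conv_hull_sub (S S' : set V) : S `<=` S' -> conv_hull S `<=` conv_hull S'.
Proof. by move=> SS' v h A [cA SA]; apply: h; split=> // s /SS'; exact: SA. Qed.

Lemma conv_hull_convex (S : set V) : convex_set (conv_hull S : set (convex_lmodType V)).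
Proof.
move=> x y l; rewrite !inE => hx hy A [cA SA].
have := cA x y l; rewrite !inE; apply; [exact: hx | exact: hy].
Qed.

(** The vectors that lie in the hull of a finite part of [S] form a convex set containing [S]:
    finite parts can be concatenated. *)
Lemma conv_hull_finite (S : set V) v : conv_hull S v ->
  exists2 F : seq V, forall s, s \in F -> S s & conv_hull [set` F] v.
Proof.
pose U := [set v | exists2 F : seq V, (forall s, s \in F -> S s) & conv_hull [set` F] v].
suff : conv_hull S `<=` U by apply.
apply: smallest_sub => [x y l|s Ss].
  rewrite !inE => -[F1 h1 c1] [F2 h2 c2]; exists (F1 ++ F2).
    by move=> s; rewrite mem_cat => /orP[/h1|/h2].
  have := @conv_hull_convex [set` F1 ++ F2] x y l; rewrite !inE; apply.
    by apply: conv_hull_sub c1 => s /= sF; rewrite mem_cat sF.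
  by apply: conv_hull_sub c2 => s /= sF; rewrite mem_cat sF orbT.
exists [:: s]; first by move=> u; rewrite inE => /eqP ->.
by move=> A [_ SA]; apply: SA; rewrite /= mem_head.
Qed.

Lemma conv_hull_finite_seq (S : set V) (D : seq V) :
  (forall v, v \in D -> conv_hull S v) ->
  exists2 F : seq V, forall s, s \in F -> S s &
    forall v, v \in D -> conv_hull [set` F] v.
Proof.
elim: D => [|x D IH] hD; first by exists [::].
have [|F1 h1 c1] := IH; first by move=> v vD; apply: hD; rewrite inE vD orbT.
have [F2 h2 c2] := conv_hull_finite (hD x (mem_head _ _)).
exists (F1 ++ F2); first by move=> s; rewrite mem_cat => /orP[/h1|/h2].
move=> v; rewrite inE => /orP[/eqP ->|/c1].
  by apply: conv_hull_sub c2 => s /= sF; rewrite mem_cat sF orbT.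
by apply: conv_hull_sub => s /= sF; rewrite mem_cat sF.
Qed.

End ConvexHull.

(** One point of [M] is picked in each cell of the grids of mesh [1 / (k + 1)], the cells being
    countably many; cells missing [M] get the default [x0]. The sequence thus stays inside [M]. *)
Lemma dense_sequence (R : realType) (p : nat) (M : set 'rV[R]_p) x0 : M x0 ->
  exists2 D : nat -> 'rV[R]_p, forall i, M (D i) &
   forall x, M x -> forall eps, 0 < eps ->
     exists i, forall j, `|x ord0 j - D i ord0 j| < eps.
Proof.
move=> Mx0.
pose cell (c : nat * {ffun 'I_p -> int}) : set 'rV[R]_p :=
  [set x | M x /\ forall j, (c.2 j)%:~R <= x ord0 j * c.1.+1%:R < (c.2 j)%:~R + 1].
exists (fun i => if (choice.unpickle i : option (nat * {ffun 'I_p -> int})) is Some c then xget x0 (cell c) else x0).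
  move=> i; case: (choice.unpickle i : option _) => // c; case: xgetP => [y _ []|] //.
move=> x Mx eps e0.
pose k := Num.truncn eps^-1.
pose a : {ffun 'I_p -> int} := [ffun j => Num.floor (x ord0 j * k.+1%:R)].
have cx : cell (k, a) x.
  split=> // j; rewrite /= ffunE; have := floor_itv (x ord0 j * k.+1%:R).
  by rewrite intrD.
exists (choice.pickle (k, a)) => j; rewrite choice.pickleK.
have [_ /(_ j) /=] := xgetI x0 cx; set y := xget _ _ => /andP[h1 h2].
have [_ /(_ j) /=] := cx => /andP[h3 h4].
have k0 : 0 < k.+1%:R :> R by rewrite ltr0n.
have ke : 1 < eps * k.+1%:R.
  by rewrite mulrC -ltr_pdivrMr// div1r truncnS_gt.
rewrite -(ltr_pM2r k0) -[X in _ * X < _](gtr0_norm k0) -normrM mulrBl.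
by apply: lt_trans ke; rewrite ltr_norml; apply/andP; split; lra.
Qed.

Lemma continuous_sum_fun (R : realType) (p : nat) (I : Type) (s : seq I)
    (f : I -> 'rV[R]_p -> R) : (forall i, continuous (f i)) ->
  continuous (fun v => \sum_(i <- s) f i v).
Proof.
move=> cf v; have fv : Filter (nbhs v) by exact: nbhs_filter.
by apply: cvg_big => [|i _]; [exact: add_continuous | exact: cf].
Qed.

Lemma continuous_dot (R : realType) (p : nat) (a : 'rV[R]_p) :
  continuous (dot a : 'rV[R]_p -> R).
Proof.
apply: continuous_sum_fun => i v.
have h1 := @cvg_cst _ (a ord0 i : R) _ (nbhs v) (nbhs_filter v).
exact: cvgM h1 (@coord_continuous R 1 p ord0 i v).
Qed.

Lemma dense_open_hit (R : realType) (p : nat) (D : nat -> 'rV[R]_p) (x : 'rV[R]_p)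
    (f : 'rV[R]_p -> R) (c : R) : continuous f -> f x < c ->
  (forall eps, 0 < eps -> exists i, forall j, `|x ord0 j - D i ord0 j| < eps) ->
  exists i, f (D i) < c.
Proof.
move=> cf fx hD.
have := @cvgr_lt _ _ (nbhs x) (nbhs_filter x) f (f x) (cf x) c fx.
move=> /nbhs_ballP[eps /= e0 he]; have [i hi] := hD eps e0; exists i; apply: he.
by split=> // a j; rewrite (ord1 a); exact: hi.
Qed.

Lemma norm2Z (R : realType) (p : nat) (a : R) (v : 'rV[R]_p) : norm2 (a *: v) = `|a| * norm2 v.
Proof.
rewrite /norm2 dotZr dotC dotZr mulrA -expr2 sqrtrM ?sqr_ge0//.
by rewrite sqrtr_sqr.
Qed.

Section Geometry.
Variables (R : realType) (p : nat) (K : set 'rV[R]_p) (beta : 'rV[R]_p).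
Hypotheses (cK : convex_set K) (Kb : K beta).

Lemma span_hull_linear (L : set 'rV[R]_p) : linear_subspace (span_hull L).
Proof.
split; first by move=> A [[A0 _] _].
move=> a u v hu hv A [lA LA]; have [_ h] := lA.
by apply: h; [exact: hu | exact: hv].
Qed.

Lemma normalized_sub_span t : normalized_set K beta t `<=` span_hull (set_diff K) `&` sphere R p.
Proof.
have lin := span_hull_linear (set_diff K).
have sub : translate K beta `<=` span_hull (set_diff K).
  by move=> _ [k Kk <-] A [_ SA]; apply: SA; exists k => //; exists beta.
move=> v [h1 h2]; split=> //; move: h1; case: ifP => _.
  apply: smallest_sub => //; split; first by case: lin.
  move=> a b x y _ _ hx hy; case: lin => z h; apply: (h) => //.
  by rewrite -[b *: y]addr0; apply: h.
move=> [k Kk <-]; case: lin => z h; rewrite -[_ *: _]addr0; apply: h => //; exact: sub.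
Qed.

(* At [t = 0] the complexities and mismatch parameters are taken on the cone at
   scale [1]; [scale_of] and [local_set] give both cases a common form. *)
Definition scale_of t : R := if t == 0 then 1 else t.

Definition local_set t : set 'rV[R]_p :=
  if t == 0 then cone_hull (translate K beta) `&` sphere R p
  else translate K beta `&` scale_set t (sphere R p).

Lemma scale_of_gt0 t : 0 <= t -> 0 < scale_of t.
Proof.
by move=> t0; rewrite /scale_of; case: eqVneq => // h; rewrite lt_neqAle eq_sym h.
Qed.

Lemma normalized_local t v : normalized_set K beta t v -> local_set t (scale_of t *: v).
Proof.
rewrite /normalized_set /local_set /scale_of; case: eqVneq => t0 [h1 h2].
  by rewrite scale1r.
split; last by exists v.
by move: h1 => [k hk <-]; rewrite scalerA divff// scale1r.
Qed.

Lemma minimizer_direction (n : nat) (X : 'I_n -> 'rV[R]_p) (Y : 'I_n -> R) t bhat :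
  (0 < n)%N -> 0 <= t -> t < norm2 (bhat - beta) ->
  minimizer K (empirical_risk X Y) bhat ->
  exists v, normalized_set K beta t v /\
    norm2 (bhat - beta) * \sum_i dot (X i) v ^+ 2 <=
      2 * \sum_i (Y i - dot (X i) beta) * dot (X i) v.
Proof.
move=> n0 t0; set h := bhat - beta; set r := norm2 h => tr [Kbh hmin].
have r0 : 0 < r by exact: le_lt_trans tr.
exists (r^-1 *: h); split.
  split; last by rewrite /sphere /= norm2Z ger0_norm ?invr_ge0 ?ltW// mulVf// gt_eqF.
  have hK : translate K beta h by exists bhat.
  case: ifP => t00.
    move=> A [[A0 cA] subA]; have := cA r^-1 0 h 0; rewrite scaler0 addr0; apply => //.
      by rewrite invr_ge0 ltW.
    exact: subA.
  have tp : 0 < t by rewrite lt_neqAle eq_sym t00.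
  have l0 : 0 <= t / r by rewrite divr_ge0// ltW.
  have l1 : t / r <= 1 by rewrite ler_pdivrMr// mul1r ltW.
  (* Since [t < r], the point at distance [t] from [beta] lies on the segment towards the minimizer,
     hence in [K]. *)
  exists ((t / r) *: h); last by rewrite scalerA mulrA mulVf ?gt_eqF// mul1r.
  pose l : {i01 R} := Itv01 l0 l1.
  exists (conv l (bhat : convex_lmodType 'rV[R]_p) beta).
    by have := cK l (mem_set Kbh) (mem_set Kb); rewrite inE.
  rewrite /h; have -> : conv l (bhat : convex_lmodType 'rV[R]_p) beta = (t / r) *: bhat + (1 - t / r) *: beta by [].
  by rewrite scalerBr scalerBl scale1r addrA addrAC addrK.
have := hmin beta Kb; rewrite /empirical_risk ler_pM2l ?invr_gt0 ?ltr0n//.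
have e i : (Y i - dot (X i) bhat) ^+ 2 = (Y i - dot (X i) beta) ^+ 2 -
    2 * r * ((Y i - dot (X i) beta) * dot (X i) (r^-1 *: h)) +
    r ^+ 2 * dot (X i) (r^-1 *: h) ^+ 2.
  have -> : dot (X i) bhat = r * dot (X i) (r^-1 *: h) + dot (X i) beta.
    by rewrite -dot_linear scalerA mulfV ?gt_eqF// scale1r subrK.
  ring.
under eq_bigr do rewrite e.
rewrite big_split sumrB /= -!mulr_sumr => hh.
rewrite -(ler_pM2l r0); lra.
Qed.

End Geometry.

(** * Complexities *)

(** An admissible sequence has exactly one block at level 0, and blocks are nonempty; so [S] has a
    point and the supremum is not [-oo]. *)
Lemma gamma_ge0 (R : realType) (p alpha : nat) (S : set 'rV[R]_p) (N : 'rV[R]_p -> R) :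
  seminorm N -> (0 <= gamma alpha S N)%E.
Proof.
move=> sN; apply: le_ereal_inf_tmp => _ [A [hpart _ h0 _] <-].
have [B AB] : exists B, A 0%N B.
  apply/set0P/negP => /eqP A0; move: h0; rewrite A0 card_eq_sym card_eq0.
  by move=> /eqP/seteqP[/(_ 0%N) h _]; exact: h.
have [cov _ ne] := hpart 0%N; have [v Bv] := ne B AB.
have Sv : S v by rewrite -cov; exists B.
apply: (@le_trans _ _ _ _ _ _ (ereal_sup_ubound _)); last by exists v => //; exact: erefl.
apply: nneseries_ge0 => s _ _; rewrite mule_ge0// ?lee_fin ?powR_ge0//.
apply: ereal_sup_ubound.
have [cov' _ _] := hpart s.
have [_ vv] : A s (pblock (A s) id v) /\ pblock (A s) id v v.
  by apply: (@getPex _ (fun B => A s B /\ B v)); move: Sv; rewrite -cov' => -[B' AB' Bv']; exists B'.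
by exists v => //; exists v => //=; rewrite subrr (seminorm0 sN).
Qed.

Lemma split_lt_adde (R : realType) (g1 g2 : \bar R) (c r : R) :
  (0 <= g1)%E -> (0 <= g2)%E -> 0 < c -> (g1 / c%:E + g2 < r%:E)%E ->
  exists a1 a2 : R, [/\ 0 < a1, 0 < a2, (g1 < a1%:E)%E, (g2 < a2%:E)%E & a1 / c + a2 < r].
Proof.
move=> h1 h2 c0; rewrite inver (gt_eqF c0).
case: g1 h1 => [g1| |]//; last first.
  by rewrite gt0_mulye ?lte_fin ?invr_gt0// => _; case: g2 h2 => [g2| |].
case: g2 h2 => [g2| |]//; rewrite !lee_fin -EFinM -EFinD lte_fin => h2 h1 h.
pose s := (r - (g1 / c + g2)) / 4.
have s0 : 0 < s by rewrite /s; lra.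
exists (g1 + s * c), (g2 + s); split; rewrite ?lte_fin.
- by rewrite ltr_wpDl// mulr_gt0.
- by rewrite ltr_wpDl.
- by rewrite ltrDl mulr_gt0.
- by rewrite ltrDl.
- rewrite mulrDl mulfK ?gt_eqF//; move: (h); rewrite /s; lra.
Qed.

(** If [x] or [y] is below 16, the right-hand side already exceeds 1, because each exponential
    involved is then at least 1/2. Otherwise [40 <= expR 15] and [15 <= 31/32 * 16] absorb the
    factor 40. *)
Lemma tail_constants (R : realType) (q x y : R) : 0 <= x -> 0 <= y -> q <= 1 ->
  q <= 40 * (expR (- x) + expR (- y)) ->
  q <= 5 * expR (- (x / 32)) + 2 * expR (- (y / 32)).
Proof.
move=> x0 y0 q1 hq.
have ex := expR_ge0 (- (x / 32)); have ey := expR_ge0 (- (y / 32)).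
have /andP[_ e2] := expR_half_bounds R.
have eN : 1 / 2 <= expR (- (1 / 2)) :> R.
  have h : expR (1 / 2) * expR (- (1 / 2)) = 1 :> R by rewrite -expRD subrr expR0.
  have := ler_wpM2r (expR_ge0 (- (1 / 2) : R)) e2; rewrite h; lra.
have big z : z < 16 -> 1 / 2 <= expR (- (z / 32)) :> R.
  by move=> z16; apply: le_trans eN _; rewrite ler_expR; lra.
have e40 : 40 <= expR 15 :> R.
  have e1 : 2 <= expR 1 :> R by have := expR_ge1Dx (1 : R); lra.
  apply: (@le_trans _ _ (2 ^+ 15)); first by rewrite !exprS expr0; lra.
  by rewrite -[15 in leRHS]mulr1 expRM_natl lerXn2r// nnegrE// expR_ge0.
have small z : 16 <= z -> 40 * expR (- z) <= expR (- (z / 32)) :> R.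
  move=> z16; apply: (@le_trans _ _ (expR 15 * expR (- z))).
    by rewrite ler_wpM2r// expR_ge0.
  by rewrite -expRD ler_expR; lra.
case: (ltP x 16) => [/big|/small] hx; first by lra.
case: (ltP y 16) => [/big|/small] hy; first by lra.
lra.
Qed.

Section ChainData.
Variables (R : realType) (p : nat) (Ng Ne : 'rV[R]_p -> R).
Hypotheses (sNg : seminorm Ng) (sNe : seminorm Ne).
Implicit Types (M : set 'rV[R]_p) (D : seq 'rV[R]_p).

Lemma seminormD : seminorm (Ng \+ Ne)%R.
Proof.
case: sNg => g1 g2; case: sNe => e1 e2; split=> [u v|a v] /=.
  by have := g1 u v; have := e1 u v; lra.
by rewrite g2 e2 mulrDr.
Qed.

Lemma q_bound_ge0 n M : (0 <= q_bound n Ng Ne M)%E.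
Proof.
apply: le_ereal_inf_tmp => _ [S _ <-].
rewrite adde_ge0//; last exact: gamma_ge0 seminormD.
by rewrite mule_ge0 ?gamma_ge0// inve_ge0 lee_fin sqrtr_ge0.
Qed.

Lemma m_bound_ge0 M : (0 <= m_bound Ng Ne M)%E.
Proof.
by apply: le_ereal_inf_tmp => _ [S _ <-]; rewrite adde_ge0// gamma_ge0.
Qed.

Lemma q_bound_chained n M D (r : R) : (0 < n)%N -> (q_bound n Ng Ne M < r%:E)%E ->
  (forall v, v \in D -> M v) ->
  exists (F : seq 'rV[R]_p) (a1 a2 : R), [/\ 0 <= a1, 0 <= a2,
    chained Ne (Ng \+ Ne)%R F a1 a2, a1 / Num.sqrt n%:R + a2 < r &
    forall v, v \in D -> conv_hull [set` F] v].
Proof.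
move=> n0 /ereal_inf_lt[_ [S MS <-] hS] DM.
have b0 : 0 < Num.sqrt n%:R :> R by rewrite sqrtr_gt0 ltr0n.
have [a1 [a2 [a10 a20 h1 h2 h]]] :=
  split_lt_adde (gamma_ge0 1 S sNe) (gamma_ge0 2 S seminormD) b0 hS.
have [|F FS hF] := @conv_hull_finite_seq R p S D; first by move=> v /DM /MS.
exists F, a1, a2; split=> //; rewrite ?ltW//.
exact: (chained_gamma sNe seminormD FS a10 a20 h1 h2).
Qed.

(* If [sg = 0], the complexity may be infinite; then any chain of the finite set
   will do, since the sub-exponential scale can be taken as small as desired. *)
Lemma m_bound_chained M D (sg : \bar R) (kappa B eps : R) : 0 < kappa -> 0 < eps ->
  (0 <= sg)%E -> (sg < +oo)%E -> 0 <= B ->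
  (kappa%:E * sg * m_bound Ng Ne M <= B%:E)%E -> (forall v, v \in D -> M v) ->
  exists (F : seq 'rV[R]_p) (s a1 a2 : R), [/\ (sg < s%:E)%E, 0 < s,
    chained Ne Ng F a1 a2, kappa * s * (a1 + a2) <= B + eps &
    forall v, v \in 0 :: D -> conv_hull [set` F] v].
Proof.
move=> k0 e0 sg0 sgy B0 hB DM.
case: sg sg0 sgy hB => [s| |]//; rewrite lee_fin => s0 _ hB.
have [s00|sp] := eqVneq s 0.
  have [a a0 ch] := chained_finite sNe sNg (0 :: D).
  have ka : 0 < kappa * (a + a) by rewrite mulr_gt0// addr_gt0.
  exists (0 :: D), (eps / (kappa * (a + a))), a, a.
  have dp : 0 < eps / (kappa * (a + a)) by rewrite divr_gt0.
  split=> //; first by rewrite s00 lte_fin.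
    have -> : kappa * (eps / (kappa * (a + a))) * (a + a) = eps.
      by rewrite mulrAC mulrC divfK// gt_eqF.
    by rewrite lerDr.
  by move=> v vD A [_ SA]; apply: SA.
have {s0}sp : 0 < s by rewrite lt_neqAle eq_sym sp.
have ks : 0 < kappa * s by rewrite mulr_gt0.
have [m mE] : exists m, m_bound Ng Ne M = m%:E.
  have := m_bound_ge0 M; move: hB; case: (m_bound Ng Ne M) => [m| |]//; first by exists m.
  by rewrite -EFinM gt0_muley ?lte_fin.
have m0 : 0 <= m by rewrite -lee_fin -mE m_bound_ge0.
move: hB; rewrite mE -!EFinM lee_fin => hB.
(* Slack for both [s] and [m]: as [del <= 1], the product [(s + del) * (m + del)] exceeds [s * m] by
   at most [del * (s + m + 1)]. *)
pose del := eps / (eps + kappa * (s + m + 1)).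
have den : 0 < kappa * (s + m + 1) by rewrite mulr_gt0//; lra.
have del0 : 0 < del by rewrite divr_gt0// addr_gt0.
have del1 : del <= 1 by rewrite ler_pdivrMr ?addr_gt0// mul1r lerDl ltW.
have delk : del * (kappa * (s + m + 1)) <= eps.
  rewrite /del mulrAC ler_pdivrMr ?addr_gt0//; apply: ler_wpM2l; first exact: ltW.
  by rewrite lerDr ltW.
have : (m_bound Ng Ne M < (m + del)%:E)%E by rewrite mE lte_fin ltrDl.
move=> /ereal_inf_lt[_ [S MS <-] hS].
have [|a1 [a2 [a10 a20 h1 h2 h]]] :=
  split_lt_adde (c := 1) (r := m + del) (gamma_ge0 1 S sNe) (gamma_ge0 2 S sNg) ltr01.
  by rewrite inver oner_eq0 invr1 mule1.
have [|F FS hF] := @conv_hull_finite_seq R p S (0 :: D).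
  by move=> v; rewrite inE => /orP[/eqP ->|/DM vM]; apply: MS; [right | left].
exists F, (s + del), a1, a2; split=> //; first by rewrite lte_fin ltrDl.
- by rewrite addr_gt0.
- exact: (chained_gamma sNe sNg FS a10 a20 h1 h2).
rewrite divr1 in h.
have kd : 0 < kappa * (s + del) by rewrite mulr_gt0// addr_gt0.
apply: (@le_trans _ _ (kappa * (s + del) * (m + del))).
  by apply: ler_wpM2l; rewrite ltW.
have kdel : 0 <= kappa * del by rewrite mulr_ge0// ltW.
have := ler_wpM2l kdel del1; lra.
Qed.

End ChainData.

(** * Uniform bounds *)

Section UniformEvent.
Context d (T : measurableType d) (R : realType) (P : probability T R).
Variables (p n : nat) (Ng Ne : 'rV[R]_p -> R).
Variables (x : {RV P >-> borel_rV R p}) (y : {RV P >-> R}).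
Variables (X : 'I_n -> {RV P >-> borel_rV R p}) (Y : 'I_n -> {RV P >-> R}).
Variables (beta : 'rV[R]_p) (tau : R).
Hypotheses (n0 : (0 < n)%N) (sNg : seminorm Ng) (sNe : seminorm Ne).
Hypotheses (bx : generic_bernstein P x Ng Ne) (suby : sub_exponential P y).
Hypothesis tau0 : 0 < tau.
Hypothesis iid : independent_copies P (fun w => (x w, y w)) (fun i w => (X i w, Y i w)).

Let Z0 w : borel_rV R p * R := (x w, y w).
Let Z i w : borel_rV R p * R := (X i w, Y i w).
Let vec (z : borel_rV R p * R) : 'rV[R]_p := z.1.
Let ell (v : 'rV[R]_p) (z : borel_rV R p * R) : R := dot (vec z) v.
Let xi (z : borel_rV R p * R) : R := z.2 - dot (vec z) beta.
Let b : R := Num.sqrt n%:R.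

Let mZ0 : measurable_fun setT Z0.
Proof. by apply: measurable_fun_pair; exact: measurable_funPT. Qed.

Let mZ i : measurable_fun setT (Z i).
Proof. by apply: measurable_fun_pair; exact: measurable_funPT. Qed.

Let mvec j : measurable_fun setT (fun z => vec z ord0 j).
Proof. exact: (measurableT_comp (@measurable_coord R p j) measurable_fst). Qed.

Let mell v : measurable_fun setT (ell v).
Proof. exact: measurable_dotx. Qed.

Let mxi : measurable_fun setT xi.
Proof. by apply: measurable_funB; [exact: measurable_snd | exact: mell]. Qed.

Let ellD (c : R) u v z : ell (c *: u + v) z = c * ell u z + ell v z.
Proof. exact: dot_linear. Qed.

Let b_ge1 : 1 <= b.
Proof. by rewrite -sqrtr1 ler_sqrt// ler1n. Qed.

Let b_sqr : b ^+ 2 = n%:R.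
Proof. by rewrite sqr_sqrtr. Qed.

Let mx j : measurable_fun setT (fun w => (x w : 'rV[R]_p) ord0 j).
Proof. exact: (measurableT_comp (mvec j) mZ0). Qed.

Let tail v g e : 0 < g -> 0 < e -> Ng v <= g -> Ne v <= e ->
  forall s, 0 <= s -> (P [set w | (s <= `|ell v (Z0 w)|)%R] <=
  (2 * expR (- Num.min (s ^+ 2 / g ^+ 2) (s / e)))%:E)%E.
Proof. exact: bernstein_tail. Qed.

Lemma residual_psi1_lt : (psi1_norm P (residual x y beta) < +oo)%E.
Proof.
have [s1 hs1] : exists s1 : R, (psi1_norm P y < s1%:E)%E.
  move: suby (psi1_ge0 P y); rewrite /sub_exponential.
  by case: psi1_norm => [s| |]// _ _; exists (s + 1); rewrite lte_fin ltrDl.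
have [s10 h1] := psi1_eub (measurable_funPT y) hs1.
have [s2 s20 h2] := dot_sub_exponential sNg sNe mx bx beta.
have s0 : 0 < 2 * (s1 + s2) by lra.
apply: (@le_lt_trans _ _ (2 * (s1 + s2))%:E); last exact: ltry.
apply: eub_psi1; first exact: s0.
apply: eub_expR_sub => //; exact: measurable_dotx.
Qed.

Section Crossing.
Variable sg : R.
Hypotheses (sg0 : 0 < sg) (sgh : (psi1_norm P (residual x y beta) < sg%:E)%E).

Lemma residual_eub : eub P (fun w => expR (`|xi (Z0 w)| / sg)) 2.
Proof.
apply: (psi1_eub _ sgh).2.
by apply: measurable_funB => //; exact: measurable_dotx.
Qed.

(** The mean is linear in [v] because each coordinate product is integrable, so it is determined on
    the canonical basis. *)
Lemma cross_mean_dot v : cross_mean P Z0 xi ell v = dot (mismatch_mean P x y beta) v.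
Proof.
have ic := integrable_cross mZ0 mxi sg0 residual_eub sNg sNe mell tail.
have e w : xi (Z0 w) * ell v (Z0 w) =
    \sum_(j < p) v ord0 j * (xi (Z0 w) * ell (delta_mx ord0 j) (Z0 w)).
  rewrite /ell /dot mulr_sumr; apply: eq_bigr => j _.
  rewrite (bigD1 j)//= big1 ?addr0 => [|i ij]; first by rewrite mxE !eqxx mulr1 [RHS]mulrC -mulrA.
  by rewrite mxE /= (negbTE ij) mulr0.
rewrite /cross_mean (_ : (fun w => _) = (fun w => \sum_(j < p) v ord0 j *
  (xi (Z0 w) * ell (delta_mx ord0 j) (Z0 w)))); last exact/funext.
have [|_ ->] := @mean_sum _ _ _ P _ (index_enum 'I_p)
  (fun j w => v ord0 j * (xi (Z0 w) * ell (delta_mx ord0 j) (Z0 w))).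
  by move=> j; exact: integrableZ_real.
apply: eq_bigr => j _; rewrite meanZ// mulrC mxE; congr (_ * _).
rewrite unlock /mean; congr (fine _); apply: eq_integral => w _; congr (_%:E).
congr (_ * _); rewrite /ell /dot (bigD1 j)//= big1 ?addr0 => [|i ij].
  by rewrite mxE !eqxx mulr1.
by rewrite mxE /= (negbTE ij) mulr0.
Qed.

End Crossing.

Let mult v w : R := \sum_(k < n)
  ((Y k w - dot (X k w) beta) * dot (X k w) v - dot (mismatch_mean P x y beta) v).

Section Finite.
Variables (L : set 'rV[R]_p) (t B u : R).
Hypotheses (t0 : 0 < t) (B0 : 0 <= B) (u0 : 1000 <= u).
Hypothesis hm : ((u ^+ 2 / (t * b))%:E * psi1_norm P (residual x y beta) *
  m_bound Ng Ne L <= B%:E)%E.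

Lemma multiplier_finite (D : seq 'rV[R]_p) (eps : R) : 0 < eps ->
  (forall v, v \in D -> L (t *: v)) ->
  exists E, [/\ measurable E,
    (P E <= (33 * expR (- (b / 2)) + 6 * expR (- (u / 1000) ^+ 2))%:E)%E &
    forall w, ~ E w -> forall v, v \in D -> mult v w <= b ^+ 2 * (B + eps)].
Proof.
move=> eps0 DL; have b0 : 0 < b by exact: lt_le_trans b_ge1.
have tb : 0 < t * b by rewrite mulr_gt0.
have k0 : 0 < u ^+ 2 / (t * b).
  by rewrite divr_gt0// exprn_gt0//; move: (u0) => u0'; lra.
have [|F [sg [a1 [a2 [hsg sg0 ch ha hull]]]]] :=
  m_bound_chained (D := [seq t *: v | v <- D]) sNg sNe k0 eps0 (psi1_ge0 P _)
    residual_psi1_lt B0 hm.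
  by move=> _ /mapP[v vD ->]; exact: DL.
(* Chaining costs a factor [2 * (200 * 400 * 3) <= 1000 ^ 2]; it is absorbed by
   running the chaining at [u / 1000]. *)
have u1 : 1 <= u / 1000 by move: (u0) => u0'; lra.
have hx := residual_eub hsg.
have [s0 [E [mE PE hE]]] := multiplier_chained iid mZ0 mZ mxi sg0 b_ge1 b_sqr hx
  sNg sNe mell ellD tail u1 ch.
exists E; split=> // w /hE hw v vD.
set c := 200 * 400 * 3 * (u / 1000) ^+ 2 * sg * b * (a1 + a2) in hw.
pose W v := multiplier P Z0 Z xi ell v w.
have Wlin a u' v' : W (a *: u' + v') = a * W u' + W v'.
  exact: (multiplierD Z mZ0 mxi sg0 hx sNg sNe mell ellD tail a u' v' w).
have W0 : W 0 = 0 := multiplier0 Z mZ0 mxi sg0 hx sNg sNe mell ellD tail w.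
have WZ a u' : W (a *: u') = a * W u' by rewrite -[LHS]/(W _) -[a *: u']addr0 Wlin W0 addr0.
have WB s : W (s - s0) = W s - W s0.
  by rewrite -scaleN1r addrC Wlin mulN1r addrC.
have up : W (t *: v) <= c + W s0.
  apply: (conv_hull_linear_le Wlin) => [s sF|]; last first.
    by apply: hull; rewrite inE map_f ?orbT.
  by have := hw s sF; rewrite -/(W _) WB => /ler_normlP[_]; lra.
(* The hull contains 0 and [W 0 = 0], so [W s0 <= c]: the unknown value at the base point is
   eliminated at the price of a factor 2. *)
have lo : - W 0 <= c - W s0.
  apply: (@conv_hull_linear_le R p [set` F] (fun v => - W v)) => [a u1' v1|s sF|].
  - by rewrite Wlin; ring.
  - by have := hw s sF; rewrite -/(W _) WB => /ler_normlP[]; lra.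
  - by apply: hull; rewrite inE eqxx.
have -> : mult v w = W v.
  by apply: eq_bigr => k _; rewrite (cross_mean_dot sg0 hsg).
rewrite -(ler_pM2l t0) -WZ.
have : W (t *: v) <= 2 * c by move: up lo; rewrite W0; lra.
move=> /le_trans; apply.
have tbb : 0 <= t * b ^+ 2 by rewrite mulr_ge0// ?sqr_ge0// ltW.
have := ler_wpM2l tbb ha.
have -> : t * b ^+ 2 * (u ^+ 2 / (t * b) * sg * (a1 + a2)) = u ^+ 2 * sg * b * (a1 + a2).
  by field; rewrite !gt_eqF.
have c2 : 2 * c = 480 * 1000 / (1000 * 1000) * (u ^+ 2 * sg * b * (a1 + a2)).
  by rewrite /c; field.
(* The zero functional is at most [c] on [F], hence on the hull; the hull contains 0, which excludes
   an empty [F]. *)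
have cge : 0 <= c.
  apply: (@conv_hull_linear_le R p [set` F] (fun=> 0) c 0) => [a _ _|s sF|].
  - by rewrite mulr0 addr0.
  - exact: le_trans (normr_ge0 _) (hw s sF).
  - by apply: hull; rewrite inE eqxx.
move: cge c2; lra.
Qed.

Variables (M : set 'rV[R]_p) (Q q : R).
Hypotheses (ML : forall v, M v -> L (t *: v)) (Q0 : 0 < Q) (Q1 : Q <= 1).
Hypothesis ball : forall v, M v -> (Q%:E <= P [set w | (2 * tau <= `|dot (x w) v|)%R])%E.
Hypothesis qL : q_bound n Ng Ne L = q%:E.
Hypothesis hq : 500 * 500 * (q + t * (tau * u)) <= b * Q * (t * tau).

Let quad v w : R := \sum_(k < n) dot (X k w) v ^+ 2.

Lemma quadratic_finite (m : nat) (D : 'I_m.+1 -> 'rV[R]_p) : (forall i, M (D i)) ->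
  (P [set w | exists i, (quad (D i) w < b ^+ 2 * (tau ^+ 2 * Q / 8))%R] <=
   (expR (- u ^+ 2))%:E)%E.
Proof.
move=> DM; have b0 : 0 < b by exact: lt_le_trans b_ge1.
have q0 : 0 <= q by rewrite -lee_fin -qL q_bound_ge0.
have ttu : 0 < t * tau by rewrite mulr_gt0.
have u1 : 1 <= u by move: (u0) => u0'; lra.
(* The infimum [q] need not be attained; the excess [t * (tau * u)] is positive and already included
   in [hq]. *)
have [||F [a1 [a2 [a10 a20 ch ha hull]]]] :=
  q_bound_chained (M := L) (D := [seq t *: D i | i <- enum 'I_m.+1])
    (r := q + t * (tau * u)) sNg sNe n0.
- by rewrite qL lte_fin ltrDl mulrA mulr_gt0//; lra.
- by move=> _ /mapP[i _ ->]; exact/ML/DM.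
apply: (quadratic_lower iid mZ0 mZ mvec (coord_eub sNg sNe mx bx) sNg sNe tail
  b_sqr u1 tau0 t0 Q0 Q1 _ ch a10 a20 _ ord0).
- have : 40 * u * (t * tau) <= b * Q * (t * tau).
    apply: le_trans hq; have : 0 <= u * (t * tau) by rewrite mulr_ge0 ?ltW//; lra.
    by lra.
  by rewrite ler_pM2r.
- have h : b * a2 + a1 <= b * (q + t * (tau * u)).
    have -> : b * a2 + a1 = b * (a1 / b + a2) by rewrite mulrDr mulrCA divff ?gt_eqF// mulr1 addrC.
    by rewrite ler_wpM2l// ltW.
  have := ler_wpM2l (ltW b0) hq; lra.
- by move=> i; apply: hull; apply/mapP; exists i; rewrite ?mem_enum.
- by move=> i; exact: ball.
Qed.

(** The events [bad m] concern the first [m + 1] directions of a dense sequence, with slack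
    [1 / (m + 1)] on the multiplier side. They increase, and the bound on their probability does not
    depend on [m], so it passes to the union. A violation at an arbitrary direction is a strict
    inequality for continuous functions, hence occurs at some member of the sequence. *)
Lemma uniform_event v0 : M v0 ->
  exists E, [/\ measurable E,
    (P E <= (40 * (expR (- (u / 1000) ^+ 2) + expR (- (b / 2))))%:E)%E &
    forall w, ~ E w -> forall v, M v ->
      b ^+ 2 * (tau ^+ 2 * Q / 8) <= quad v w /\ mult v w <= b ^+ 2 * B].
Proof.
move=> /dense_sequence[D DM dense].
pose A i := [set w | quad (D i) w < b ^+ 2 * (tau ^+ 2 * Q / 8)].
pose C (m i : nat) := [set w | b ^+ 2 * (B + m.+1%:R^-1) < mult (D i) w].
pose bad m := \bigcup_(i in `I_m.+1) (A i `|` C m i).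
have mdot (k : 'I_n) v : measurable_fun setT (fun w => dot (X k w) v).
  exact: (measurableT_comp (mell v) (mZ k)).
have mA i : measurable (A i).
  rewrite [A i](_ : _ = ~` [set w | b ^+ 2 * (tau ^+ 2 * Q / 8) <= quad (D i) w]).
    apply: measurableC; apply: measurable_ge; apply: measurable_sum => k.
    by apply: measurable_funX; exact: mdot.
  by apply/seteqP; split=> w; rewrite /A /= ltNge => /negP.
have mC m i : measurable (C m i).
  apply: measurable_gt; apply: measurable_sum => k; apply: measurable_funB; last exact: measurable_cst.
  apply: measurable_funM; last exact: mdot.
  by apply: measurable_funB; [exact: measurable_funPT | exact: mdot].
have mbad m : measurable (bad m).
  by apply: bigcup_measurable => i _; exact: measurableU.
have Pbad m : (P (bad m) <= (40 * (expR (- (u / 1000) ^+ 2) + expR (- (b / 2))))%:E)%E.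
  have [||E [mE PE hE]] := multiplier_finite (D := [seq D i | i <- iota 0 m.+1])
    (eps := m.+1%:R^-1).
  - by rewrite invr_gt0 ltr0n.
  - by move=> _ /mapP[i _ ->]; exact/ML/DM.
  pose A' := [set w | exists i : 'I_m.+1, quad (D i) w < b ^+ 2 * (tau ^+ 2 * Q / 8)].
  have mA' : measurable A'.
    rewrite [A'](_ : _ = \bigcup_(i in `I_m.+1) A i).
      by apply: bigcup_measurable => i _; exact: mA.
    apply/seteqP; split=> w /= => [[i hi]|[i im hi]]; first by exists i => //=.
    by exists (Ordinal im).
  have PA' : (P A' <= (expR (- u ^+ 2))%:E)%E by exact: quadratic_finite.
  apply: (@le_trans _ _ (P (A' `|` E))).
    apply: le_measure; rewrite ?inE; [exact: mbad | exact: measurableU |].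
    move=> w [i im [Ai|Ci]]; [by left; exists (Ordinal im) | right].
    apply: contrapT => /hE /(_ (D i)); rewrite map_f ?mem_iota// => /(_ isT).
    by rewrite leNgt Ci.
  apply: (le_trans (measureU2 P mA' mE)).
  apply: (le_trans (leeD PA' PE)); rewrite -EFinD lee_fin.
  have : expR (- u ^+ 2) <= expR (- (u / 1000) ^+ 2).
    have [h1 h2 h3] : [/\ 0 <= u / 1000, u / 1000 <= u & 0 <= u].
      by move: (u0) => u0'; split; lra.
    by rewrite ler_expR lerN2; exact: lerXn2r h1 h3 h2.
  have := expR_ge0 (- (u / 1000) ^+ 2); have := expR_ge0 (- (b / 2)); lra.
exists (\bigcup_m bad m); split.
- by apply: bigcup_measurable => m _; exact: mbad.
- have nd : nondecreasing_seq bad.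
    move=> m m' mm'; apply/subsetPset => w [i im hi]; exists i; first exact: leq_trans im _.
    case: hi => [Ai|Ci]; [by left | right].
    apply: le_lt_trans Ci; apply: ler_wpM2l; first exact: sqr_ge0.
    by rewrite lerD2l lef_pV2 ?posrE ?ltr0n// ler_nat.
  have cv := nondecreasing_cvg_mu (mu := P) mbad (bigcup_measurable (fun m _ => mbad m)) nd.
  rewrite -(cvg_lim (@ereal_hausdorff R) cv); apply: lime_le; first exact: cvgP cv.
  by apply: nearW => m; exact: Pbad.
move=> w nE v Mv; split; rewrite leNgt; apply/negP => h; apply: nE.
- have [|i hi] := dense_open_hit (f := quad^~ w) (D := D) _ h (dense v Mv).
    apply: continuous_sum_fun => k v1; have c := @continuous_dot R p (X k w) v1.
    exact: (cvgM c c).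
  by exists i => //; exists i; [exact: ltnSn | left].
pose a k : 'rV[R]_p := mismatch_mean P x y beta - (Y k w - dot (X k w) beta) *: (X k w : 'rV[R]_p).
have multE v1 : - mult v1 w = \sum_(k < n) dot (a k) v1.
  rewrite /mult -sumrN; apply: eq_bigr => k _.
  have -> : a k = - (Y k w - dot (X k w) beta) *: (X k w : 'rV[R]_p) + mismatch_mean P x y beta.
    by rewrite /a addrC scaleNr.
  by rewrite [RHS]dotC dot_linear ![dot v1 _]dotC; ring.
have [m hm'] : exists m, b ^+ 2 * (B + m.+1%:R^-1) < mult v w.
  have b2 : 0 < b ^+ 2 by rewrite b_sqr ltr0n.
  have dl : 0 < mult v w / b ^+ 2 - B by rewrite subr_gt0 ltr_pdivlMr// mulrC.
  exists (Num.truncn (mult v w / b ^+ 2 - B)^-1).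
  rewrite mulrC -ltr_pdivlMr// addrC -ltrBrDr.
  by rewrite -[ltRHS]invrK ltf_pV2 ?posrE ?invr_gt0 ?ltr0n// truncnS_gt.
have [||i hi] := dense_open_hit (f := fun v1 => \sum_(k < n) dot (a k) v1) (D := D)
    (c := - (b ^+ 2 * (B + m.+1%:R^-1))) _ _ (dense v Mv).
- by apply: continuous_sum_fun => k; exact: continuous_dot.
- by rewrite -multE ltrN2.
(* The index must be large enough to include direction [i] and to have slack at most
   [1 / (m + 1)]. *)
exists (maxn i m) => //; exists i; first by rewrite /= ltnS leq_maxl.
right; move: hi; rewrite -multE ltrN2; apply: le_lt_trans.
apply: ler_wpM2l; first exact: sqr_ge0.
by rewrite lerD2l lef_pV2 ?posrE ?ltr0n// ler_nat ltnS leq_maxr.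
Qed.

End Finite.
End UniformEvent.

(** * The theorem *)

Section Conditions.
Variables (R : realType) (p n : nat) (Ng Ne : 'rV[R]_p -> R).
Variables (K : set 'rV[R]_p) (beta : 'rV[R]_p) (tau Q u t : R).
Hypotheses (n0 : (0 < n)%N) (sNg : seminorm Ng) (sNe : seminorm Ne).
Hypotheses (tau0 : 0 < tau) (Q0 : 0 < Q) (u0 : 0 < u) (t0 : 0 <= t).
Let L := local_set K beta t.
Let s : R := scale_of t.
Let b : R := Num.sqrt n%:R.

Let s0 : 0 < s. Proof. exact: scale_of_gt0. Qed.
Let b0 : 0 < b. Proof. by rewrite sqrtr_gt0 ltr0n. Qed.

Lemma q_complexityE : q_complexity n Ng Ne t (translate K beta) =
  ((s^-1)%:E * q_bound n Ng Ne L)%E.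
Proof.
rewrite /q_complexity /L /local_set /s /scale_of; case: ifP => // _.
by rewrite invr1 mul1e.
Qed.

Lemma m_complexityE : m_complexity Ng Ne t (translate K beta) =
  ((s^-1)%:E * m_bound Ng Ne L)%E.
Proof.
rewrite /m_complexity /L /local_set /s /scale_of; case: ifP => // _.
by rewrite invr1 mul1e.
Qed.

(** An infinite complexity would make the left-hand side infinite, against the finite sample size;
    for a finite one, the square root of the condition is taken and denominators are cleared. *)
Lemma sample_size_condition (c : R) : 0 < c ->
  ((c ^+ 2)%:E * ((q_complexity n Ng Ne t (translate K beta) + (tau * u)%:E)
     / (tau%:E * Q%:E)) ^+ 2 <= n%:R%:E)%E ->
  exists2 q : R, q_bound n Ng Ne L = q%:E &
    c * (q + s * (tau * u)) <= b * Q * (s * tau).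
Proof.
move=> c0; rewrite q_complexityE -EFinM inver gt_eqF ?mulr_gt0//.
have := q_bound_ge0 sNg sNe n L.
have tQ : 0 < tau * Q by rewrite mulr_gt0.
have c2 : 0 < c ^+ 2 by rewrite exprn_gt0.
case: (q_bound n Ng Ne L) => [q| |]//; rewrite ?lee_fin => q0 h.
  exists q => //; move: h.
  rewrite -expr2 => h.
  have bn : b ^+ 2 = n%:R by rewrite sqr_sqrtr.
  move: h; rewrite -bn -exprMn => h.
  have {}h : c * ((s^-1 * q + tau * u) / (tau * Q)) <= b.
    rewrite leNgt; apply/negP => lt; move: h; rewrite leNgt => /negP; apply.
    by rewrite ltrXn2r// ltW.
  have {}h : c * (s^-1 * q + tau * u) <= b * (tau * Q) by rewrite -ler_pdivrMr// -mulrA.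
  have -> : c * (q + s * (tau * u)) = s * (c * (s^-1 * q + tau * u)).
    by field; rewrite gt_eqF.
  apply: le_trans (ler_wpM2l (ltW s0) h) _; rewrite le_eqVlt; apply/orP; left; apply/eqP; ring.
exfalso; move: h; rewrite gt0_muley ?lte_fin ?invr_gt0// addye// gt0_mulye ?lte_fin ?invr_gt0//.
by rewrite expe2 mulyy gt0_muley ?lte_fin.
Qed.

(** The radius is finite, so neither summand is infinite. The product is kept as one number [B]: for
    [sg = 0] it is finite even if the complexity is not. *)
Lemma radius_condition (c : R) (rho sg : \bar R) : 0 < c -> (-oo < rho)%E -> (0 <= sg)%E ->
  (c%:E * ((tau%:E * Q%:E) ^+ 2)^-1 * maxe (rho + (u ^+ 2)%:E * sg *
     (m_complexity Ng Ne t (translate K beta) / b%:E)) 0 <= t%:E)%E ->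
  exists r B : R, [/\ rho = r%:E, 0 <= B,
    ((u ^+ 2 / (s * b))%:E * sg * m_bound Ng Ne L <= B%:E)%E &
    c * (r + B) <= t * (tau * Q) ^+ 2].
Proof.
move=> c0 rho0 sg0.
have tQ : 0 < tau * Q by rewrite mulr_gt0.
have tQ2 : 0 < (tau * Q) ^+ 2 by rewrite exprn_gt0.
have d0 : 0 < c * ((tau * Q) ^+ 2)^-1 by rewrite divr_gt0.
have -> : ((u ^+ 2)%:E * sg * (m_complexity Ng Ne t (translate K beta) / b%:E) =
    (u ^+ 2 / (s * b))%:E * sg * m_bound Ng Ne L)%E.
  rewrite m_complexityE inver gt_eqF// invfM; move: (u ^+ 2) => u2.
  rewrite !EFinM -!muleA; congr (_ * _)%E.
  by rewrite muleCA; congr (_ * _)%E; rewrite muleA muleC.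
rewrite -EFinM -EFin_expe inver gt_eqF// -EFinM.
have : (0 <= (u ^+ 2 / (s * b))%:E * sg * m_bound Ng Ne L)%E.
  rewrite mule_ge0 ?m_bound_ge0// mule_ge0// lee_fin divr_ge0 ?sqr_ge0// ltW// mulr_gt0//.
move: (_ * m_bound _ _ _)%E => B B0 h.
have : (maxe (rho + B) 0 < +oo)%E.
  rewrite ltey; apply/eqP => e; move: h; rewrite e gt0_muley ?lte_fin//.
have : (rho + B <= maxe (rho + B) 0)%E by rewrite le_max lexx.
move=> h1 /(le_lt_trans h1){h1} h2.
case: B B0 h h2 => [B| |]// B0 h; last by rewrite addey ?ltxx// gt_eqF.
case: rho rho0 h => [r| |]// _ h _.
exists r, B; split=> //.
move: h; rewrite -EFinD -EFin_max -EFinM lee_fin.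
rewrite mulrAC ler_pdivrMr// => /(le_trans _); apply.
by apply: ler_wpM2l; [exact: ltW | rewrite le_max lexx].
Qed.

End Conditions.

Lemma minimizer_close (R : realType) (p n : nat) (X : 'I_n -> 'rV[R]_p) (Y : 'I_n -> R)
    (K : set 'rV[R]_p) (beta bhat mm : 'rV[R]_p) (t tau Q r B : R) :
  (0 < n)%N -> convex_set K -> K beta -> 0 <= t -> 0 < tau -> 0 < Q ->
  (forall v, normalized_set K beta t v ->
    [/\ dot mm v <= r, n%:R * (tau ^+ 2 * Q / 8) <= \sum_(k < n) dot (X k) v ^+ 2 &
     \sum_(k < n) ((Y k - dot (X k) beta) * dot (X k) v - dot mm v) <= n%:R * B]) ->
  16 * (r + B) <= t * (tau * Q) ^+ 2 -> Q <= 1 ->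
  minimizer K (empirical_risk X Y) bhat -> norm2 (bhat - beta) <= t.
Proof.
move=> n0 cK Kb t0 tau0 Q0 hv hrB Q1 hmin; rewrite leNgt; apply/negP => tr.
have [v [Mv hd]] := minimizer_direction cK Kb n0 t0 tr hmin.
have [hr hq hm] := hv v Mv.
set N := norm2 _ in tr hd.
have n0' : 0 < n%:R :> R by rewrite ltr0n.
have N0 : 0 < N by exact: le_lt_trans tr.
have tQ : 0 < tau ^+ 2 * Q by rewrite mulr_gt0// exprn_gt0.
rewrite sumrB sumr_const card_ord -[_ *+ n]mulr_natl in hm.
have h1 : N * (n%:R * (tau ^+ 2 * Q / 8)) <= 2 * (n%:R * (r + B)).
  have h2 := ler_wpM2l (ltW n0') hr.
  by apply: le_trans (ler_wpM2l (ltW N0) hq) (le_trans hd _); lra.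
have h3 : N * (tau ^+ 2 * Q) <= 16 * (r + B).
  by rewrite -(ler_pM2l n0'); lra.
(* The radius condition carries [Q^2] and the quadratic bound [Q]; they are compared through
   [Q <= 1]. *)
have h4 : t * (tau * Q) ^+ 2 <= t * (tau ^+ 2 * Q).
  by rewrite exprMn; apply: ler_wpM2l => //; apply: ler_wpM2l; [exact: sqr_ge0 | by rewrite expr2 ler_piMr// ltW].
have := le_trans h3 (le_trans hrB h4).
by rewrite ler_pM2r// leNgt tr.
Qed.

Lemma failure_probability (R : realType) (e u b : R) : 0 <= b -> e <= 1 ->
  e <= 40 * (expR (- (u / 1000) ^+ 2) + expR (- (b / 2))) ->
  1 - 5 * expR (- ((32 * (1000 * 1000))^-1 * u ^+ 2)) -
    2 * expR (- ((32 * (1000 * 1000))^-1 * b)) <= 1 - e.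
Proof.
move=> b0 e1 he; have b20 : 0 <= b / 2 by lra.
have := tail_constants (sqr_ge0 (u / 1000)) b20 e1 he.
have -> : (u / 1000) ^+ 2 / 32 = (32 * (1000 * 1000))^-1 * u ^+ 2 by field.
have : expR (- (b / 2 / 32)) <= expR (- ((32 * (1000 * 1000))^-1 * b)).
  by rewrite ler_expR lerN2; lra.
lra.
Qed.

Theorem theorem2p10 (R : realType) :
  exists C C1 C2 : R, [/\ 0 < C, 0 < C1 & 0 < C2] /\
  forall (p n : nat) (Ng Ne : 'rV[R]_p -> R)
    (d : measure_display) (T : measurableType d) (P : probability T R)
    (x : {RV P >-> borel_rV R p}) (y : {RV P >-> R})
    (K : set 'rV[R]_p) (tau : R)
    (X : 'I_n -> {RV P >-> borel_rV R p}) (Y : 'I_n -> {RV P >-> R})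
    (beta : 'rV[R]_p),
  let Kdelta := span_hull (set_diff K) `&` sphere R p in
  let Q := small_ball P (2 * tau) Kdelta x in
  (0 < n)%N ->
  seminorm Ng -> seminorm Ne ->
  generic_bernstein P x Ng Ne ->
  sub_exponential P y ->
  convex_set K ->
  0 < tau -> (0 < Q)%E ->
  independent_copies P (fun w => (x w, y w)) (fun i w => (X i w, Y i w)) ->
  K beta ->
  forall u t : R, 8 <= u -> 0 <= t ->
  exists E : set T,
    [/\ measurable E,
        ((1 - 5 * expR (- (C * u ^+ 2)) - 2 * expR (- (C * Num.sqrt n%:R)))%:E
           <= P E)%E
      & forall w, E w ->
        (C1%:E * ((q_complexity n Ng Ne t (translate K beta) + (tau * u)%:E)
                  / (tau%:E * Q)) ^+ 2 <= n%:R%:E)%E ->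
        (C2%:E * ((tau%:E * Q) ^+ 2)^-1
           * maxe (rho_mismatch P x y K beta t
                   + (u ^+ 2)%:E * sigma_mismatch P x y beta
                     * (m_complexity Ng Ne t (translate K beta)
                        / (Num.sqrt n%:R)%:E)) 0 <= t%:E)%E ->
        forall bhat : 'rV[R]_p,
          minimizer K (empirical_risk (fun i => X i w) (fun i => Y i w)) bhat ->
          norm2 (bhat - beta) <= t].
Proof.
(* [C] combines the 32 of [tail_constants] with the replacement of [u] by [u / 1000]; [C1] is a
   square because the sample size condition is used after taking roots; [C2 = 2 * 8], from the cross
   term of the risk and the 8 in the quadratic bound. *)
exists (32 * (1000 * 1000))^-1, ((500 * 500) ^+ 2), 16; split.
  by split; rewrite ?invr_gt0 ?exprn_gt0 ?mulr_gt0 ?ltr0n.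
move=> p n Ng Ne d T P x y K tau X Y beta Kdelta Q n0 sNg sNe bx suby cK tau0 Q0 iid Kb u t u8 t0.
set b : R := Num.sqrt n%:R.
set pr : R := 1 - _ - _.
have u0 : 0 < u by lra.
have b1 : 1 <= b by rewrite -sqrtr1 ler_sqrt// ler1n.
have [ee eb] : 0 <= expR (- ((32 * (1000 * 1000))^-1 * u ^+ 2)) /\
  0 <= expR (- ((32 * (1000 * 1000))^-1 * b)) by split; exact: expR_ge0.
have pr1 : pr <= 1 by rewrite /pr; move: ee eb; lra.
(* For [u < 1000] the claimed probability is not positive, since [5 * (1 - 1/32) > 1], and the empty
   event will do. *)
have [u1000|u1000] := ltP u 1000.
  exists set0; split=> //; rewrite measure0 lee_fin.
  have : 1 - 1 / 32 <= expR (- ((32 * (1000 * 1000))^-1 * u ^+ 2)).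
    apply: le_trans (expR_ge1Dx _); rewrite lerD2l lerN2.
    have : u * u <= 1000 * 1000 by apply: ler_pM => //; exact: ltW.
    by rewrite expr2; lra.
  by move: eb; rewrite /pr; lra.
set c1 := (X in (X <= n%:R%:E)%E).
(* The two conditions do not involve [w]; if one of them fails, the whole space is a valid event. *)
have [h1|nh1] := pselect (c1 <= n%:R%:E)%E; last first.
  by exists setT; split=> //; rewrite probability_setT lee_fin.
set c2 := (X in (X <= t%:E)%E).
have [h2|nh2] := pselect (c2 <= t%:E)%E; last first.
  by exists setT; split=> //; rewrite probability_setT lee_fin.
(* Without directions no minimizer can be farther than [t]. With one, the small-ball infimum is over
   a nonempty set, hence at most 1, and [rho_mismatch] is not [-oo]. *)
have [[v0 Mv0]|empty] := pselect (normalized_set K beta t !=set0); last first.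
  exists setT; split=> //; first by rewrite probability_setT lee_fin.
  move=> w _ _ _ bhat hmin; rewrite leNgt; apply/negP => tr.
  by have [v [Mv _]] := minimizer_direction cK Kb n0 t0 tr hmin; apply: empty; exists v.
have ball v : normalized_set K beta t v -> (Q <= P [set w | (2 * tau <= `|dot (x w) v|)%R])%E.
  by move=> /(normalized_sub_span Kb) Kv; apply: ereal_inf_lbound; exists v; [exact: Kv | reflexivity].
have [Qr QE Q1] : exists2 Qr, Q = Qr%:E & Qr <= 1.
  have : (Q <= 1)%E.
    apply: (le_trans (ball _ Mv0)); apply: probability_le1; apply: measurable_ge.
    apply: measurableT_comp => //; apply: measurable_dotx => j.
    exact: (measurableT_comp (@measurable_coord R p j) (measurable_funPT x)).
  move: Q0; case: (Q) => [Qr| |]// _; rewrite lee_fin => Q1; first by exists Qr.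
have Qr0 : 0 < Qr by rewrite -lte_fin -QE.
have [q qE hq] : exists2 q : R, q_bound n Ng Ne (local_set K beta t) = q%:E &
    500 * 500 * (q + scale_of t * (tau * u)) <= b * Qr * (scale_of t * tau).
  have c0 : 0 < 500 * 500 :> R by rewrite mulr_gt0 ?ltr0n.
  move: h1; rewrite /c1 QE => h1'.
  exact: (sample_size_condition n0 sNg sNe tau0 Qr0 t0 c0 h1').
have sg0 : (0 <= sigma_mismatch P x y beta)%E by exact: psi1_ge0.
have rho0 : (-oo < rho_mismatch P x y K beta t)%E.
  apply: (@lt_le_trans _ _ (dot (mismatch_mean P x y beta) v0)%:E); first exact: ltNyr.
  by apply: ereal_sup_ubound; exists v0.
have [r [B [rE B0 hm hrB]]] : exists r B : R, [/\ rho_mismatch P x y K beta t = r%:E, 0 <= B,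
    ((u ^+ 2 / (scale_of t * b))%:E * sigma_mismatch P x y beta *
      m_bound Ng Ne (local_set K beta t) <= B%:E)%E &
    16 * (r + B) <= t * (tau * Qr) ^+ 2].
  have c0 : 0 < 16 :> R by rewrite ltr0n.
  move: h2; rewrite /c2 QE => h2'.
  exact: (radius_condition n0 sNg sNe tau0 Qr0 t0 c0 rho0 sg0 h2').
have [|E [mE PE hE]] := uniform_event (M := normalized_set K beta t) n0 sNg sNe bx suby tau0 iid
  (scale_of_gt0 t0) B0 u1000 hm (@normalized_local _ _ K beta t) Qr0 Q1 _ qE hq Mv0.
  by move=> v /ball; rewrite QE.
have bn : b ^+ 2 = n%:R by rewrite sqr_sqrtr.
exists (~` E); split; first exact: measurableC.
- rewrite probability_setC//.
  have [e eE] : exists e : R, P E = e%:E.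
    by exists (fine (P E)); rewrite fineK// fin_num_measure.
  have e1 : e <= 1 by rewrite -lee_fin -eE; exact: probability_le1.
  move: PE; rewrite eE -EFinB !lee_fin => PE.
  by apply: failure_probability => //; exact: sqrtr_ge0.
move=> w nE _ _ bhat hmin.
apply: (minimizer_close n0 cK Kb t0 tau0 Qr0 _ hrB Q1 hmin) => v Mv.
have [h3 h4] := hE w nE v Mv; split; rewrite -?bn; [|exact: h3|exact: h4].
by rewrite -lee_fin -rE; apply: ereal_sup_ubound; exists v.
Qed.
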